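(* There is a positive constant $C$ such that for every $r\in[0,\tfrac12)$, $$N(r)\le C\left(\tfrac12-r\right)^{-4/5}.$$ Consequently, every assemblage generated from $\omega_r$ by projective measurements on Alice's qubit admits an LHS model of size at most $C(\tfrac12-r)^{-4/5}$.
   Context: Qubit POVM: finite family $\{\Pi_i\}_{i=1}^n$ of positive semidefinite operators summing to $\mathbb{I}$; it simulates $\{M_{a|x}\}$ if $M_{a|x}=\sum_i p(a|x,i)\Pi_i$ with $p(a|x,i)\ge0$, $\sum_a p(a|x,i)=1$. $\mathcal{P}_r$: the two-outcome POVMs $\{\tfrac12(\mathbb{I}\pm r\hat n\cdot\vec\sigma)\}$ over all unit $\hat n\in\mathbb{R}^3$. $N(r)$: smallest $n$ such that some $n$-outcome qubit POVM simulates $\mathcal{P}_r$. $\omega_r=r|\Psi^-\rangle\langle\Psi^-|+(1-r)\mathbb{I}\otimes\mathbb{I}/4$, $|\Psi^-\rangle=(|01\rangle-|10\rangle)/\sqrt2$. The assemblage generated from $\rho_{AB}$ by POVMs $\{M_{a|x}\}$ on $A$ is $\sigma_{a|x}=\mathrm{Tr}_A[(M_{a|x}\otimes\mathbb{I})\rho_{AB}]$; an LHS model of size $n$ is a distribution $p(i)$ on $\{1,\dots,n\}$, states $\rho_i$ on $B$ and $p(a|x,i)$ with $\sigma_{a|x}=\sum_{i=1}^n p(a|x,i)p(i)\rho_i$. *)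

(* Defs.v *)
From HB Require Import structures.
From mathcomp Require Import all_boot all_order all_algebra.
From mathcomp Require Import all_classical all_reals all_analysis.
From mathcomp Require Import complex mxtens.
Set Implicit Arguments. Unset Strict Implicit. Unset Printing Implicit Defensive.
Import Order.TTheory GRing.Theory Num.Theory.
Local Open Scope ring_scope.
Local Open Scope complex_scope.

Section Qubits.
Variable R : realType.
Local Notation C := (R[i]).

Definition adjmx {m n} (A : 'M[C]_(m, n)) : 'M[C]_(n, m) := (map_mx (@conjc R) A)^T.

Definition psd {n} (A : 'M[C]_n) : Prop :=
  adjmx A = A /\ forall v : 'cV[C]_n, 0 <= (adjmx v *m A *m v) 0 0.

Definition povm {n} (Pi : 'I_n -> 'M[C]_2) : Prop :=
  (forall i, psd (Pi i)) /\ \sum_(i < n) Pi i = 1%:M.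

Definition simulates {n} (Pi : 'I_n -> 'M[C]_2) {X : Type} {A : finType}
    (M : X -> A -> 'M[C]_2) : Prop :=
  exists p : X -> A -> 'I_n -> R,
    (forall x a i, 0 <= p x a i) /\
    (forall x i, \sum_(a : A) p x a i = 1) /\
    (forall x a, M x a = \sum_(i < n) (p x a i)%:C *: Pi i).

Definition pauli_dot (v : R * R * R) : 'M[C]_2 :=
  let: (n1, n2, n3) := v in
  \matrix_(i < 2, j < 2)
    if i == j then (if i == 0 then n3%:C else (- n3)%:C)
    else (if i == 0 then Complex n1 (- n2) else Complex n1 n2).

Definition unit3 (v : R * R * R) : Prop :=
  let: (n1, n2, n3) := v in n1 ^+ 2 + n2 ^+ 2 + n3 ^+ 2 = 1.

Definition unitvec := {v : R * R * R | unit3 v}.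

Definition Pr (r : R) (x : unitvec) (a : bool) : 'M[C]_2 :=
  (2^-1)%:C *: (1%:M + ((if a then r else - r)%:C) *: pauli_dot (sval x)).

Definition simulable (r : R) (n : nat) : Prop :=
  exists Pi : 'I_n -> 'M[C]_2, povm Pi /\ simulates Pi (Pr r).

(* N(r): the smallest n such that some n-outcome qubit POVM simulates P_r
   (set to 0 by convention when no finite POVM simulates P_r; the theorem
   separately asserts that one exists). *)
Definition Nmin (r : R) : nat :=
  match pselect (exists n, `[< simulable r n >]) with
  | left h => ex_minn h
  | right _ => 0%N
  end.

(* two-qubit objects; first tensor factor = Alice *)
Definition Psi_minus : 'cV[C]_(2 * 2) :=
  ((Num.sqrt (2 : R))^-1)%:C *:
    (delta_mx (mxtens_index (0 : 'I_2, 1 : 'I_2)) 0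
     - delta_mx (mxtens_index (1 : 'I_2, 0 : 'I_2)) 0).

Definition omega (r : R) : 'M[C]_(2 * 2) :=
  r%:C *: (Psi_minus *m adjmx Psi_minus) + ((1 - r) / 4)%:C *: 1%:M.

Definition ptrA (Y : 'M[C]_(2 * 2)) : 'M[C]_2 :=
  \matrix_(b < 2, b' < 2) \sum_(a < 2) Y (mxtens_index (a, b)) (mxtens_index (a, b')).

Definition assemblage (rho : 'M[C]_(2 * 2)) {X : Type} {A : finType}
    (M : X -> A -> 'M[C]_2) (x : X) (a : A) : 'M[C]_2 :=
  ptrA ((M x a *t (1%:M : 'M[C]_2)) *m rho).

Definition projective {X : Type} {A : finType} (M : X -> A -> 'M[C]_2) : Prop :=
  (forall x a, adjmx (M x a) = M x a /\ M x a *m M x a = M x a) /\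
  (forall x, \sum_(a : A) M x a = 1%:M).

Definition density (rho : 'M[C]_2) : Prop := psd rho /\ \tr rho = 1.

Definition LHS_model (n : nat) {X : Type} {A : finType}
    (sigma : X -> A -> 'M[C]_2) : Prop :=
  exists (p : 'I_n -> R) (rho : 'I_n -> 'M[C]_2) (q : X -> A -> 'I_n -> R),
    (forall i, 0 <= p i) /\ \sum_(i < n) p i = 1 /\
    (forall i, density (rho i)) /\
    (forall x a i, 0 <= q x a i) /\ (forall x i, \sum_(a : A) q x a i = 1) /\
    (forall x a, sigma x a = \sum_(i < n) (q x a i * p i)%:C *: rho i).

End Qubits.

(* Main.v *)
Require Import Defs.
From HB Require Import structures.
From mathcomp Require Import all_boot all_order all_algebra.
From mathcomp Require Import all_classical all_reals all_analysis.
From mathcomp Require Import complex mxtens ring lra zify.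
Set Implicit Arguments. Unset Strict Implicit. Unset Printing Implicit Defensive.
Import Order.TTheory GRing.Theory Num.Theory.
Local Open Scope ring_scope.

(** The POVM with effects [(w_i / 2) (1 +- v_i . sigma)] simulates [Pr r] as soon
    as the zonotope spanned by the segments [w_i [-v_i, v_i]] contains the ball of
    radius [r], that is, as soon as its width [sum_i w_i |<v_i, m>|] is at least
    [r] in every unit direction [m]. So it suffices to approximate the ball, whose
    width is 1/2, to within [O(n^(-5/4))] by [n] weighted unit vectors of total
    weight 1.

    Start from a very fine equal-area grid and delete points scale by scale. At
    scale [2^-k] the sphere is cut into [O(4^k)] cells. Five points of one cell
    admit a nonzero signed change of their weights that preserves their total
    weight and their barycentre; it alters the width in direction [m] only if the
    great circle orthogonal to [m] crosses the cell, which happens for [O(2^k)]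
    cells, and then by [O(2^-k 4^-k)]. Choosing the signs of these changes by a
    partial colouring makes the errors add up like independent ones, to
    [O(2^(k/2) 2^(-3k)) = O(2^(-5k/2))], while a fixed proportion of the clusters
    loses a point. The directions are handled along a chain of nets: the errors of
    the increments decrease geometrically, so that the partial colouring can meet
    all constraints without a logarithmic loss. The errors of all scales form a
    geometric series dominated by the last one. *)

(** * Partial colourings *)

Section PartialColoring.
Variable R : realType.

(** The obstacle is that all directions must be controlled at once: random signs with a union bound
    over [O(4^k)] or more directions would lose a power of [k] at every scale. The partial colouring
    pays for a constraint at [lam] standard deviations only about [expR (- lam ^ 2 / 8)], and the
    sum of these costs may be as large as a fixed fraction of the number of clusters. Chain level
    [l] has [O(4^(k+l))] directions but standard deviations smaller by [2^-l], so thresholds growing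
    linearly in [l] are affordable: the cost decays faster than [4^l] grows, leaving [O(4^k)], the
    order of the number of clusters.

    Two invariants allow iteration. Cell masses never change, so their bounds, proved once for the
    grid, hold at all coarser scales. A change never exceeds the weight it modifies and equals it at
    one point of each cluster; the colour -1 keeps weights nonnegative and deletes that point.

    For the grid, mere convergence of the width is enough: it may be as fine as desired in terms of
    [k], because even the many rounds at its own scale cost little. In the end [4^k] points leave a
    gap of order [(4^k)^(-5/4)], whence the exponent 4/5. *)

Lemma expR_cosh_le (y : R) : expR y + expR (- y) <= 2 * expR (y ^+ 2).
Proof.
have [y1|y1] := lerP 1 `|y|.
  have h : `|y| <= y ^+ 2 by rewrite -real_normK ?num_real // ler_eXnr.
  have a : expR y <= expR (y ^+ 2) by rewrite ler_expR (le_trans (ler_norm _) h).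
  have b : expR (- y) <= expR (y ^+ 2).
    by rewrite ler_expR (le_trans _ h) // -normrN ler_norm.
  by rewrite mulr2n mulrDl !mul1r lerD.
(* Both exponentials are bounded by [expR (2 * z) <= (1 - z) ^- 2], a consequence of
   [1 - z <= expR (- z)], and the right side is bounded below by its tangent; no power series is
   expanded. *)
pose u := y / 2.
have uy : y = u *+ 2 by rewrite /u; lra.
have /andP[u1 u2] : - 2^-1 < u < 2^-1.
  by rewrite -ltr_norml /u normrM [X in _ * X]ger0_norm; lra.
have half (z : R) : z < 1 -> expR (z *+ 2) <= (1 - z) ^- 2.
  move=> z1; rewrite -mulr_natl expRM_natl -exprVn lerXn2r ?nnegrE ?expR_ge0 //.
    by rewrite invr_ge0; lra.
  rewrite -[z in expR z]opprK expRN lef_pV2 ?posrE ?expR_gt0 ?subr_gt0 //.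
  exact: expR_ge1Dx.
have hp := half u ltac:(lra); rewrite -uy in hp; have := half (- u) ltac:(lra).
rewrite mulNrn -uy opprK => hm.
apply: (le_trans (lerD (hp) hm)).
have u4 : u ^+ 2 <= 4^-1 by rewrite expr2; nra.
have u0 : 0 <= u ^+ 2 by rewrite sqr_ge0.
have -> : (1 - u) ^- 2 + (1 + u) ^- 2 = 2 * ((1 + u ^+ 2) / (1 - u ^+ 2) ^+ 2).
  by field; apply/andP; split; [|apply/andP; split]; apply/eqP; nra.
rewrite ler_pM2l // ler_pdivrMr; last by rewrite exprn_gt0 //; lra.
have -> : y ^+ 2 = 2 * u ^+ 2 *+ 2 by rewrite uy; ring.
rewrite -mulr_natl expRM_natl -exprMn.
have [E0 E1] : 0 <= expR (2 * u ^+ 2) /\ 1 + 2 * u ^+ 2 <= expR (2 * u ^+ 2).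
  by rewrite expR_ge0 expR_ge1Dx.
apply: (@le_trans _ _ (((1 + 2 * u ^+ 2) * (1 - u ^+ 2)) ^+ 2)).
  set w := u ^+ 2 in u4 u0 *; rewrite !expr2; nra.
by rewrite lerXn2r ?nnegrE ?mulr_ge0 ?ler_wpM2r //; lra.
Qed.

Definition sgb (b : bool) : R := if b then 1 else - 1.

Variables (J I : finType).
Implicit Types (x y : {ffun J -> bool}).

Definition signed_sum (a : J -> R) x : R := \sum_j sgb (x j) * a j.

Lemma signed_sum_mgf (a : J -> R) (s : R) :
  \sum_x expR (s * signed_sum a x) <=
  2 ^+ #|J| * expR (s ^+ 2 * \sum_j a j ^+ 2).
Proof.
under eq_bigr => x _ do
  (rewrite /signed_sum mulr_sumr expR_sum).
rewrite -(bigA_distr_bigA (fun j b => expR (s * (sgb b * a j)))) /=.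
rewrite mulr_sumr expR_sum -prodr_const -big_split /=.
apply: ler_prod => j _; rewrite big_bool /sgb /= addr_ge0 ?expR_ge0 //=.
rewrite mul1r mulN1r mulrN; apply: le_trans (expR_cosh_le _) _.
by rewrite exprMn.
Qed.

Definition hamming x y : nat := #|[pred j | x j != y j]|.

(** Exponential Markov bound: the sum of [4 ^- hamming x y] over all [y] factors into
    [(1 + 1/4) ^ #|J|], and each [y] of the ball contributes at least [4 ^- D]. *)
Lemma hamming_ball x (D : nat) :
  (#|[pred y | (hamming x y <= D)%N]|)%:R <= (5 / 4) ^+ #|J| * 4 ^+ D :> R.
Proof.
have E : \sum_y (4^-1) ^+ hamming x y = (5/4) ^+ #|J| :> R.
  have E1 y : (4^-1) ^+ hamming x y =
      \prod_j (if x j != y j then 4^-1 else 1) :> R.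
    by rewrite /hamming -prodr_const big_mkcond.
  under eq_bigr do rewrite E1.
  rewrite -(bigA_distr_bigA (fun j b => if x j != b then 4^-1 else 1)) /=.
  rewrite -prodr_const; apply: eq_bigr => j _.
  by rewrite big_bool /=; case: (x j) => /=; lra.
rewrite -ler_pdivrMr ?exprn_gt0 // -E -exprVn -sum1_card natr_sum mulr_suml.
rewrite [leRHS](bigID (fun y => hamming x y <= D)%N) /=.
apply: ler_wpDr; first by apply: sumr_ge0 => y _; rewrite exprn_ge0.
apply: ler_sum => y; rewrite inE => yD; rewrite mul1r.
by rewrite ler_wiXn2l //; lra.
Qed.


Variables (a : I -> J -> R) (sig lam : I -> R).
Hypothesis sig_gt0 : forall i, 0 < sig i.
Hypothesis a_sig : forall i, \sum_j a i j ^+ 2 <= sig i ^+ 2.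
Hypothesis lam_ge4 : forall i, 4 <= lam i.

Let Lam i := lam i * sig i.
Let X i x := signed_sum (a i) x.
Let level i x := Num.truncn (`|X i x| / Lam i).
Let maxlev := (\max_i \max_x level i x)%N.
(** Half the Chernoff exponent [lam ^ 2 / 4] of [level_sum]: charging [mu] per level then leaves a
    mean charge of order [eta]. *)
Let mu i := lam i ^+ 2 / 8.
Let eta i := expR (- mu i).

Let Lam_gt0 i : 0 < Lam i.
Proof. by rewrite mulr_gt0 // (lt_le_trans _ (lam_ge4 i)). Qed.

Let level_ltn i x : (level i x < maxlev.+1)%N.
Proof. by rewrite ltnS (leq_trans _ (leq_bigmax i)) // (leq_bigmax x). Qed.

(* Level 0 is a single bucket: the sign is only recorded from level 1 on. *)
Let code i x : bool * 'I_maxlev.+1 :=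
  ((level i x == 0%N) || (0 < X i x), Ordinal (level_ltn i x)).

Let code_close i x y : code i x = code i y -> `|X i x - X i y| <= 2 * Lam i.
Proof.
case=> eqs eql; have L := Lam_gt0 i.
have itv z : (level i z)%:R * Lam i <= `|X i z| < (level i z).+1%:R * Lam i.
  rewrite -ler_pdivlMr // -ltr_pdivrMr // truncn_itv //.
  by rewrite divr_ge0 // ltW.
have /andP[lx ux] := itv x; have /andP[ly uy] := itv y.
move: eqs lx ux ly uy; rewrite -eql -[in (level i x).+1%:R]natr1.
have := ler0n R (level i x).
case: (level i x == 0%N) / eqP => [->|_] /=.
  by rewrite !mul0r add0r mul1r => _ _ _ + _; rewrite !ltr_norml ler_norml; lra.
set l := (level i x)%:R; set u := X i x; set v := X i y.
move=> l0; case: ltrP => u0; case: ltrP => v0 // _;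
  [rewrite (gtr0_norm u0) (gtr0_norm v0)|rewrite (ler0_norm u0) (ler0_norm v0)];
  by rewrite !mulrDl mul1r ler_norml => *; nra.
Qed.

(** Exponential of minus a code length, to satisfy Kraft's inequality: the positive levels, with two
    signs each, add at most [3 * eta], which the factor [expR (- 3 * eta)] compensates. The pair
    [(false, 0)] is never a code and gets weight 0. *)
Let weight i (d : bool * 'I_maxlev.+1) : R :=
  if ~~ d.1 && (d.2 == 0%N :> nat) then 0
  else expR (- (3 * eta i + mu i * (d.2 : nat)%:R)).

Let mu_ge i : 2 <= mu i.
Proof. by rewrite /mu ler_pdivlMr // expr2; have := lam_ge4 i; nra. Qed.

Let eta_le i : 0 < eta i <= 3^-1.
Proof.
rewrite expR_gt0 /= /eta expRN lef_pV2 ?posrE ?expR_gt0 //.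
have -> : mu i = (mu i / 2) *+ 2 by lra.
rewrite -[_ *+ 2]mulr_natl expRM_natl.
apply: (@le_trans _ _ ((1 + mu i / 2) ^+ 2)).
  by rewrite expr2; have := mu_ge i; nra.
rewrite lerXn2r ?nnegrE ?expR_ge0 ?expR_ge1Dx //; have := mu_ge i; lra.
Qed.

Let weight_sum i : \sum_d weight i d <= 1.
Proof.
rewrite -(pair_big xpredT xpredT (fun b t => weight i (b, t))) /= big_bool /=.
rewrite !big_ord_recl /weight /= add0r mulr0 addr0.
have /andP[e0 e3] := eta_le i.
pose S := \sum_(t < maxlev) eta i ^+ t.+1.
have -> : \sum_(t < maxlev) expR (- (3 * eta i + mu i * (bump 0 t)%:R)) =
    expR (- (3 * eta i)) * S.
  rewrite mulr_sumr; apply: eq_bigr => t _.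
  by rewrite opprD expRD -[- (mu i * _)]mulNr [- mu i * _]mulrC expRM_natl.
have S1 : S * (1 - eta i) <= eta i.
  suff -> : S * (1 - eta i) = eta i - eta i ^+ maxlev.+1.
    by rewrite lerBlDr lerDl exprn_ge0 // ltW.
  rewrite /S; elim: maxlev => [|n IH]; first by rewrite big_ord0 mul0r expr1 subrr.
  by rewrite big_ord_recr mulrDl IH /= (exprS _ n.+1); ring.
have S2 : S <= 3/2 * eta i by nra.
set e := expR _; rewrite (_ : e + _ + _ = (1 + 2 * S) * e); last by ring.
rewrite /e expRN ler_pdivrMr ?expR_gt0 // mul1r.
have := expR_ge1Dx (3 * eta i); lra.
Qed.

Let level_sum i :
  \sum_x (level i x)%:R <= 2 ^+ #|J| * (2 * expR (- (2 * mu i))).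
Proof.
have L := Lam_gt0 i; have l4 := lam_ge4 i; have s0 := sig_gt0 i.
(* The minimiser of the Chernoff exponent [- tau + tau ^ 2 / lam ^ 2], whose minimum is
   [- 2 * mu]. *)
pose tau := lam i ^+ 2 / 2.
have tau1 : 1 <= tau by rewrite /tau expr2; nra.
have H x : (level i x)%:R <=
    expR (- tau) * (expR (tau / Lam i * X i x) + expR (- (tau / Lam i) * X i x)).
  pose y := `|X i x| / Lam i.
  have y0 : 0 <= y by rewrite divr_ge0 // ltW.
  have ly : (level i x)%:R <= y by have /andP[] := truncn_itv y0.
  have [y1|y1] := ltP y 1.
    have -> : level i x = 0%N by apply/eqP; rewrite truncn_eq // y0 y1.
    by rewrite mulr_ge0 ?addr_ge0 ?expR_ge0.
  apply: (le_trans ly).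
  have -> : y = 1 + (y - 1) by ring.
  apply: (le_trans (expR_ge1Dx _)).
  apply: (@le_trans _ _ (expR (- tau) * expR (tau * y))).
    by rewrite -expRD ler_expR; nra.
  rewrite ler_pM2l ?expR_gt0 //.
  have -> : tau * y = tau / Lam i * `|X i x| by rewrite /y; ring.
  rewrite mulNr -mulrN; case: (ler0P (X i x)) => _.
    by rewrite lerDr expR_ge0.
  by rewrite lerDl expR_ge0.
apply: (le_trans (ler_sum _ (fun x _ => H x))).
rewrite -mulr_sumr big_split /=.
have G s : s ^+ 2 = (tau / Lam i) ^+ 2 ->
    \sum_x expR (s * X i x) <= 2 ^+ #|J| * expR (lam i ^+ 2 / 4).
  move=> s2; apply: (le_trans (signed_sum_mgf _ _)).
  rewrite ler_pM2l ?exprn_gt0 // ler_expR s2.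
  apply: (@le_trans _ _ ((tau / Lam i) ^+ 2 * sig i ^+ 2)).
    by rewrite ler_wpM2l ?sqr_ge0.
  rewrite le_eqVlt; apply/orP; left; apply/eqP.
  rewrite /tau /Lam; field; apply/andP; split; apply/eqP => E; nra.
have := lerD (G (tau / Lam i) erefl) (G (- (tau / Lam i)) (sqrrN _)).
rewrite -(ler_pM2l (expR_gt0 (- tau))) => /le_trans; apply.
have -> : expR (- (2 * mu i)) = expR (- tau) * expR (lam i ^+ 2 / 4).
  by rewrite -expRD; congr expR; rewrite /tau /mu; field.
by rewrite le_eqVlt; apply/orP; left; apply/eqP; ring.
Qed.


(* The product of the [weight i] is a subprobability on codes, and by Jensen its
   average over all sign vectors is at least [(3 / 4) ^ #|J|]; hence some code is
   shared by more sign vectors than a Hamming ball of radius [#|J| / 8] contains.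
   Half the difference of two distant vectors with the same code is the
   colouring. *)
Lemma partial_coloring :
  (0 < #|J|)%N -> 5 * \sum_i expR (- (lam i ^+ 2 / 8)) <= #|J|%:R / 4 ->
  exists eps : J -> R,
    [/\ forall j, [\/ eps j = - 1, eps j = 0 | eps j = 1],
        (#|J| <= 16 * #|[pred j | (eps j == - 1)%R]|)%N &
        forall i, `|\sum_j eps j * a i j| <= lam i * sig i].
Proof.
move=> K0 budget.
pose Phi x : R := \sum_i (3 * eta i + mu i * (level i x)%:R).
pose W (d : {ffun I -> bool * 'I_maxlev.+1}) : R := \prod_i weight i (d i).
pose codes x : {ffun I -> bool * 'I_maxlev.+1} := [ffun i => code i x].
have weight_ge0 i d : 0 <= weight i d.
  by rewrite /weight; case: ifP => // _; rewrite expR_ge0.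
have Wcode x : W (codes x) = expR (- Phi x).
  rewrite /W /Phi -sumrN expR_sum; apply: eq_bigr => i _.
  by rewrite ffunE /weight /= negb_or; case: (level i x == 0%N); rewrite ?andbF.
have Wsum : \sum_d W d <= 1.
  rewrite /W -(bigA_distr_bigA weight); apply: Num.Theory.prodr_ile1 => i _.
  by rewrite weight_sum sumr_ge0.
have Phi_sum : \sum_x Phi x <= 2 ^+ #|J| * (#|J|%:R / 4).
  apply: (@le_trans _ _ (\sum_i 2 ^+ #|J| * (5 * eta i))); last first.
    by rewrite -mulr_sumr -mulr_sumr ler_wpM2l ?exprn_ge0.
  rewrite exchange_big /=; apply: ler_sum => i _.
  rewrite big_split /= sumr_const -mulr_sumr card_ffun card_bool -[_ *+ _]mulr_natl.
  rewrite natrX.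
  have m0 := mu_ge i; have := ler_wpM2l (le_trans (ler0n _ 2) m0) (level_sum i).
  have e0 : 0 < eta i by have /andP[] := eta_le i.
  (* So the levels cost on average at most [2 * eta]; with the constant [3 * eta] this is the
     [5 * eta] of the budget. *)
  have : mu i * expR (- (2 * mu i)) <= eta i.
    rewrite mulrDl mul1r opprD expRD mulrA -[leRHS]mul1r ler_pM2r //.
    rewrite expRN ler_pdivrMr ?expR_gt0 // mul1r.
    by have := expR_ge1Dx (mu i); lra.
  have : 0 < 2 ^+ #|J| :> R by rewrite exprn_gt0.
  set P := 2 ^+ _; set E := expR _; set S := \sum_(_ | _) _ => P0 h1 h2; nra.
have lower : (3 / 2) ^+ #|J| <= \sum_x W (codes x).
  have c0 : (3 / 4) ^+ #|J| <= expR (- (#|J|%:R / 4)) :> R.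
    rewrite -mulrN expRM_natl lerXn2r ?nnegrE ?expR_ge0 //.
    by have := expR_ge1Dx (- 4^-1 : R); lra.
  apply: (@le_trans _ _ (2 ^+ #|J| * expR (- (#|J|%:R / 4)))).
    have -> : 3 / 2 = 2 * (3 / 4) :> R by field.
    by rewrite [(2 * _) ^+ _]exprMn ler_wpM2l ?exprn_ge0.
  set c := #|J|%:R / 4.
  (* Jensen's inequality, through the tangent of [expR] at the budgeted mean [c]. *)
  have h x : expR (- c) * (1 + c - Phi x) <= W (codes x).
    rewrite Wcode (_ : - Phi x = - c + (c - Phi x)); last by ring.
    rewrite expRD ler_pM2l ?expR_gt0 //; have := expR_ge1Dx (c - Phi x); lra.
  apply: le_trans (ler_sum _ (fun x _ => h x)).
  rewrite -mulr_sumr mulrC ler_pM2l ?expR_gt0 // sumrB sumr_const card_ffun card_bool.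
  by rewrite -[(1 + c) *+ _]mulr_natl natrX /c mulrDr mulr1; move: Phi_sum; lra.
(* Since [3/2 = 5/4 * 6/5], the contradiction needs [4 ^ D < (6/5) ^ #|J|]; the fraction 1/8 comes
   from [4 < (6/5) ^ 8]. *)
pose D := (#|J| %/ 8)%N.
have [x [y [xy far]]] : exists x y, codes x = codes y /\ (D < hamming x y)%N.
  apply: contrapT => no.
  have near x y : codes x = codes y -> (hamming x y <= D)%N.
    by move=> e; rewrite leqNgt; apply/negP => h; apply: no; exists x, y.
  have : \sum_x W (codes x) <= (5 / 4) ^+ #|J| * 4 ^+ D.
    set M := _ * _; have M0 : 0 <= M by rewrite mulr_ge0 ?exprn_ge0.
    rewrite (partition_big codes xpredT) //=.
    apply: (@le_trans _ _ (\sum_d M * W d)); last first.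
      by rewrite -mulr_sumr ler_piMr.
    apply: ler_sum => d _.
    under eq_bigr => x /eqP -> do rewrite -[W d]mul1r.
    rewrite -mulr_suml ler_wpM2r ?prodr_ge0 //.
    have [/existsP[x0 /eqP x0d]|] := boolP [exists x, codes x == d]; last first.
      move=> /existsPn nod; rewrite big1 // => x /eqP e.
      by have := nod x; rewrite e eqxx.
    apply: le_trans (hamming_ball x0 D).
    rewrite (_ : \sum_(_ | _) 1 = #|[pred x | codes x == d]|%:R); last first.
      by rewrite -sum1_card natr_sum.
    rewrite ler_nat; apply: subset_leq_card.
    by apply/fintype.subsetP => x; rewrite !inE => /eqP e; apply: near; rewrite e.
  move=> /(le_trans lower); apply/negP; rewrite -ltNge.
  have -> : 3 / 2 = 5 / 4 * (6 / 5) :> R by field.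
  rewrite [(5 / 4 * _) ^+ _]exprMn ltr_pM2l ?exprn_gt0 //.
  rewrite [X in _ < _ ^+ X](divn_eq _ 8) -/D exprD [in _ ^+ (D * 8)]mulnC exprM.
  have h8 : 4 < (6 / 5) ^+ 8 :> R.
    have h2 : 2 < (6 / 5) ^+ 4 :> R by rewrite !exprS expr0; lra.
    rewrite (exprM _ 4 2) expr2; nra.
  have h1 n : 1 <= (6 / 5) ^+ n :> R by rewrite exprn_ege1 //; lra.
  case: (posnP D) => [D0|Dp].
    rewrite D0 !expr0 mul1r exprn_egt1; last by lra.
    by move: K0; rewrite [X in (0 < X)%N](divn_eq _ 8) -/D D0 lt0n.
  apply: (@lt_le_trans _ _ (((6 / 5) ^+ 8) ^+ D)).
    by rewrite ltrXn2r // -?lt0n // nnegrE exprn_ge0 //; lra.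
  by rewrite ler_peMr // exprn_ge0 // exprn_ge0 //; lra.
pose e (j : J) : R := (sgb (x j) - sgb (y j)) / 2.
have e_val j : [\/ e j = - 1, e j = 0 | e j = 1].
  by rewrite /e /sgb; case: (x j); case: (y j);
    [apply: Or32|apply: Or33|apply: Or31|apply: Or32]; field.
have e_sum i : `|\sum_j e j * a i j| <= lam i * sig i.
  have -> : \sum_j e j * a i j = (X i x - X i y) / 2.
    by rewrite /X /signed_sum -sumrB mulr_suml; apply: eq_bigr => k _; rewrite /e; ring.
  have := @code_close i x y; have /ffunP/(_ i) := xy; rewrite !ffunE => -> /(_ erefl).
  by rewrite /Lam normrM (@ger0_norm _ 2^-1) //; lra.
have e_card : (#|J| <= 8 * (#|[pred j | (e j == - 1)%R]| + #|[pred j | (e j == 1)%R]|))%N.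
  suff : (hamming x y <= #|[pred j | (e j == - 1)%R]| + #|[pred j | (e j == 1)%R]|)%N.
    by move: far; rewrite /D; lia.
  rewrite -cardUI; apply: leq_trans (leq_addr _ _); apply: subset_leq_card.
  apply/fintype.subsetP => k; rewrite !inE /e /sgb.
  by case: (x k); case: (y k) => // _; apply/orP; [right|left]; apply/eqP; field.
(* The value -1 is the one that deletes points, so the colouring is negated if 1 is the more
   frequent value. *)
case: (leqP #|[pred j | (e j == 1)%R]| #|[pred j | (e j == - 1)%R]|) => cmp.
  by exists e; split=> //; move: e_card cmp; lia.
exists (fun j => - e j); split.
- by move=> j; case: (e_val j) => ->; rewrite ?opprK ?oppr0;
    [apply: Or33|apply: Or32|apply: Or31].
- rewrite (_ : #|_| = #|[pred j | (e j == 1)%R]|); last first.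
    by apply: eq_card => j; rewrite !inE eqr_opp.
  by move: e_card cmp; lia.
- move=> i; rewrite -normrN -sumrN (eq_bigr (fun j => e j * a i j)) //.
  by move=> j _; rewrite mulNr opprK.
Qed.

End PartialColoring.

(** * Balanced clusters *)

(** A kernel vector divided by its entry of largest modulus. The value 1 attained in [A] is what
    later makes a weight vanish under the colour -1. *)
Lemma linear_dependence (R : realType) (T : finType) (A : {set T}) (d : nat)
    (u : T -> 'I_d -> R) :
  (d < #|A|)%N ->
  exists c : T -> R,
    [/\ forall t, t \notin A -> c t = 0, forall t, `|c t| <= 1,
        exists2 t, t \in A & c t = 1 & forall g, \sum_t c t * u t g = 0].
Proof.
move=> dA; pose M : 'M[R]_(#|A|, d) := \matrix_(i, g) u (enum_val i) g.
have kerN0 : kermx M != 0.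
  rewrite -mxrank_eq0 mxrank_ker subn_eq0 -ltnNge.
  exact: leq_ltn_trans (rank_leq_col M) dA.
pose v := nz_row (kermx M).
have v0 : v != 0 by rewrite nz_row_eq0.
have vM : v *m M = 0 by apply/sub_kermxP; exact: nz_row_sub.
have [i0 vi0] : exists i, v 0 i != 0.
  by move/rV0Pn: v0.
pose c0 t := \sum_i v 0 i *+ (enum_val i == t).
have c0E i : c0 (enum_val i) = v 0 i.
  rewrite /c0 (bigD1 i) //= eqxx mulr1n big1 ?addr0 // => k ki.
  by rewrite (inj_eq enum_val_inj) (negbTE ki).
have c0out t : t \notin A -> c0 t = 0.
  move=> tA; apply: big1 => i _; case: eqP => [e|]; last by rewrite mulr0n.
  by move: tA; rewrite -e enum_valP.
pose t0 := [arg max_(t > enum_val i0 in A) `|c0 t|]%O.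
have [t0A t0max] : t0 \in A /\ forall t, t \in A -> `|c0 t| <= `|c0 t0|.
  by rewrite /t0; case: Order.TotalTheory.arg_maxP; rewrite ?enum_valP.
have t0n : c0 t0 != 0.
  rewrite -normr_gt0; apply: lt_le_trans (t0max _ (enum_valP i0)).
  by rewrite normr_gt0 c0E.
exists (fun t => c0 t / c0 t0); split.
- by move=> t /c0out ->; rewrite mul0r.
- move=> t; rewrite normrM normfV ler_pdivrMr ?normr_gt0 // mul1r.
  by have [/t0max//|/c0out ->] := boolP (t \in A); rewrite normr0.
- by exists t0; rewrite ?divff.
- move=> g; under eq_bigr do rewrite mulrAC.
  rewrite -mulr_suml; suff -> : \sum_t c0 t * u t g = (v *m M) 0 g.
    by rewrite vM mxE mul0r.
  rewrite mxE /c0; under eq_bigr do rewrite mulr_suml.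
  rewrite exchange_big /=; apply: eq_bigr => i _.
  rewrite (bigD1 (enum_val i)) //= eqxx mulr1n mxE big1 ?addr0 // => t.
  by rewrite eq_sym => /negbTE ->; rewrite mulr0n mul0r.
Qed.

(** Greedy selection: while more than [4 * #|C|] points remain, some cell holds five of them. *)
Lemma disjoint_fivefold_clusters (T C : finType) (cell : T -> C) (K : nat)
    (S : {set T}) :
  (4 * #|C| + 5 * K <= #|S|)%N ->
  exists A : nat -> {set T},
    (forall j, (j < K)%N -> [/\ A j \subset S, #|A j| = 5%N &
       exists c, forall t, t \in A j -> cell t = c]) /\
    (forall i j, (i < K)%N -> (j < K)%N -> i != j -> [disjoint A i & A j]).
Proof.
elim: K S => [|K IH] S hS; first by exists (fun=> finset.set0).
have [c hc] : exists c, (5 <= #|[set t in S | cell t == c]|)%N.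
  apply/existsP; apply/contraT; rewrite negb_exists => /forallP h.
  suff : (#|S| <= 4 * #|C|)%N by move: hS; lia.
  rewrite -sum1_card (partition_big cell xpredT) //= mulnC -sum_nat_const.
  apply: leq_sum => c _; rewrite sum1_card -ltnS ltnNge; have := h c.
  congr (~~ (_ <= _)%N).
  by apply: eq_card => t; rewrite !inE.
have [B BS B5] : exists2 B : {set T}, B \subset [set t in S | cell t == c] & #|B| = 5%N.
  have /card_geqP[s [us s5 sS]] := hc; exists [set x in s].
    by apply/fintype.subsetP => x; rewrite inE => /sS.
  by rewrite cardsE; move/card_uniqP: us => ->.
have BS' : B \subset S by apply: fintype.subset_trans BS _; apply/fintype.subsetP => t; rewrite inE => /andP[].
have /IH[A [A1 A2]] : (4 * #|C| + 5 * K <= #|S :\: B|)%N.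
  have := cardsID B S; have -> : S :&: B = B by apply/finset.setIidPr.
  by rewrite B5; move: hS; lia.
have dB j : (j < K)%N -> [disjoint B & A j].
  move=> /A1[+ _ _]; rewrite finset.subsetD => /andP[_].
  by rewrite disjoint_sym.
exists (fun j => if j == K then B else A j); split.
  move=> j; rewrite ltnS leq_eqVlt; case: (altP eqP) => [_ _|_ /= jK].
    by split=> //; exists c => t /(fintype.subsetP BS); rewrite inE => /andP[_ /eqP].
  have [a1 a2 a3] := A1 j jK; split=> //.
  exact: fintype.subset_trans a1 (subsetDl _ _).
have lt_K i : (i < K.+1)%N -> i != K -> (i < K)%N by move=> iK n; rewrite ltn_neqAle n.
move=> i j iK jK ij.
case: (eqVneq i K) => [iK'|iK']; case: (eqVneq j K) => [jK'|jK'].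
- by move: ij; rewrite iK' jK' eqxx.
- by apply/dB/lt_K.
- by rewrite disjoint_sym; apply/dB/lt_K.
- by apply: A2 => //; apply: lt_K.
Qed.

(** * Cells on the sphere *)

Section Grid.
Variable R : realType.
Implicit Types (x y : R) (k n : nat).

Lemma card_ord_spread n d (A : {set 'I_n}) :
  (forall i j, i \in A -> j \in A -> (i <= j + d)%N) -> (#|A| <= d.+1)%N.
Proof.
move=> h; have [->|/set0Pn[i0 i0A]] := eqVneq A finset.set0; first by rewrite cards0.
case: (arg_minnP (fun i : 'I_n => i : nat) i0A) => m mA mmin.
pose f (i : 'I_n) : 'I_d.+1 := inord (i - m).
rewrite -[d.+1]card_ord -(@card_in_imset _ _ f) ?max_card // => i j iA jA /(congr1 val) /=.
rewrite !inordK ?ltnS ?leq_subLR ?(h _ _ _ mA) // => e; apply: val_inj => /=.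
by move: e (mmin _ iA) (mmin _ jA); lia.
Qed.

Lemma normrM_gt0 x z : 0 < z -> `|x| * z = `|x * z|.
Proof. by move=> z0; rewrite normrM (gtr0_norm z0). Qed.

(** Intervals of length [2 ^- k] on [[-1, 1]]; the endpoint 1 occupies the extra index
    [2 ^ k.+1]. *)
Definition grid k x : 'I_(2 ^ k.+1).+1 := inord (Num.truncn (2 ^+ k * (x + 1))).

Lemma grid_val k x : -1 <= x <= 1 ->
  (grid k x : nat) = Num.truncn (2 ^+ k * (x + 1)).
Proof.
move=> /andP[x1 x2]; rewrite /grid inordK // truncn_lt_nat; last first.
  by rewrite mulr_ge0 ?exprn_ge0 //; lra.
rewrite -[(_ ^ _).+1%:R]natr1 natrX exprSr; have : 0 < 2 ^+ k :> R by rewrite exprn_gt0.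
by nra.
Qed.

Lemma grid_itv k x : -1 <= x <= 1 ->
  (grid k x)%:R <= 2 ^+ k * (x + 1) < (grid k x)%:R + 1.
Proof.
move=> xi; rewrite grid_val // natr1 truncn_itv // mulr_ge0 ?exprn_ge0 //.
by case/andP: xi; lra.
Qed.

(** Dyadic nesting: it makes the cells refine one another and gives each node of a chain its
    parent. *)
Lemma grid_half k x : -1 <= x <= 1 -> (grid k x : nat) = (grid k.+1 x)./2.
Proof.
move=> xi; have /andP[a b] := grid_itv k.+1 xi.
rewrite grid_val //; apply: truncn_def.
move: a b; rewrite exprS; set i := grid k.+1 x; set z := 2 ^+ k.
have := odd_double_half i; rewrite -muln2 => /(congr1 (fun n : nat => n%:R : R)) /=.
rewrite natrD natrM -[(_./2).+1%:R]natr1.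
have : 0 <= ((odd i)%:R : R) <= 1 by rewrite ler0n lern1 leq_b1.
by move=> /andP[]; nra.
Qed.

Lemma grid_close k x y : -1 <= x <= 1 -> -1 <= y <= 1 -> grid k x = grid k y ->
  `|x - y| <= 2 ^- k.
Proof.
move=> xi yi e; have := grid_itv k xi; have := grid_itv k yi; rewrite e.
have z0 : 0 < 2 ^+ k :> R by rewrite exprn_gt0.
rewrite -[2 ^- k]mul1r ler_pdivlMr // normrM_gt0 // ler_norml.
by move=> /andP[? ?] /andP[? ?]; nra.
Qed.

Lemma grid_dist k x y (d : nat) : -1 <= x <= 1 -> -1 <= y <= 1 ->
  `|x - y| <= d%:R / 2 ^+ k -> (grid k x <= grid k y + d.+1)%N.
Proof.
move=> xi yi; have /andP[a _] := grid_itv k xi; have /andP[_ b] := grid_itv k yi.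
have z0 : 0 < 2 ^+ k :> R by rewrite exprn_gt0.
rewrite ler_pdivlMr // normrM_gt0 // ler_norml => /andP[_ h].
by rewrite addnS -ltnS -(ltr_nat R) -!natr1 natrD; lra.
Qed.

Definition node k (i : nat) : R := i%:R / 2 ^+ k - 1.

Lemma node_itv k i : (i <= 2 ^ k.+1)%N -> -1 <= node k i <= 1.
Proof.
move=> ik; have z0 : 0 < 2 ^+ k :> R by rewrite exprn_gt0.
have a : 0 <= i%:R / 2 ^+ k :> R by rewrite divr_ge0 ?ler0n ?exprn_ge0.
have b : i%:R / 2 ^+ k <= 2 :> R.
  by rewrite ler_pdivrMr // -exprS -natrX ler_nat.
by rewrite /node; apply/andP; split; lra.
Qed.

Lemma node_grid k x : -1 <= x <= 1 -> `|x - node k (grid k x)| <= 2 ^- k.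
Proof.
move=> xi; have /andP[] := grid_itv k xi; rewrite /node => lo hi.
have z0 : 0 < 2 ^+ k :> R by rewrite exprn_gt0.
rewrite -[leRHS]mul1r ler_pdivlMr // normrM_gt0 // ler_norml.
set i := (grid k x)%:R.
have -> : (x - (i / 2 ^+ k - 1)) * 2 ^+ k = 2 ^+ k * (x + 1) - i.
  by field; rewrite gt_eqF.
by apply/andP; split; lra.
Qed.

Lemma node_half k i : `|node k.+1 i - node k i./2| <= 2 ^- k.+1.
Proof.
have z0 : 0 < 2 ^+ k :> R by rewrite exprn_gt0.
have -> : node k.+1 i - node k i./2 = (odd i)%:R / 2 ^+ k.+1.
  rewrite /node -{1}(odd_double_half i) -muln2 natrD natrM exprS; field.
  by rewrite gt_eqF.
rewrite ger0_norm ?divr_ge0 ?exprn_ge0 // ler_piMl ?invr_ge0 ?exprn_ge0 //.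
by rewrite lern1 leq_b1.
Qed.

End Grid.

(** * Cubed-sphere cells and the cells crossed by a great circle *)

Section Cells.
Variable R : realType.
Local Notation vec := ('I_3 -> R).
Implicit Types (u v m : vec) (k : nat).

Definition dot u m : R := \sum_g u g * m g.

Lemma sum3_cyclic (F : vec) (f : 'I_3) :
  \sum_g F g = F f + F (f + 1) + F (f + 2).
Proof.
have H (a b c : 'I_3) : [/\ a = 0, b = 1 & c = 2%:R] ->
   \sum_g F g = F a + F b + F c.
  move=> [-> -> ->]; rewrite !big_ord_recl big_ord0 addr0 addrA.
  by congr (_ + F _ + F _); apply: val_inj.
case: f => [[|[|[|//]]] p].
- by rewrite -H //; split; apply: val_inj.
- rewrite addrC addrA -H //; split; exact: val_inj.
- rewrite -addrA addrC -H //; split; exact: val_inj.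
Qed.

Lemma card_by_col n p (X : {set 'I_n * 'I_p}) :
  #|X| = (\sum_j #|[set i | (i, j) \in X]|)%N.
Proof.
rewrite -sum1_card big_mkcond /=.
transitivity (\sum_j \sum_i nat_of_bool ((i, j) \in X))%N.
  by rewrite exchange_big pair_bigA; apply: eq_bigr => -[i j] _ /=; case: ifP.
apply: eq_bigr => j _; rewrite -sum1_card [RHS]big_mkcond /=.
by apply: eq_bigr => i _; rewrite inE; case: ifP.
Qed.

Lemma card_by_row n p (X : {set 'I_n * 'I_p}) :
  #|X| = (\sum_i #|[set j | (i, j) \in X]|)%N.
Proof.
rewrite -sum1_card big_mkcond /=.
transitivity (\sum_i \sum_j nat_of_bool ((i, j) \in X))%N.
  by rewrite pair_bigA; apply: eq_bigr => -[i j] _ /=; case: ifP.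
apply: eq_bigr => j _; rewrite -sum1_card [RHS]big_mkcond /=.
by apply: eq_bigr => i _; rewrite inE; case: ifP.
Qed.

(* Indices of coordinates live in ['I_3], where addition is modulo 3. *)
Definition face v : 'I_3 := [arg max_(f > ord0) `|v f|]%O.

Lemma face_max v g : `|v g| <= `|v (face v)|.
Proof. by rewrite /face; case: Order.TotalTheory.arg_maxP => // f _; apply. Qed.

Definition is_unit v := \sum_g v g ^+ 2 = 1.

Lemma face_neq0 v : is_unit v -> v (face v) != 0.
Proof.
move=> v1; apply/eqP => f0; have := oner_neq0 R; rewrite -v1 big1 ?eqxx // => g _.
by have := face_max v g; rewrite f0 normr0 normr_le0 => /eqP ->; rewrite expr0n.
Qed.

Lemma unit_le1 v g : is_unit v -> `|v g| <= 1.
Proof.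
move=> v1; rewrite -(@ler_pXn2r _ 2) ?nnegrE // expr1n real_normK ?num_real // -v1.
by rewrite (bigD1 g) //= lerDl sumr_ge0 // => i _; rewrite sqr_ge0.
Qed.

Definition ratio v (h : 'I_3) : R := v (face v + h) / v (face v).

Lemma ratio_itv v h : is_unit v -> -1 <= ratio v h <= 1.
Proof.
move=> v1; rewrite -ler_norml normrM normfV ler_pdivrMr ?normr_gt0 ?face_neq0 //.
by rewrite mul1r face_max.
Qed.

Definition cell_type k : finType :=
  (('I_3 * bool) * ('I_(2 ^ k.+1).+1 * 'I_(2 ^ k.+1).+1))%type.

(** Radial projection to the cube: six signed faces, each with a square mesh of side [2 ^- k]. The
    sign is recorded so that, within a cell, [dot v m] and the affine form in [dot_ratio] change
    sign together. *)
Definition cell k v : cell_type k :=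
  ((face v, 0 < v (face v)), (grid k (ratio v 1), grid k (ratio v 2))).

Lemma card_cell_type k : (#|cell_type k| <= 54 * 4 ^ k)%N.
Proof.
rewrite !card_prod !card_ord card_bool.
have : (0 < 2 ^ k)%N by rewrite expn_gt0.
by rewrite expnS (_ : 4 = 2 * 2)%N // expnMn; nia.
Qed.

Definition is_face m := (forall g, `|m g| <= 1) /\ exists f, `|m f| = 1.

Lemma dot_ratio v m : is_unit v ->
  dot v m = v (face v) *
    (m (face v) + m (face v + 1) * ratio v 1 + m (face v + 2) * ratio v 2).
Proof.
by move=> /face_neq0 v0; rewrite /dot (sum3_cyclic _ (face v)) /ratio; field.
Qed.

Variables (T : finType) (v : T -> vec).
Hypothesis v_unit : forall t, is_unit (v t).

(** Only points of the family count: a cell is crossed when the great circle strictly separates two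
    of its points [v t]. *)
Definition crossed k m : {set cell_type k} :=
  [set c | [exists t, exists t', [&& cell k (v t) == c, cell k (v t') == c &
    dot (v t) m * dot (v t') m < 0]]].

Let L m t := m (face (v t)) + m (face (v t) + 1) * ratio (v t) 1 +
  m (face (v t) + 2) * ratio (v t) 2.

(** The affine form takes both signs in the cell and, its slopes being at most 1, varies there by at
    most two mesh sizes. *)
Let crossed_L k m t : (forall g, `|m g| <= 1) ->
  cell k (v t) \in crossed k m -> `|L m t| <= 2 / 2 ^+ k.
Proof.
move=> m1; rewrite inE => /existsP[t1 /existsP[t2 /and3P[/eqP c1 /eqP c2]]].
rewrite !dot_ratio // -!/(L _ _) => neg.
have close t' : cell k (v t') = cell k (v t) -> `|L m t - L m t'| <= 2 / 2 ^+ k.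
  case=> ef _ e1 e2; rewrite /L ef; set f := face (v t).
  set a := m (f + 1); set b := m (f + 2).
  rewrite [X in `|X|](_ : _ = a * (ratio (v t) 1 - ratio (v t') 1) +
     b * (ratio (v t) 2 - ratio (v t') 2)); last by ring.
  apply: (le_trans (ler_normD _ _)); rewrite !normrM.
  have h1 := grid_close (ratio_itv 1 (v_unit t)) (ratio_itv 1 (v_unit t')) (esym e1).
  have h2 := grid_close (ratio_itv 2 (v_unit t)) (ratio_itv 2 (v_unit t')) (esym e2).
  rewrite (_ : 2 / 2 ^+ k = 2 ^- k + 2 ^- k :> R); last by rewrite mulrDl mul1r.
  by apply: lerD; rewrite -[leRHS]mul1r; apply: ler_pM => //; exact: m1.
have := close _ c1; have := close _ c2.
have : L m t1 * L m t2 < 0.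
  have sgn (x y : R) b : x != 0 -> y != 0 -> (0 < x) = b -> (0 < y) = b -> 0 < x * y.
    case: b => x0 y0 sx sy; first by rewrite mulr_gt0.
    have xn : x < 0 by rewrite lt_neqAle x0 leNgt sx.
    by rewrite nmulr_rgt0 // lt_neqAle y0 leNgt sy.
  have : 0 < v t1 (face (v t1)) * v t2 (face (v t2)).
    case: c1 c2 => _ s1 _ _ [_ s2 _ _].
    exact: sgn (face_neq0 _) (face_neq0 _) s1 s2.
  by move=> pos; move: neg; rewrite mulrACA pmulr_rlt0.
rewrite !ler_norml => neg' /andP[? ?] /andP[? ?].
by case: (lerP 0 (L m t1)) => ?; apply/andP; split; nra.
Qed.

Lemma crossed_small k m t : (forall g, `|m g| <= 1) ->
  cell k (v t) \in crossed k m -> `|dot (v t) m| <= 2 / 2 ^+ k.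
Proof.
move=> m1 /(crossed_L m1) h; rewrite dot_ratio // normrM -/(L m t).
by rewrite -[leRHS]mul1r ler_pM // unit_le1.
Qed.

Lemma crossed_same_sign k m c : c \notin crossed k m ->
  (forall t, cell k (v t) = c -> 0 <= dot (v t) m) \/
  (forall t, cell k (v t) = c -> dot (v t) m <= 0).
Proof.
rewrite inE negb_exists => /forallP nc.
have [/existsP[t /andP[/eqP tc tpos]]|/existsPn h] :=
    boolP [exists t, (cell k (v t) == c) && (0 < dot (v t) m)].
  left=> t' t'c; rewrite leNgt; apply/negP => neg.
  have /existsP := nc t; apply; exists t'.
  by rewrite tc t'c eqxx /= pmulr_rlt0.
by right=> t tc; rewrite leNgt; apply/negP => p; have := h t; rewrite tc eqxx p.
Qed.

(** On each face the crossed cells lie in the band where the affine form is at most [2 / 2 ^ k]. If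
    a slope is at least 1/4, every row or column meets the band in at most 22 cells. Otherwise the
    coordinate of modulus 1 is the constant term, the form is at least 1/2 in modulus, and a
    nonempty band forces [2 ^ k <= 4]. *)
Lemma crossed_card k m : is_face m -> (#|crossed k m| <= 450 * 2 ^ k)%N.
Proof.
move=> [m1 [f0 mf0]].
pose N := (2 ^ k.+1).+1.
have N3 : (N <= 3 * 2 ^ k)%N.
  have : (0 < 2 ^ k)%N by rewrite expn_gt0.
  by rewrite /N expnS; lia.
pose X p := [set ij | (p, ij) \in crossed k m].
suff XP p : (#|X p| <= 66 * 2 ^ k)%N.
  have -> : #|crossed k m| = (\sum_p #|X p|)%N.
    rewrite -sum1_card (eq_bigr (fun p => \sum_(ij | (p, ij) \in crossed k m) 1)%N).
      rewrite pair_big_dep /=; apply: eq_bigl => -[p ij] //.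
    by move=> q _; rewrite -sum1_card; apply: eq_bigl => ij; rewrite inE.
  apply: (@leq_trans (\sum_(p : 'I_3 * bool) 66 * 2 ^ k)%N); first exact: leq_sum.
  by rewrite sum_nat_const card_prod card_ord card_bool; lia.
case: p => f s; set a := m (f + 1); set b := m (f + 2).
have z0 : 0 < 2 ^- k :> R by rewrite invr_gt0 exprn_gt0.
have XE i j : (i, j) \in X (f, s) -> exists t,
    [/\ grid k (ratio (v t) 1) = i, grid k (ratio (v t) 2) = j,
        -1 <= ratio (v t) 1 <= 1, -1 <= ratio (v t) 2 <= 1 &
        `|m f + a * ratio (v t) 1 + b * ratio (v t) 2| <= 2 / 2 ^+ k].
  rewrite inE => cr; have := cr; rewrite inE => /existsP[t /existsP[_ /andP[/eqP e _]]].
  exists t; have := @crossed_L k m t m1; rewrite e => /(_ cr); rewrite /L.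
  case: e => -> _ <- <-; rewrite !ratio_itv // -/a -/b.
have abs_le (x y e : R) : `|x| <= e -> `|y| <= e -> `|x - y| <= e *+ 2.
  by rewrite !ler_norml => /andP[? ?] /andP[? ?]; apply/andP; split; lra.
(* The two band conditions give 2 + 2 mesh sizes and the other coordinate 1; division by the slope
   1/4 turns 5 into 20. *)
have key (q x y x' y' : R) (c d : R) : 4^-1 <= `|c| -> `|d| <= 1 ->
   `|q + c * x + d * y| <= 2 / 2 ^+ k -> `|q + c * x' + d * y'| <= 2 / 2 ^+ k ->
   `|y - y'| <= 2 ^- k -> `|x - x'| <= 20%:R / 2 ^+ k.
  move=> c4 d1 h h' hy.
  have : `|c * (x - x')| <= 5 / 2 ^+ k.
    rewrite (_ : c * (x - x') = (q + c * x + d * y) - (q + c * x' + d * y') -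
      d * (y - y')); last by ring.
    apply: (le_trans (ler_normB _ _)); have := abs_le _ _ _ h h'.
    have : `|d * (y - y')| <= 2 ^- k by rewrite normrM -[leRHS]mul1r ler_pM.
    by lra.
  rewrite normrM; have := normr_ge0 (x - x'); nra.
have [a4|a4] := lerP 4^-1 `|a|.
  have row j : (#|[set i | (i, j) \in X (f, s)]| <= 22)%N.
    apply: card_ord_spread => i i'; rewrite inE => /XE[t [ti tj i1 i2 h]].
    rewrite inE => /XE[t' [ti' tj' i1' i2' h']].
    rewrite -ti -ti'; apply: grid_dist => //.
    apply: (key _ _ _ _ _ _ _ a4 _ h h') => //; first exact: m1.
    by apply: grid_close; rewrite // tj.
  rewrite card_by_col; apply: (@leq_trans (\sum_(j : 'I_N) 22)%N).
    by apply: leq_sum => j _; exact: row.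
  by rewrite sum_nat_const card_ord; lia.
have [b4|b4] := lerP 4^-1 `|b|.
  have col i : (#|[set j | (i, j) \in X (f, s)]| <= 22)%N.
    apply: card_ord_spread => j j'; rewrite inE => /XE[t [ti tj i1 i2 h]].
    rewrite inE => /XE[t' [ti' tj' i1' i2' h']].
    rewrite -tj -tj'; apply: grid_dist => //; rewrite addrAC in h; rewrite addrAC in h'.
    apply: (key _ _ _ _ _ _ _ b4 _ h h') => //; first exact: m1.
    by apply: grid_close; rewrite // ti.
  rewrite card_by_row; apply: (@leq_trans (\sum_(j : 'I_N) 22)%N).
    by apply: leq_sum => j _; exact: col.
  by rewrite sum_nat_const card_ord; lia.
have [->|/set0Pn[[i j] ij]] := eqVneq (X (f, s)) finset.set0; first by rewrite cards0.
have [t [_ _ r1 r2 h]] := XE _ _ ij.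
have mf : `|m f| = 1.
  have : f0 \in [:: f; f + 1; f + 2].
    by case: {+}f f0 {mf0} => [[|[|[|//]]] ?] [[|[|[|//]]] ?]; rewrite !inE.
  rewrite !inE => /or3P[] /eqP e; rewrite -?e // in mf0 *.
    by move: a4; rewrite /a -e mf0; lra.
  by move: b4; rewrite /b -e mf0; lra.
have k4 : (2 ^ k <= 4)%N.
  have small (c x : R) : `|c| < 4^-1 -> -1 <= x <= 1 -> `|c * x| <= 4^-1.
    by move=> c4; rewrite -ler_norml normrM => x1; have := normr_ge0 c; nra.
  have := ler_normB (m f + a * ratio (v t) 1 + b * ratio (v t) 2 - a * ratio (v t) 1)
    (b * ratio (v t) 2).
  have := ler_normB (m f + a * ratio (v t) 1 + b * ratio (v t) 2) (a * ratio (v t) 1).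
  rewrite [X in `|X| <= _ + `|b * _|](_ : _ = m f); last by ring.
  have := small _ _ a4 r1; have := small _ _ b4 r2; rewrite mf => s1 s2 h1 h2.
  have : 2^-1 <= 2 / 2 ^+ k :> R by apply: le_trans h; lra.
  by rewrite ler_pdivlMr ?exprn_gt0 // -(ler_nat R) natrX; lra.
apply: leq_trans (max_card _) _; rewrite card_prod card_ord -/N.
by nia.
Qed.

End Cells.

(** * Thinning a weighted point set *)

Section Step.
Variable R : realType.
Local Notation vec := ('I_3 -> R).

(* The width is homogeneous and even, so directions are normalised to have one
   coordinate equal to 1 and the others in [[-1, 1]]. *)
Definition face_vec (f : 'I_3) (x y : R) : vec :=
  fun g => if g == f then 1 else if g == f + 1 then x else y.

Lemma face_vec_le1 f x y : -1 <= x <= 1 -> -1 <= y <= 1 ->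
  forall g, `|face_vec f x y g| <= 1.
Proof.
move=> hx hy g; rewrite /face_vec.
by case: ifP => _; [rewrite normr1|case: ifP => _; rewrite ler_norml].
Qed.

Lemma face_vec_is_face f x y : -1 <= x <= 1 -> -1 <= y <= 1 ->
  is_face (face_vec f x y).
Proof.
move=> hx hy; split; first exact: face_vec_le1.
by exists f; rewrite /face_vec eqxx normr1.
Qed.

Lemma face_vec_close f x y x' y' (d : R) : `|x - x'| <= d -> `|y - y'| <= d ->
  forall g, `|face_vec f x y g - face_vec f x' y' g| <= d.
Proof.
move=> hx hy g; rewrite /face_vec; case: ifP => _; last by case: ifP.
by rewrite subrr normr0 (le_trans _ hx).
Qed.

Lemma dot_lipschitz (u m m' : vec) (d : R) : is_unit u ->
  (forall g, `|m g - m' g| <= d) -> `| `|dot u m| - `|dot u m'| | <= 3 * d.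
Proof.
move=> u1 mm; apply: le_trans (ler_dist_dist _ _) _.
rewrite /dot -sumrB; apply: le_trans (ler_norm_sum _ _ _) _.
apply: le_trans (_ : \sum_(g < 3) d <= _); last by rewrite sumr_const card_ord mulr_natl.
apply: ler_sum => g _; rewrite -mulrBr normrM -[leRHS]mul1r.
by apply: ler_pM => //; exact: unit_le1.
Qed.

(* [2^(-5k/2)] *)
Definition rate k : R := (Num.sqrt 2)^-1 ^+ (5 * k).

Lemma rate_gt0 k : 0 < rate k.
Proof. by rewrite exprn_gt0 // invr_gt0 sqrtr_gt0. Qed.

Lemma rate_sqr k : rate k ^+ 2 = 2 ^- (5 * k).
Proof. by rewrite /rate -exprM mulnC exprM exprVn sqr_sqrtr // exprVn. Qed.

(** Chains of directions can stop at mesh [2 ^- (3 * k)]: there the Lipschitz bound is already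
    within the rate. *)
Lemma rate_ge k : 2 ^- (3 * k) <= rate k.
Proof.
rewrite -(@ler_pXn2r _ 2) ?nnegrE ?invr_ge0 ?exprn_ge0 ?(ltW (rate_gt0 _)) //.
rewrite rate_sqr exprVn -exprM lef_pV2 ?posrE ?exprn_gt0 //.
by apply: ler_weXn2l; [lra|lia].
Qed.

Lemma sum_geometric_linear n :
  \sum_(l < n) l.+1%:R / 2 ^+ l = 4 - (2 * n + 4)%:R / 2 ^+ n :> R.
Proof.
elim: n => [|n IH]; first by rewrite big_ord0 expr0; lra.
rewrite big_ord_recr /= IH exprS !natrD !natrM -!natr1.
by field; rewrite expf_neq0.
Qed.

Variables (T : finType) (v : T -> vec).
Hypothesis v_unit : forall t, is_unit (v t).

Definition width (w : T -> R) (m : vec) : R := \sum_t w t * `|dot (v t) m|.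

Definition support (w : T -> R) : {set T} := [set t | w t != 0].

Variables (k : nat) (w : T -> R) (D : R).
Hypothesis w_ge0 : forall t, 0 <= w t.
Hypothesis w_sum : \sum_t w t = 1.
Hypothesis w_cell : forall c, \sum_(t | cell k (v t) == c) w t <= D / 4 ^+ k.
Hypothesis D_gt0 : 0 < D.

(** Five points against four linear conditions, the mass (index [ord0] of [u]) and three
    coordinates, leave a dependence. Multiplied by [w], it is a change bounded by [w] and equal to
    [w] at one point. *)
Lemma balanced_clusters (K : nat) : (4 * #|cell_type k| + 5 * K <= #|support w|)%N ->
  exists (A : 'I_K -> {set T}) (kap : 'I_K -> cell_type k) (b : 'I_K -> T -> R),
    [/\ forall i j, i != j -> [disjoint A i & A j],
        forall j t, t \in A j -> cell k (v t) = kap j,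
        forall j t, t \notin A j -> b j t = 0,
        forall j t, `|b j t| <= w t &
    [/\ forall j, \sum_t b j t = 0,
        forall j g, \sum_t b j t * v t g = 0 &
        forall j, exists t, [/\ t \in A j, t \in support w & b j t = w t]]].
Proof.
move=> /(disjoint_fivefold_clusters (fun t => cell k (v t)))[A [A1 A2]].
have cl (j : 'I_K) : exists p : cell_type k * (T -> R),
    [/\ forall t, t \in A j -> cell k (v t) = p.1,
        forall t, t \notin A j -> p.2 t = 0,
        forall t, `|p.2 t| <= w t &
    [/\ \sum_t p.2 t = 0,
        forall g, \sum_t p.2 t * v t g = 0 &
        exists t, [/\ t \in A j, t \in support w & p.2 t = w t]]].
  have [AS A5 [c Ac]] := A1 j (ltn_ord j).
  pose u t (g : 'I_4) := w t * (if unlift ord0 g is Some h then v t h else 1).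
  have [|x [x1 x2 [t0 t0A xt0] x4]] := @linear_dependence R T (A j) 4 u.
    by rewrite A5.
  exists (c, fun t => x t * w t); split => //=.
  - by move=> t /x1 ->; rewrite mul0r.
  - by move=> t; rewrite normrM (ger0_norm (w_ge0 t)) ler_piMl.
  split.
  - transitivity (\sum_t x t * u t ord0); last exact: x4.
    by apply: eq_bigr => t _; rewrite /u unlift_none mulr1.
  - move=> g; transitivity (\sum_t x t * u t (lift ord0 g)); last exact: x4.
    by apply: eq_bigr => t _; rewrite /u liftK mulrA.
  exists t0; rewrite xt0 mul1r; split=> //.
  exact: (fintype.subsetP AS).
have [p P] := choice cl.
exists (fun j => A j), (fun j => (p j).1), (fun j => (p j).2); split.
- by move=> i j ij; apply: A2.
- by move=> j; case: (P j).
- by move=> j; case: (P j).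
- by move=> j; case: (P j).
- by split=> j; case: (P j) => _ _ _ [].
Qed.

Section Recolour.
Variables (K : nat) (A : 'I_K -> {set T}) (kap : 'I_K -> cell_type k).
Variable b : 'I_K -> T -> R.
Hypothesis A_disj : forall i j, i != j -> [disjoint A i & A j].
Hypothesis A_cell : forall j t, t \in A j -> cell k (v t) = kap j.
Hypothesis b_out : forall j t, t \notin A j -> b j t = 0.
Hypothesis b_le : forall j t, `|b j t| <= w t.
Hypothesis b_sum : forall j, \sum_t b j t = 0.
Hypothesis b_dot : forall j g, \sum_t b j t * v t g = 0.
Hypothesis b_peak : forall j, exists t, [/\ t \in A j, t \in support w & b j t = w t].

Let mass j := \sum_(t in A j) w t.

Let mass_ge0 j : 0 <= mass j.
Proof. exact: sumr_ge0. Qed.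

Let sum_mass (P : pred 'I_K) (Q : pred T) :
  (forall j t, P j -> t \in A j -> Q t) ->
  \sum_(j | P j) mass j <= \sum_(t | Q t) w t.
Proof.
move=> PQ; rewrite (exchange_big_dep Q) /=; last by move=> j t; exact: PQ.
apply: ler_sum => t _.
have [j /andP[Pj tj]|none] := pickP (fun j => P j && (t \in A j)).
  rewrite (bigD1 j) ?Pj //= big1 ?addr0 // => i /andP[/andP[_ ti] ij].
  by have /disjointFr/(_ ti) := A_disj ij; rewrite tj.
by rewrite big_pred0.
Qed.

Let mass_le j : mass j <= D / 4 ^+ k.
Proof.
apply: le_trans (w_cell (kap j)).
rewrite -[mass j](big_pred1_eq +%R); apply: sum_mass => i t /eqP -> /A_cell ->.
exact: eqxx.
Qed.

Let b_mass j (F : T -> R) (d : R) : (forall t, t \in A j -> `|F t| <= d) ->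
  `|\sum_t b j t * F t| <= d * mass j.
Proof.
move=> Fd; apply: le_trans (ler_norm_sum _ _ _) _.
rewrite (bigID (mem (A j))) /= [X in _ + X]big1 ?addr0; last first.
  by move=> t /b_out ->; rewrite mul0r normr0.
rewrite mulr_sumr; apply: ler_sum => t tA.
by rewrite normrM mulrC ler_pM // Fd.
Qed.

(** Of the two factors in each square, one is bounded by its maximum and the other is summed:
    disjoint clusters in [Z] have total mass at most [#|Z|] times the cell bound. So the variance is
    governed by the crossed cells and not by the number of clusters. *)
Let energy (F : T -> R) (Z : {set cell_type k}) (d : R) : 0 <= d ->
  (forall j, kap j \notin Z -> \sum_t b j t * F t = 0) ->
  (forall t, cell k (v t) \in Z -> `|F t| <= d) ->
  \sum_j (\sum_t b j t * F t) ^+ 2 <= d ^+ 2 * #|Z|%:R * (D / 4 ^+ k) ^+ 2.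
Proof.
move=> d0 zero small; set M := D / _.
have M0 : 0 <= M by rewrite divr_ge0 ?exprn_ge0 // ltW.
apply: (@le_trans _ _ (\sum_(j | kap j \in Z) d ^+ 2 * M * mass j)).
  rewrite (bigID (fun j => kap j \in Z)) /= [X in _ + X]big1 ?addr0; last first.
    by move=> j /zero ->; rewrite expr0n.
  apply: ler_sum => j jZ.
  have h : `|\sum_t b j t * F t| <= d * mass j.
    by apply: b_mass => t /A_cell e; apply: small; rewrite e.
  rewrite -real_normK ?num_real //.
  apply: (@le_trans _ _ ((d * mass j) ^+ 2)).
    by rewrite lerXn2r ?nnegrE ?mulr_ge0.
  by rewrite exprMn -mulrA ler_wpM2l ?sqr_ge0 // expr2 ler_wpM2r // mass_le.
rewrite -mulr_sumr [leRHS](_ : _ = d ^+ 2 * M * (#|Z|%:R * M)); last by ring.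
apply: ler_wpM2l; first exact: mulr_ge0 (sqr_ge0 d) M0.
rewrite (partition_big kap (fun c => c \in Z)) //= mulr_natl -sumr_const.
apply: ler_sum => c cZ; apply: le_trans (w_cell c).
by apply: sum_mass => j t /andP[_ /eqP <-] /A_cell ->.
Qed.

Let b_dot0 j m : \sum_t b j t * dot (v t) m = 0.
Proof.
under eq_bigr do rewrite /dot mulr_sumr.
rewrite exchange_big big1 //= => g _.
under eq_bigr do rewrite mulrA.
by rewrite -mulr_suml b_dot mul0r.
Qed.

Definition shift j m := \sum_t b j t * `|dot (v t) m|.

(** On an uncrossed cell the absolute value is a linear form up to a fixed sign, and the change
    preserves the barycentre. *)
Let shift_uncrossed j m : kap j \notin crossed v k m -> shift j m = 0.
Proof.
move=> /crossed_same_sign[] h; rewrite /shift.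
  transitivity (\sum_t b j t * dot (v t) m); last exact: b_dot0.
  apply: eq_bigr => t _.
  have [/A_cell/h h0|/b_out ->] := boolP (t \in A j); last by rewrite !mul0r.
  by rewrite ger0_norm.
transitivity (- \sum_t b j t * dot (v t) m); last by rewrite b_dot0 oppr0.
rewrite -sumrN; apply: eq_bigr => t _.
have [/A_cell/h h0|/b_out ->] := boolP (t \in A j); last by rewrite !mul0r oppr0.
by rewrite ler0_norm // mulrN.
Qed.

(* [90 ^ 2 = 3 ^ 2 * 900], where [900 * 2 ^ k] bounds the number of cells crossed
   by one of two directions (see [crossed_card]). *)
Definition spread l : R := 90 * D * rate k / 2 ^+ l.

Let spread_sqr l : spread l ^+ 2 =
  (3 / 2 ^+ (k + l)) ^+ 2 * (900 * 2 ^+ k) * (D / 4 ^+ k) ^+ 2.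
Proof.
have -> : 4 ^+ k = (2 ^+ k) ^+ 2 :> R by rewrite -exprM mulnC exprM; congr (_ ^+ _); ring.
have := rate_sqr k; rewrite mulnC exprM exprD /spread.
have z0 : 2 ^+ k != 0 :> R by rewrite expf_neq0.
have y0 : 2 ^+ l != 0 :> R by rewrite expf_neq0.
set z := 2 ^+ k in z0 *; set y := 2 ^+ l in y0 *; set r := rate k => r2.
rewrite !exprMn r2; field.
by rewrite z0 y0.
Qed.

Let shift_energy m : is_face m -> \sum_j shift j m ^+ 2 <= spread 0 ^+ 2.
Proof.
move=> mf; have [m1 _] := mf.
apply: (le_trans (@energy _ (crossed v k m) (2 / 2 ^+ k) _ _ _)).
- by rewrite divr_ge0 ?exprn_ge0.
- by move=> j /shift_uncrossed.
- by move=> t tc; rewrite normr_id; apply: crossed_small.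
rewrite spread_sqr addn0 ler_wpM2r ?sqr_ge0 // ler_pM ?sqr_ge0 //.
  by rewrite lerXn2r ?nnegrE ?divr_ge0 ?exprn_ge0 // ler_wpM2r ?invr_ge0 ?exprn_ge0 //; lra.
rewrite -natrX -natrM ler_nat (leq_trans (crossed_card v_unit k mf)) //.
by rewrite leq_mul2r orbC.
Qed.

(** Here smallness comes from the distance of the two directions rather than from proximity to the
    great circle, which gains the factor [2 ^- l]; the cells crossed by either direction count. *)
Let shift_diff_energy l m m' : is_face m -> is_face m' ->
  (forall g, `|m g - m' g| <= 2 ^- (k + l)) ->
  \sum_j (shift j m - shift j m') ^+ 2 <= spread l ^+ 2.
Proof.
move=> mf mf' mm.
under eq_bigr => j _ do
  (rewrite /shift -sumrB; under eq_bigr => t _ do rewrite -mulrBr).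
apply: (le_trans (@energy _ (crossed v k m :|: crossed v k m') (3 / 2 ^+ (k + l)) _ _ _)).
- by rewrite divr_ge0 ?exprn_ge0.
- move=> j; rewrite inE negb_or => /andP[/shift_uncrossed h1 /shift_uncrossed h2].
  under eq_bigr => t _ do rewrite mulrBr.
  by rewrite sumrB -/(shift j m) -/(shift j m') h1 h2 subr0.
- by move=> t _; apply: dot_lipschitz.
rewrite spread_sqr ler_wpM2r ?sqr_ge0 // ler_wpM2l ?sqr_ge0 //.
rewrite -natrX -natrM ler_nat (leq_trans (leq_card_setU _ _)) //.
have := crossed_card v_unit k mf; have := crossed_card v_unit k mf'; lia.
Qed.


(** Faces carry no sign, as the width is even. *)
Let net l : finType := ('I_3 * ('I_(2 ^ l.+1).+1 * 'I_(2 ^ l.+1).+1))%type.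

Definition node_vec l f i j : vec := face_vec f (node R l i) (node R l j).

(** Difference with the parent node. At [l = 0], where chains begin, it is the full shift. *)
Let increment l (c : net (k + l)) j : R :=
  shift j (node_vec (k + l) c.1 c.2.1 c.2.2) -
  (if l is l'.+1 then shift j (node_vec (k + l') c.1 c.2.1./2 c.2.2./2) else 0).

Let node_vec_face l f (i j : 'I_(2 ^ l.+1).+1) : is_face (node_vec l f i j).
Proof. by apply: face_vec_is_face; apply: node_itv; rewrite -ltnS. Qed.

Let increment_energy l (c : net (k + l)) :
  \sum_j increment c j ^+ 2 <= spread l ^+ 2.
Proof.
case: c => f [i j]; rewrite /increment /=; case: l i j => [|l] i j.
  by under eq_bigr do rewrite subr0; exact: shift_energy.
apply: shift_diff_energy => //.
  have half a : (a < (2 ^ (k + l.+1).+1).+1)%N -> (a./2 <= 2 ^ (k + l).+1)%N.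
    by rewrite ltnS addnS expnS => h; rewrite leq_half_double -mul2n (leq_trans h).
  by apply: face_vec_is_face; apply: node_itv; exact: half (ltn_ord _).
have close (a c : nat) g : `|node_vec (k + l.+1) f a c g -
    node_vec (k + l) f a./2 c./2 g| <= 2 ^- (k + l.+1).
  by rewrite addnS; apply: face_vec_close; exact: node_half.
by move=> g; exact: close.
Qed.

Let spread_gt0 l : 0 < spread l.
Proof. by rewrite divr_gt0 ?exprn_gt0 // mulr_gt0 ?rate_gt0 // mulr_gt0. Qed.

(** Level [l] has at most [27 * 4 ^ (k + l)] directions, each of cost [expR (- 8 * (l + 1) ^ 2) <=
    256 ^- (l + 1)]. Level [l] thus costs at most [4 ^ k * 2 ^- (l + 1)], and all levels together at
    most [4 ^ k]. *)
Let budget n : (43 * 4 ^ k <= K)%N ->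
  5 * \sum_(i : {l : 'I_n & net (k + l)}) expR (- ((8 * (tag i).+1%:R) ^+ 2 / 8))
  <= K%:R / 4 :> R.
Proof.
move=> hK.
rewrite -(sig_big_dep xpredT (fun _ => xpredT)
  (fun (l : 'I_n) (_ : net (k + l)) => expR (- ((8 * l.+1%:R) ^+ 2 / 8)))) /=.
have term (l : 'I_n) :
    \sum_(c : net (k + l)) expR (- ((8 * l.+1%:R) ^+ 2 / 8)) <= 4 ^+ k * 2 ^- l.+1 :> R.
  rewrite sumr_const !card_prod !card_ord.
  have h1 : expR (- ((8 * l.+1%:R) ^+ 2 / 8)) <= 256 ^- l.+1 :> R.
    have e2 : expR (- 8 : R) <= 256^-1.
      rewrite expRN lef_pV2 ?posrE ?expR_gt0 // -[8]mulr1 expRM_natl.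
      have : 2 <= expR 1 :> R by have := expR_ge1Dx (1 : R); lra.
      move=> h; apply: (@le_trans _ _ (2 ^+ 8)); first by rewrite -natrX ler_nat.
      by rewrite lerXn2r ?nnegrE ?expR_ge0.
    apply: (@le_trans _ _ (expR (l.+1%:R * (- 8)))).
      rewrite ler_expR; have : 1 <= l.+1%:R :> R by rewrite ler1n.
      by rewrite expr2; nra.
    by rewrite expRM_natl -exprVn lerXn2r ?nnegrE ?expR_ge0.
  have h2 : (3 * ((2 ^ (k + l).+1).+1 * (2 ^ (k + l).+1).+1) <= 27 * (4 ^ k * 4 ^ l))%N.
    have : (0 < 2 ^ (k + l))%N by rewrite expn_gt0.
    by rewrite -expnD (_ : 4 = 2 * 2)%N // expnMn expnS; nia.
  rewrite -[leLHS]mulr_natl.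
  apply: (@le_trans _ _ ((27 * (4 ^ k * 4 ^ l))%:R * 256 ^- l.+1)).
    by apply: ler_pM; rewrite ?ler0n ?expR_ge0 ?ler_nat.
  rewrite natrM natrM !natrX mulrCA -!mulrA ler_wpM2l ?exprn_ge0 //.
  have -> : 256 = 4 * 64 :> R by rewrite -natrM.
  have y0 : 4 ^+ l != 0 :> R by rewrite expf_neq0.
  rewrite exprMn [4 ^+ l.+1]exprS (_ : _ * _ = 27 / 4 * 64 ^- l.+1); last first.
    by field; rewrite y0 expf_neq0.
  have -> : 64 = 32 * 2 :> R by rewrite -natrM.
  rewrite exprMn invfM mulrA ler_piMl ?invr_ge0 ?exprn_ge0 //.
  rewrite ler_pdivrMr ?exprn_gt0 // mul1r exprS.
  have : 1 <= 32 ^+ l :> R by rewrite exprn_ege1 // ler1n.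
  by lra.
have sum2 : \sum_(l < n) 2 ^- l.+1 <= 1 :> R.
  suff -> : \sum_(l < n) 2 ^- l.+1 = 1 - 2 ^- n :> R by rewrite gerBl invr_ge0 exprn_ge0.
  elim: {term}n => [|m IH]; first by rewrite big_ord0 expr0 invr1 subrr.
  by rewrite big_ord_recr /= IH exprS; field; rewrite expf_neq0.
apply: (@le_trans _ _ (5 * \sum_(l < n) 4 ^+ k * 2 ^- l.+1)).
  by rewrite ler_pM2l //; apply: ler_sum => l _; exact: term.
rewrite -mulr_sumr.
have k0 : 0 <= 4 ^+ k :> R by rewrite exprn_ge0.
have : (43 * 4 ^ k)%:R <= K%:R :> R by rewrite ler_nat.
rewrite natrM natrX.
set Q := \sum_(l < n) _ in sum2 *.
by set z := 4 ^+ k in k0 *; nra.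
Qed.


Lemma recolour : (43 * 4 ^ k <= K)%N ->
  exists w' : T -> R,
    [/\ forall t, 0 <= w' t,
        forall c, \sum_(t | cell k (v t) == c) w' t =
                  \sum_(t | cell k (v t) == c) w t,
        (#|support w'| + 4 ^ k <= #|support w|)%N &
        forall f x y, -1 <= x <= 1 -> -1 <= y <= 1 ->
          `|width w' (face_vec f x y) - width w (face_vec f x y)| <=
          (2880 * D + 3) * rate k].
Proof.
move=> hK.
have K0 : (0 < K)%N by apply: leq_trans hK; rewrite muln_gt0 expn_gt0.
(* Levels 0 to [2 * k], so that the finest net has mesh [2 ^- (3 * k)]. *)
pose a (i : {l : 'I_(2 * k).+1 & net (k + l)}) j := increment (tagged i) j.
pose sg (i : {l : 'I_(2 * k).+1 & net (k + l)}) := spread (tag i).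
pose lm (i : {l : 'I_(2 * k).+1 & net (k + l)}) : R := 8 * (tag i).+1%:R.
have [] := @partial_coloring R 'I_K _ a sg lm.
- by move=> i; exact: spread_gt0.
- by move=> i; exact: increment_energy.
- move=> i; rewrite /lm; have : 1 <= (tag i).+1%:R :> R by rewrite ler1n.
  by lra.
- by rewrite card_ord.
- by rewrite card_ord; exact: budget.
rewrite card_ord => eps [eps_val eps_card eps_small].
have eps1 j : `|eps j| <= 1.
  by case: (eps_val j) => ->; rewrite ?normrN ?normr0 ?normr1.
pose w' t := w t + \sum_j eps j * b j t.
have w'_in j t : t \in A j -> w' t = w t + eps j * b j t.
  move=> tj; rewrite /w' (bigD1 j) //= big1 ?addr0 // => i ij.
  by rewrite b_out ?mulr0 //; rewrite (disjointFl (A_disj ij) tj).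
have w'_out t : (forall j, t \notin A j) -> w' t = w t.
  by move=> h; rewrite /w' big1 ?addr0 // => j _; rewrite b_out ?mulr0.
have w'E m : width w' m - width w m = \sum_j eps j * shift j m.
  rewrite /width -sumrB.
  under eq_bigr => t _ do rewrite -mulrBl /w' [w t + _]addrC addrK mulr_suml.
  rewrite exchange_big; apply: eq_bigr => j _; rewrite /shift mulr_sumr.
  by apply: eq_bigr => t _; rewrite mulrA.
exists w'; split.
- move=> t; have [/existsP[j tj]|/existsPn h] := boolP [exists j, t \in A j].
    rewrite (w'_in _ _ tj); have : `|eps j * b j t| <= w t.
      by rewrite normrM -[leRHS]mul1r ler_pM.
    by rewrite ler_norml => /andP[? _]; lra.
  by rewrite w'_out.
- move=> c; rewrite /w' big_split /= [X in _ + X]exchange_big /= [X in _ + X]big1 ?addr0 //.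
  move=> j _; rewrite -mulr_sumr.
  have [<-|nc] := eqVneq (kap j) c.
    suff -> : \sum_(t | cell k (v t) == kap j) b j t = \sum_t b j t.
      by rewrite b_sum mulr0.
    rewrite [RHS](bigID (fun t => cell k (v t) == kap j)) /= [X in _ + X]big1 ?addr0 //.
    by move=> t; have [/A_cell ->|/b_out] := boolP (t \in A j); rewrite ?eqxx.
  rewrite big1 ?mulr0 // => t /eqP tc; apply: b_out; apply/negP => /A_cell e.
  by move: nc; rewrite -tc e eqxx.
- have [peak peakP] := choice b_peak.
  (* A cluster coloured -1 has [b = w] at its peak, where the new weight vanishes. Peaks of disjoint
     clusters are distinct, and at least [K / 16] clusters have this colour, which exceeds [4 ^ k]
     as [43 > 16]. *)
  pose dead := [set peak j | j in [pred j | eps j == - 1]].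
  have peak_inj : injective peak.
    move=> i j e; apply/eqP/negPn/negP => /A_disj dij.
    have [pi _ _] := peakP i; have [pj _ _] := peakP j.
    by move: (disjointFr dij pi); rewrite e pj.
  have dead_card : (4 ^ k <= #|dead|)%N.
    by rewrite card_imset //; move: eps_card hK; set n := #|_|; lia.
  have dead_sub : dead \subset support w.
    by apply/fintype.subsetP => t /imsetP[j _ ->]; case: (peakP j).
  have sub : support w' \subset support w :\: dead.
    apply/fintype.subsetP => t; rewrite !inE => w't; apply/andP; split.
      apply/negP => /imsetP[j]; rewrite inE => /eqP ej et; move/negP: w't; apply.
      have [pj _ bp] := peakP j.
      by rewrite et (w'_in _ _ pj) ej bp mulN1r subrr.
    apply/eqP => wt; move/negP: w't; apply; rewrite /w' wt add0r big1 // => j _.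
    by have := b_le j t; rewrite wt normr_le0 => /eqP ->; rewrite mulr0.
  have := subset_leq_card sub; rewrite cardsD (finset.setIidPr dead_sub).
  by have := subset_leq_card dead_sub; lia.
move=> f x y hx hy; rewrite w'E.
pose X m := \sum_j eps j * shift j m; rewrite -/(X _).
pose mn n := node_vec (k + n) f (grid (k + n) x) (grid (k + n) y).
(* Telescoping over the nodes of [(x, y)]: by [grid_half] the parent of the node at level [n + 1] is
   the node at level [n], so every step is an increment controlled by the colouring. *)
have chain n : (n <= 2 * k)%N -> `|X (mn n)| <= \sum_(l < n.+1) 8 * l.+1%:R * spread l.
  elim: n => [|n IH] hn.
    have := eps_small (existT _ ord0 (f, (grid (k + 0) x, grid (k + 0) y))).
    rewrite /a /increment /= big_ord1 => h; apply: le_trans h.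
    by rewrite le_eqVlt /X; apply/orP; left; apply/eqP; congr `|_|; apply: eq_bigr => j _; rewrite subr0.
  rewrite big_ord_recr /=.
  pose l : 'I_(2 * k).+1 := Ordinal (hn : (n.+1 < (2 * k).+1)%N).
  have := eps_small (existT (fun l : 'I_(2 * k).+1 => net (k + l)) l (f, (grid (k + n.+1) x, grid (k + n.+1) y))).
  rewrite /a /increment /= => h.
  rewrite (_ : X (mn n.+1) = X (mn n) + \sum_j eps j *
    (shift j (mn n.+1) - shift j (node_vec (k + n) f
       (grid (k + n.+1) x)./2 (grid (k + n.+1) y)./2))).
    by apply: le_trans (ler_normD _ _) _; apply: lerD => //; apply: IH; exact: ltnW.
  rewrite /X -big_split /=; apply: eq_bigr => j _.
  by rewrite addnS -!grid_half // mulrBr addrC subrK.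
have tail : `|X (face_vec f x y) - X (mn (2 * k)%N)| <= 3 * rate k.
  rewrite /X -sumrB; apply: le_trans (ler_norm_sum _ _ _) _.
  apply: (@le_trans _ _ (\sum_j 3 * rate k * mass j)); last first.
    rewrite -mulr_sumr ler_piMr ?mulr_ge0 ?(ltW (rate_gt0 _)) //.
    by rewrite -w_sum; exact: sum_mass.
  apply: ler_sum => j _; rewrite -mulrBr normrM -[leRHS]mul1r ler_pM //.
  rewrite /shift -sumrB; under eq_bigr do rewrite -mulrBr.
  apply: b_mass => t _; apply: dot_lipschitz => // g.
  apply: le_trans (rate_ge k); rewrite (_ : 3 * k = k + 2 * k)%N; last by lia.
  by apply: face_vec_close; exact: node_grid.
have := chain _ (leqnn (2 * k)%N).
(* The thresholds contribute 8 and [spread] 90; the remaining series is below 4, whence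
   [2880 = 4 * 720]. *)
have -> : \sum_(l < (2 * k).+1) 8 * l.+1%:R * spread l =
   720 * D * rate k * \sum_(l < (2 * k).+1) l.+1%:R / 2 ^+ l.
  rewrite mulr_sumr; apply: eq_bigr => l _; rewrite /spread; field.
  by rewrite expf_neq0.
rewrite sum_geometric_linear; set q := _ / _.
have q0 : 0 <= q by rewrite divr_ge0 ?exprn_ge0.
have r0 := rate_gt0 k; have Dr := mulr_gt0 D_gt0 r0.
move: tail; rewrite !ler_norml => /andP[? ?] /andP[? ?].
by apply/andP; split; nra.
Qed.

End Recolour.

Lemma thinning : (432 * 4 ^ k <= #|support w|)%N ->
  exists w' : T -> R,
    [/\ forall t, 0 <= w' t,
        forall c, \sum_(t | cell k (v t) == c) w' t =
                  \sum_(t | cell k (v t) == c) w t,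
        (#|support w'| + 4 ^ k <= #|support w|)%N &
        forall f x y, -1 <= x <= 1 -> -1 <= y <= 1 ->
          `|width w' (face_vec f x y) - width w (face_vec f x y)| <=
          (2880 * D + 3) * rate k].
Proof.
(* As [432 = 2 * 4 * 54], the [4 * #|cell_type k|] points that may stay unclustered are at most half
   the support; the other half provides [5 * K] points. Then [432 / 10] gives the [43] of
   [recolour]. *)
move=> big; pose K := (#|support w| %/ 10)%N.
have k0 : (0 < 4 ^ k)%N by rewrite expn_gt0.
have K1 : (4 * #|cell_type k| + 5 * K <= #|support w|)%N.
  by have := card_cell_type k; move: big; rewrite /K; lia.
have [A [kap [b [h1 h2 h3 h4 [h5 h6 h7]]]]] := balanced_clusters K1.
by apply: (recolour h1 h2 h3 h4 h5 h6 h7); move: big; rewrite /K; lia.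
Qed.

End Step.

(** * Descending through the scales *)

Section Iteration.
Variable R : realType.
Local Notation vec := ('I_3 -> R).

Lemma rate_half k : rate R k.+1 <= rate R k / 2.
Proof.
rewrite /rate mulnS exprD mulrC ler_pM2l ?rate_gt0 //.
have h : (Num.sqrt (2 : R))^-1 ^+ 2 = 2^-1 by rewrite exprVn sqr_sqrtr.
have s0 : 0 <= (Num.sqrt (2 : R))^-1 by rewrite invr_ge0 sqrtr_ge0.
have s1 : (Num.sqrt (2 : R))^-1 <= 1.
  rewrite -(@ler_pXn2r _ 2) ?nnegrE // h; lra.
by rewrite -h ler_wiXn2l.
Qed.

Variables (T : finType) (v : T -> vec).
Hypothesis v_unit : forall t, is_unit (v t).

(** The invariant of the descent: mass bounds of the initial grid survive any number of rounds, at
    the current scale and at all coarser ones. *)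
Definition same_cells k (w w' : T -> R) :=
  forall c, \sum_(t | cell k (v t) == c) w' t = \sum_(t | cell k (v t) == c) w t.

Lemma same_cells_sum k w w' : same_cells k w w' -> \sum_t w' t = \sum_t w t.
Proof.
move=> h; rewrite (partition_big (fun t => cell k (v t)) xpredT) //=.
rewrite [RHS](partition_big (fun t => cell k (v t)) xpredT) //=.
exact: eq_bigr.
Qed.

Definition coarse k (c : cell_type k.+1) : cell_type k :=
  (c.1, (inord c.2.1./2, inord c.2.2./2)).

Lemma cell_coarse k t : cell k (v t) = coarse (cell k.+1 (v t)).
Proof.
rewrite /coarse /cell /=; congr (_, (_, _)); apply: val_inj => /=;
  by rewrite -grid_half ?ratio_itv // inordK.
Qed.

Lemma same_cells_coarse k w w' : same_cells k.+1 w w' -> same_cells k w w'.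
Proof.
move=> h c.
have E (u : T -> R) : \sum_(t | cell k (v t) == c) u t =
    \sum_(d | coarse d == c) \sum_(t | cell k.+1 (v t) == d) u t.
  rewrite (partition_big (fun t => cell k.+1 (v t)) (fun d => coarse d == c)) /=.
    apply: eq_bigr => d /eqP dc; apply: eq_bigl => t.
    rewrite cell_coarse; case: (eqVneq (cell k.+1 (v t)) d) => [->|_].
      by rewrite dc eqxx.
    by rewrite andbF.
  by move=> t; rewrite cell_coarse.
by rewrite !E; apply: eq_bigr => d _.
Qed.

Variables (D : R).
Hypothesis D_gt0 : 0 < D.

Let E := 2880 * D + 3.

(** Each round deletes at least [4 ^ k] points at the price [E * rate R k], and [s] rounds remove
    the excess. *)
Lemma thin_level k s (w : T -> R) :
  (forall t, 0 <= w t) -> \sum_t w t = 1 ->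
  (forall c, \sum_(t | cell k (v t) == c) w t <= D / 4 ^+ k) ->
  (#|support w| <= 432 * 4 ^ k + s * 4 ^ k)%N ->
  exists w' : T -> R,
    [/\ forall t, 0 <= w' t, same_cells k w w',
        (#|support w'| <= 432 * 4 ^ k)%N &
        forall f x y, -1 <= x <= 1 -> -1 <= y <= 1 ->
          `|width v w' (face_vec f x y) - width v w (face_vec f x y)| <=
          s%:R * E * rate R k].
Proof.
elim: s w => [|s IH] w w0 w1 wc ws.
  exists w; split=> //; first by move: ws; rewrite mul0n addn0.
  by move=> f x y _ _; rewrite subrr normr0 !mul0r.
have E0 : 0 <= E by rewrite /E; have := D_gt0; lra.
have [small|big] := leqP #|support w| (432 * 4 ^ k).
  exists w; split=> // f x y _ _.
  by rewrite subrr normr0 !mulr_ge0 ?ler0n ?(ltW (rate_gt0 _ _)).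
have [u [u0 uc us uw]] := thinning v_unit w0 w1 wc D_gt0 (ltnW big).
have [||||u' [u'0 u'c u's u'w]] := IH u => //.
- by rewrite (same_cells_sum uc).
- by move=> c; rewrite uc.
- by move: us ws; lia.
exists u'; split=> //; first by move=> c; rewrite u'c uc.
move=> f x y hx hy.
rewrite -[_ - width v w _](subrKA (width v u (face_vec f x y))).
apply: le_trans (ler_normD _ _) _.
rewrite -natr1 !mulrDl mul1r; apply: lerD; [exact: u'w|exact: uw].
Qed.

(** From [432 * 4 ^ (k + 1)] to [432 * 4 ^ k] points there are [1296 = 3 * 432] rounds. The constant
    [2592] solves [1296 + c / 2 = c], so [rate_half] closes the induction. Only the first scale,
    which starts from all of [T], takes [s] rounds. *)
Lemma thin_to_level (kappa s : nat) (w : T -> R) :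
  (forall t, 0 <= w t) -> \sum_t w t = 1 ->
  (forall k c, (k <= kappa)%N -> \sum_(t | cell k (v t) == c) w t <= D / 4 ^+ k) ->
  (#|T| <= s * 4 ^ kappa)%N ->
  forall n, (n <= kappa)%N ->
  exists w' : T -> R,
    [/\ forall t, 0 <= w' t, same_cells (kappa - n) w w',
        (#|support w'| <= 432 * 4 ^ (kappa - n))%N &
        forall f x y, -1 <= x <= 1 -> -1 <= y <= 1 ->
          `|width v w' (face_vec f x y) - width v w (face_vec f x y)| <=
          E * (s%:R * rate R kappa + 2592 * rate R (kappa - n))].
Proof.
move=> w0 w1 wc Ts; have E0 : 0 <= E by rewrite /E; have := D_gt0; lra.
elim=> [|n IH] hn.
  have [||w' [w'0 w'c w's w'w]] := @thin_level kappa s w w0 w1.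
  - by move=> c; apply: wc.
  - by apply: leq_trans (max_card _) _; move: Ts; lia.
  exists w'; rewrite subn0; split=> // f x y hx hy.
  apply: le_trans (w'w f x y hx hy) _.
  have := mulr_ge0 E0 (ltW (rate_gt0 R kappa)); lra.
have [u [u0 uc us uw]] := IH (ltnW hn).
have ek : (kappa - n = (kappa - n.+1).+1)%N by lia.
move: uc us uw; rewrite ek; set k := (kappa - n.+1)%N => uc us uw.
have uc' := same_cells_coarse uc.
have [|||w' [w'0 w'c w's w'w]] := @thin_level k 1296 u u0.
- by rewrite (same_cells_sum uc).
- by move=> c; rewrite uc' wc // /k; lia.
- by move: us; rewrite expnS; lia.
exists w'; split=> //; first by move=> c; rewrite w'c uc'.
move=> f x y hx hy.
rewrite -[_ - width v w _](subrKA (width v u (face_vec f x y))).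
apply: le_trans (ler_normD _ _) _.
have h1 := w'w f x y hx hy; have h2 := uw f x y hx hy.
have h3 := ler_wpM2l E0 (rate_half k).
apply: le_trans (lerD h1 h2) _; lra.
Qed.

End Iteration.

(** * An equal-area grid *)

Section SphereGrid.
Variable R : realType.
Local Notation vec := ('I_3 -> R).

(** Radial projection from the cube to its inscribed sphere does not increase distances. In terms of
    the face coordinates [p], [p'] and the inner product [X] of the points on the cube, this is
    [0 <= (1 - p * p') * ((p * p')^-1 - X)], where the second factor is nonnegative by
    Cauchy-Schwarz. *)
Lemma cell_close k (u u' : vec) : is_unit u -> is_unit u' -> cell k u = cell k u' ->
  \sum_g (u g - u' g) ^+ 2 <= 2 * (2 ^- k) ^+ 2.
Proof.
move=> u1 u1' e.
have h1 := grid_close (ratio_itv 1 u1) (ratio_itv 1 u1').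
have h2 := grid_close (ratio_itv 2 u1) (ratio_itv 2 u1').
case: e => ef es /h1 {}h1 /h2 {}h2.
have n0 := face_neq0 u1; have n0' := face_neq0 u1'.
have pp : 0 < u (face u) * u' (face u').
  move: es; case: (ltrP 0 (u (face u))) => s.
    by move=> /esym s'; rewrite mulr_gt0.
  move=> /esym/negbT; rewrite -leNgt => s'.
  by rewrite nmulr_rgt0 lt_neqAle ?n0 ?n0' ?s ?s'.
have le1 : u (face u) * u' (face u') <= 1.
  by rewrite -(gtr0_norm pp) normrM mulr_ile1 // unit_le1.
move: u1 u1'; rewrite /is_unit !(sum3_cyclic _ (face u)).
have E (x : vec) h : x (face x) != 0 -> x (face x + h) = x (face x) * ratio x h.
  by move=> x0; rewrite /ratio mulrC divfK.
have := E u' 1 n0'; have := E u' 2 n0'; rewrite -!ef in n0' pp le1 * => -> ->.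
rewrite (E u 1) // (E u 2) //.
move: h1 h2 n0 n0' pp le1.
set p := u _; set p' := u' _; set x := ratio u 1; set y := ratio u 2.
set x' := ratio u' 1; set y' := ratio u' 2; set d := 2 ^- k.
have d0 : 0 <= d by rewrite invr_ge0 exprn_ge0.
move=> h1 h2 n0 n0' pp le1 s1 s2.
have sq (z : R) : `|z| <= d -> z ^+ 2 <= d ^+ 2.
  by move=> h; rewrite -[z ^+ 2]real_normK ?num_real // lerXn2r ?nnegrE.
have {}h1 := sq _ h1; have {}h2 := sq _ h2.
have {s1} S : 1 + x ^+ 2 + y ^+ 2 = p ^- 2.
  by apply: (mulfI (expf_neq0 2 n0)); rewrite divff ?expf_neq0 // -[RHS]s1; ring.
have {s2} S' : 1 + x' ^+ 2 + y' ^+ 2 = p' ^- 2.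
  by apply: (mulfI (expf_neq0 2 n0')); rewrite divff ?expf_neq0 // -[RHS]s2; ring.
pose X := 1 + x * x' + y * y'.
have eqX : (p - p') ^+ 2 + (p * x - p' * x') ^+ 2 + (p * y - p' * y') ^+ 2 =
    2 - 2 * (p * p') * X.
  transitivity (p ^+ 2 * (1 + x ^+ 2 + y ^+ 2) + p' ^+ 2 * (1 + x' ^+ 2 + y' ^+ 2)
     - 2 * (p * p') * X); first by rewrite /X; ring.
  by rewrite S S' !divff ?expf_neq0 //; ring.
have hX : p ^- 2 + p' ^- 2 - 2 * X <= 2 * d ^+ 2.
  rewrite -S -S' (_ : _ - _ = (x - x') ^+ 2 + (y - y') ^+ 2); last by rewrite /X; ring.
  by lra.
have am : 2 * (p * p')^-1 <= p ^- 2 + p' ^- 2.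
  have := sqr_ge0 (p^-1 - p'^-1); rewrite (_ : _ ^+ 2 = p ^- 2 + p' ^- 2 - 2 * (p * p')^-1).
    by lra.
  by field; rewrite n0 n0'.
have Xle : X <= (p * p')^-1.
  have h : 0 <= 2 - 2 * (p * p') * X by rewrite -eqX !addr_ge0 ?sqr_ge0.
  by rewrite -[leRHS]mul1r ler_pdivlMr // mulrC; lra.
rewrite eqX; apply: le_trans hX; move: Xle am pp le1.
have : p * p' * (p * p')^-1 = 1 by rewrite divff // mulf_neq0.
set a := p * p'; set b := a^-1; move=> ab Xle am pp le1.
have : 0 <= (1 - a) * (b - X) by rewrite mulr_ge0 ?subr_ge0.
by rewrite mulrBl !mulrBr ab mul1r; lra.
Qed.

Lemma card_spread_real n (h : R) (A : {set 'I_n}) : 0 <= h ->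
  (forall i j, i \in A -> j \in A -> (i <= j)%N -> (j%:R - i%:R) <= h) ->
  #|A|%:R <= h + 1.
Proof.
move=> h0 hA; have /andP[t1 _] := truncn_itv h0.
apply: (@le_trans _ _ (Num.truncn h).+1%:R); last by rewrite -natr1 lerD2r.
rewrite ler_nat; apply: card_ord_spread => i j iA jA.
rewrite -leq_subLR truncn_ge_nat //.
have [ij|/ltnW ji] := leqP i j; first by rewrite (eqP ij).
by rewrite natrB // hA.
Qed.

Lemma normr_sin_muln (x : R) n : `|sin (x *+ n)| <= n%:R * `|sin x|.
Proof.
elim: n => [|n IH]; first by rewrite mulr0n sin0 normr0 mul0r.
rewrite mulrS sinD; apply: le_trans (ler_normD _ _) _.
rewrite !normrM -nat1r mulrDl mul1r lerD //.
  by rewrite ler_piMr // cos_max.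
by rewrite -[leRHS]mul1r ler_pM // cos_max.
Qed.

(** A weak Jordan inequality without convexity: some multiple [n * m / P] lies in [[1/4, 1/2]],
    where the sine of [pi] times it is at least 1/2, and [normr_sin_muln] divides this by [n]. *)
Lemma sin_pi_frac_ge (m P : nat) : (0 < P)%N -> (m.*2 <= P)%N ->
  m%:R / P%:R <= sin (pi * (m%:R / P%:R)) :> R.
Proof.
move=> P0 mP; have pi0 := pi_gt0 R.
have P0' : 0 < P%:R :> R by rewrite ltr0n.
have [->|m0] := posnP m; first by rewrite mul0r mulr0 sin0.
pose n := (P %/ m.*2)%N.
have nm1 : (n * m.*2 <= P)%N by exact: leq_divM.
have n0 : (0 < n)%N by rewrite divn_gt0 // double_gt0.
have nm2 : (P <= 4 * (n * m))%N.
  have lt : (P %% m.*2 < m.*2)%N by rewrite ltn_pmod // double_gt0.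
  have h : (m <= n * m)%N by rewrite leq_pmull.
  by rewrite {1}(divn_eq P m.*2) -/n -[in (n * _)%N]muln2 mulnA; move: lt h; lia.
pose x : R := pi * (m%:R / P%:R).
have xn : x *+ n = pi * ((n * m)%:R / P%:R) by rewrite /x natrM -mulr_natr; ring.
have q1 : 4^-1 <= (n * m)%:R / P%:R :> R.
  by rewrite ler_pdivlMr // mulrC ler_pdivrMr // mulrC -natrM ler_nat.
have q2 : (n * m)%:R / P%:R <= 2^-1 :> R.
  rewrite ler_pdivrMr // ler_pdivlMl // -natrM ler_nat.
  by move: nm1; rewrite -muln2; lia.
have s4 : 2^-1 <= sin (pi / 4 : R).
  have s0 : 0 <= sin (pi / 4 : R) by apply: sin_ge0_pi; apply/andP; split; lra.
  have := cos_mulr2n (pi / 4 : R); rewrite (_ : (pi / 4) *+ 2 = pi / 2); last by field.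
  rewrite cos_pihalf cos2sin2 => h; nra.
have sx0 : 0 <= sin x.
  have f0 : 0 <= m%:R / P%:R :> R by rewrite divr_ge0 ?ler0n.
  have f1 : m%:R / P%:R <= 1 :> R.
    by rewrite ler_pdivrMr // mul1r ler_nat; move: mP; lia.
  by apply: sin_ge0_pi; rewrite /x; apply/andP; split; nra.
have snx : 2^-1 <= n%:R * sin x.
  rewrite -(ger0_norm sx0); apply: le_trans (normr_sin_muln x n).
  apply: le_trans (ler_norm _); apply: (le_trans s4).
  rewrite xn leNgt ltr_sin; last 2 first.
  - by rewrite in_itv /=; apply/andP; split; nra.
  - by rewrite in_itv /=; apply/andP; split; nra.
  by rewrite -leNgt ler_pM2l.
have n0' : 0 < n%:R :> R by rewrite ltr0n.
rewrite -(ler_pM2l n0'); apply: le_trans snx.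
by rewrite mulrA -natrM.
Qed.

Lemma chord_ge (i j P : nat) : (i <= j)%N -> ((j - i).*2 <= P)%N -> (0 < P)%N ->
  2 * ((j%:R - i%:R) / P%:R) <=
  Num.sqrt ((cos (pi *+ 2 * (i%:R / P%:R)) - cos (pi *+ 2 * (j%:R / P%:R))) ^+ 2 +
     (sin (pi *+ 2 * (i%:R / P%:R)) - sin (pi *+ 2 * (j%:R / P%:R))) ^+ 2) :> R.
Proof.
move=> ij hP P0; have := sin_pi_frac_ge P0 hP; rewrite natrB //.
set q := _ / _ => hs; have q0 : 0 <= q by rewrite divr_ge0 ?subr_ge0 ?ler_nat.
set a := pi *+ 2 * _; set b := pi *+ 2 * _.
have ab : b - a = (pi * q) *+ 2 by rewrite /a /b /q mulrBl; ring.
rewrite (_ : _ + _ = (2 * sin (pi * q)) ^+ 2); last first.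
  have := cosB b a; rewrite ab cos_mulr2n cos2sin2.
  have := cos2Dsin2 a; have := cos2Dsin2 b.
  set ca := cos a; set sa := sin a; set cb := cos b; set sb := sin b; set s := sin _.
  move=> e1 e2 e3.
  have -> : (ca - cb) ^+ 2 + (sa - sb) ^+ 2 = (ca ^+ 2 + sa ^+ 2) + (cb ^+ 2 + sb ^+ 2) -
    2 * (cb * ca + sb * sa) by ring.
  by rewrite e1 e2 -e3; ring.
by rewrite sqrtr_sqr (le_trans _ (ler_norm _)) // ler_pM2l.
Qed.

(* By Archimedes, equidistribution in height and angle is equidistribution on the
   sphere. *)
Definition cyl_vec (z a : R) : vec := fun g =>
  if val g is n.+1 then (if n is _.+1 then z else Num.sqrt (1 - z ^+ 2) * sin a)
  else Num.sqrt (1 - z ^+ 2) * cos a.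

Lemma sum_cyl (F : nat -> R -> R) z a :
  \sum_(g < 3) F g (cyl_vec z a g) =
  F 0%N (Num.sqrt (1 - z ^+ 2) * cos a) + F 1%N (Num.sqrt (1 - z ^+ 2) * sin a) + F 2%N z.
Proof. by rewrite !big_ord_recl big_ord0 addr0 addrA. Qed.

Lemma cyl_unit z a : 0 <= z <= 1 -> is_unit (cyl_vec z a).
Proof.
move=> /andP[z0 z1]; rewrite /is_unit (sum_cyl (fun _ x => x ^+ 2)).
rewrite !exprMn -mulrDr cos2Dsin2 mulr1 sqr_sqrtr ?subrK //.
by rewrite subr_ge0 expr_le1.
Qed.

Variables (N P : nat).
Hypotheses (N0 : (0 < N)%N) (P0 : (0 < P)%N).

(** Values in [[0, 1)]: the width is even, so one hemisphere represents the sphere. *)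
Definition height (j : 'I_N) : R := j%:R / N%:R.
Definition angle (i : 'I_P) : R := pi *+ 2 * (i%:R / P%:R).
Definition sphere_grid (t : 'I_N * 'I_P) : vec := cyl_vec (height t.1) (angle t.2).

Lemma height_itv j : 0 <= height j <= 1.
Proof.
have N0' : 0 < N%:R :> R by rewrite ltr0n.
by rewrite divr_ge0 ?ler0n //= ler_pdivrMr // mul1r ler_nat ltnW.
Qed.

Lemma sphere_grid_unit t : is_unit (sphere_grid t).
Proof. by apply: cyl_unit; exact: height_itv. Qed.

Lemma low_half i j n : (j.*2 < n)%N -> ((j - i).*2 <= n)%N.
Proof. by lia. Qed.

Lemma high_half i j n : (n <= i.*2)%N -> (j < n)%N -> ((j - i).*2 <= n)%N.
Proof. by lia. Qed.

(** At scales not finer than the grid, a cell holds a share of the points comparable with its area.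
    The constant is 21 for the heights times 5 for the angles. *)
Lemma sphere_grid_cell k (c : cell_type k) :
  1 <= N%:R * (2 ^- k) ^+ 2 :> R -> 1 <= P%:R * 2 ^- k :> R ->
  #|[set t | cell k (sphere_grid t) == c]|%:R <= 105 * (2 ^- k) ^+ 2 * (N%:R * P%:R) :> R.
Proof.
set dl := 2 ^- k => Nd Pd; set S := [set t | _].
have N0' : 0 < N%:R :> R by rewrite ltr0n.
have P0' : 0 < P%:R :> R by rewrite ltr0n.
have dl0 : 0 < dl by rewrite invr_gt0 exprn_gt0.
have [->|/set0Pn[t0 t0S]] := eqVneq S finset.set0.
  by rewrite cards0 mulr0n !mulr_ge0 ?ler0n ?(ltW dl0).
pose rho (t : 'I_N * 'I_P) := Num.sqrt (1 - height t.1 ^+ 2).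
pose C (t t' : 'I_N * 'I_P) := cos (angle t.2 - angle t'.2).
have rho0 t : 0 <= rho t by rewrite sqrtr_ge0.
have C1 t t' : C t t' <= 1 by exact: cos_le1.
have rho_sqr t : rho t ^+ 2 = 1 - height t.1 ^+ 2.
  by rewrite sqr_sqrtr // subr_ge0; have /andP[? ?] := height_itv t.1; rewrite expr_le1.
(* Squared distance in cylindrical coordinates. *)
have close t t' : t \in S -> t' \in S ->
    (rho t - rho t') ^+ 2 + 2 * rho t * rho t' * (1 - C t t') +
    (height t.1 - height t'.1) ^+ 2 <= 2 * dl ^+ 2.
  rewrite !inE => /eqP tc /eqP t'c.
  have := cell_close (sphere_grid_unit t) (sphere_grid_unit t') (etrans tc (esym t'c)).
  rewrite -/dl; apply: le_trans; rewrite !big_ord_recl big_ord0 /=.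
  rewrite /sphere_grid /cyl_vec /= -/(rho t) -/(rho t') /C cosB le_eqVlt; apply/orP; left.
  have := cos2Dsin2 (angle t.2); have := cos2Dsin2 (angle t'.2).
  set c1 := cos _; set s1 := sin _; set c2 := cos _; set s2 := sin _ => e1 e2.
  rewrite -subr_eq0; apply/eqP.
  transitivity (rho t ^+ 2 * (1 - (c2 ^+ 2 + s2 ^+ 2)) + rho t' ^+ 2 * (1 - (c1 ^+ 2 + s1 ^+ 2))).
    by ring.
  by rewrite e1 e2; ring.
have cardS : (#|S| <= #|fst @: S| * #|snd @: S|)%N.
  rewrite -cardsX; apply: subset_leq_card; apply/fintype.subsetP => t tS.
  by rewrite !inE !imset_f.
have close_rho t : t \in S -> `|rho t - rho t0| <= 2 * dl.
  move=> tS; rewrite -(@ler_pXn2r _ 2) ?nnegrE ?mulr_ge0 ?(ltW dl0) //.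
  rewrite real_normK ?num_real //; have := close _ _ tS t0S.
  have := sqr_ge0 (height t.1 - height t0.1); have := C1 t t0.
  have := mulr_ge0 (rho0 t) (rho0 t0) => h1 h2 h3.
  have : 0 <= 2 * rho t * rho t0 * (1 - C t t0) by rewrite !mulr_ge0 ?subr_ge0.
  by rewrite exprMn; have := sqr_ge0 dl; lra.
have count_heights (h : R) : 0 <= h ->
    (forall t t', t \in S -> t' \in S -> height t'.1 - height t.1 <= h) ->
    #|fst @: S|%:R <= h * N%:R + 1 :> R.
  move=> h0 hh; apply: card_spread_real; first by rewrite mulr_ge0 ?ler0n.
  move=> i j /imsetP[t tS ->] /imsetP[t' t'S ->] _.
  have := hh _ _ tS t'S; rewrite /height -mulrBl ler_pdivrMr //.
have Nd' : 0 <= N%:R * dl ^+ 2 by rewrite mulr_ge0 ?sqr_ge0 ?ler0n.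
(* Near the pole the cell lies in a cap of height [O(dl ^ 2)]; elsewhere its
   heights range over [O(dl * rho)] and its angles over [O(dl / rho)]. *)
have [small|big] := ltP (rho t0) (4 * dl).
  have /count_heights cJ : 0 <= 36 * dl ^+ 2 by rewrite mulr_ge0 ?sqr_ge0.
  have cI : #|snd @: S|%:R <= P%:R :> R by rewrite ler_nat -[leqRHS]card_ord max_card.
  apply: (@le_trans _ _ (37 * dl ^+ 2 * N%:R * P%:R)); last first.
    by rewrite mulrA ler_wpM2r ?ler0n // ler_wpM2r ?ler0n // ler_wpM2r ?sqr_ge0 //; lra.
  apply: (@le_trans _ _ (#|fst @: S|%:R * #|snd @: S|%:R)).
    by rewrite -natrM ler_nat.
  apply: ler_pM; rewrite ?ler0n //; apply: le_trans (cJ _) _; last by lra.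
  move=> t t' tS t'S; have /andP[z0 z1] := height_itv t.1.
  have /andP[z0' z1'] := height_itv t'.1.
  have : rho t <= 6 * dl by have := close_rho _ tS; rewrite ler_norml => /andP[_]; lra.
  move=> r6; have : rho t ^+ 2 <= 36 * dl ^+ 2.
    rewrite (_ : 36 * _ = (6 * dl) ^+ 2); last by ring.
    by rewrite lerXn2r ?nnegrE // mulr_ge0 // ltW.
  by rewrite rho_sqr expr2; nra.
have r0 : 0 < rho t0 by apply: lt_le_trans big; rewrite mulr_gt0.
have rho_le1 : rho t0 <= 1.
  by rewrite -(@ler_pXn2r _ 2) ?nnegrE // expr1n rho_sqr lerBlDr lerDl sqr_ge0.
have close_z t : t \in S -> `|height t.1 - height t0.1| <= 10 * dl * rho t0.
  move=> tS; have /andP[z0 z1] := height_itv t.1; have /andP[z0' z1'] := height_itv t0.1.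
  have := close_rho _ tS; have := rho_sqr t; have := rho_sqr t0.
  have := close _ _ tS t0S.
  have : 0 <= 2 * rho t * rho t0 * (1 - C t t0) by rewrite !mulr_ge0 ?subr_ge0.
  have := sqr_ge0 (rho t - rho t0).
  set y := 2 * _ * _ * _; set u := (_ - _) ^+ 2; set z := height t.1; set z' := height t0.1.
  rewrite -/z -/z' in z0 z1 z0' z1'.
  move: y u => y u u0 y0 hc e0 e; rewrite ler_norml => /andP[q1 q2].
  (* Away from the equator, [z ^ 2 - z' ^ 2 = rho t0 ^ 2 - rho t ^ 2] converts the bound on radii
     into one on heights. Near it [rho t0] is at least 1/2 and the distance bound is enough. *)
  have [half|half] := lerP 2^-1 z'.
    have a : (z + z') * `|z - z'| <= 5 * dl * rho t0.
      rewrite -[X in X * _]ger0_norm ?addr_ge0 // -normrM.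
      have -> : (z + z') * (z - z') = (rho t0 - rho t) * (rho t0 + rho t).
        rewrite (_ : (z + z') * _ = z ^+ 2 - z' ^+ 2); last by ring.
        rewrite (_ : (rho t0 - _) * _ = rho t0 ^+ 2 - rho t ^+ 2); last by ring.
        by rewrite e0 e; ring.
      rewrite normrM (ger0_norm (addr_ge0 (rho0 t0) (rho0 t))).
      have : `|rho t0 - rho t| <= 2 * dl by rewrite ler_norml; apply/andP; split; lra.
      have : rho t0 + rho t <= 5 / 2 * rho t0 by lra.
      move=> h1 h2; apply: (@le_trans _ _ (2 * dl * (5 / 2 * rho t0))); last by lra.
      by apply: ler_pM; rewrite ?addr_ge0.
    have : 0 <= (z + z' - 2^-1) * `|z - z'| by rewrite mulr_ge0 //; lra.
    by rewrite mulrBl; lra.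
  have rhalf : 2^-1 <= rho t0.
    by rewrite leNgt; apply/negP => r; nra.
  have a : `|z - z'| <= 2 * dl.
    rewrite -(@ler_pXn2r _ 2) ?nnegrE ?mulr_ge0 ?(ltW dl0) // real_normK ?num_real //.
    by rewrite exprMn; have := sqr_ge0 dl; lra.
  by apply: (le_trans a); nra.
have cJ : #|fst @: S|%:R <= 21 * (dl * rho t0 * N%:R) :> R.
  have dr0 : 0 <= 20 * dl * rho t0 by rewrite !mulr_ge0 // ltW.
  apply: le_trans (count_heights _ dr0 _) _.
    move=> t t' /close_z + /close_z; rewrite !ler_norml => /andP[? ?] /andP[? ?]; lra.
  have : 1 <= dl * rho t0 * N%:R by nra.
  by lra.
have half_count (B : {set 'I_P}) : B \subset snd @: S ->
    (forall i j, i \in B -> j \in B -> (i <= j)%N -> ((j - i).*2 <= P)%N) ->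
    #|B|%:R <= 3 / 2 * (P%:R * dl / rho t0) + 1 :> R.
  move=> BS hB; apply: card_spread_real.
    by rewrite !mulr_ge0 ?ler0n ?invr_ge0 ?(ltW dl0) ?(ltW r0).
  move=> i j iB jB ij; have := chord_ge ij (hB _ _ iB jB ij) P0.
  have /imsetP[t tS it] := fintype.subsetP BS _ iB.
  have /imsetP[t' t'S jt'] := fintype.subsetP BS _ jB.
  rewrite -!/(angle _) [X in Num.sqrt X](_ : _ = 2 * (1 - C t t')); last first.
    rewrite /C -it -jt' cosB.
    have := cos2Dsin2 (angle i); have := cos2Dsin2 (angle j).
    set c1 := cos _; set s1 := sin _; set c2 := cos _; set s2 := sin _ => e1 e2.
    apply/eqP; rewrite -subr_eq0; apply/eqP.
    transitivity ((c2 ^+ 2 + s2 ^+ 2) - 1 + ((c1 ^+ 2 + s1 ^+ 2) - 1)); first by ring.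
    by rewrite e1 e2; ring.
  have := close _ _ tS t'S; have := sqr_ge0 (rho t - rho t').
  have := sqr_ge0 (height t.1 - height t'.1).
  have := close_rho _ tS; have := close_rho _ t'S.
  rewrite !ler_norml => /andP[a1 _] /andP[a2 _] b1 b2 b3.
  have hC : 0 <= 1 - C t t' by rewrite subr_ge0.
  have rr : rho t0 ^+ 2 / 4 <= rho t * rho t'.
    rewrite (_ : _ / 4 = rho t0 / 2 * (rho t0 / 2)); last by field.
    have x1 : rho t0 / 2 <= rho t by lra.
    have x2 : rho t0 / 2 <= rho t' by lra.
    by apply: ler_pM => //; rewrite divr_ge0 // ltW.
  have : Num.sqrt (2 * (1 - C t t')) <= 3 * dl / rho t0.
    rewrite -(@ler_pXn2r _ 2) ?nnegrE ?sqrtr_ge0 ?divr_ge0 ?mulr_ge0 ?(ltW dl0) ?(ltW r0) //.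
    rewrite sqr_sqrtr ?mulr_ge0 // expr_div_n ler_pdivlMr ?exprn_gt0 // exprMn.
    by have := ler_wpM2r hC rr; have := sqr_ge0 dl; lra.
  move=> h1 h2; have := le_trans h2 h1.
  rewrite mulrA ler_pdivrMr // => h3.
  have -> : 3 / 2 * (P%:R * dl / rho t0) = 3 * dl / rho t0 * P%:R / 2 by ring.
  by rewrite ler_pdivlMr // mulrC.
have cI : #|snd @: S|%:R <= 5 * (P%:R * dl / rho t0) :> R.
  have q1 : 1 <= P%:R * dl / rho t0 by rewrite ler_pdivlMr // mul1r; lra.
  (* Two half-circles, within each of which index differences stay below [P / 2], as [chord_ge]
     requires. *)
  rewrite -(cardsID [set i : 'I_P | (i.*2 < P)%N] (snd @: S)) natrD.
  have h1 := half_count _ (subsetIl (snd @: S) [set i : 'I_P | (i.*2 < P)%N]).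
  have h2 := half_count _ (subsetDl (snd @: S) [set i : 'I_P | (i.*2 < P)%N]).
  apply: le_trans (lerD (h1 _) (h2 _)) _.
  - by move=> i j _; rewrite finset.in_setI inE => /andP[_ jP] _; exact: low_half.
  - move=> i j; rewrite finset.in_setD inE -leqNgt => /andP[iP _] _ _.
    exact: high_half (ltn_ord j).
  - by lra.
apply: (@le_trans _ _ (#|fst @: S|%:R * #|snd @: S|%:R)).
  by rewrite -natrM ler_nat.
apply: (@le_trans _ _ (21 * (dl * rho t0 * N%:R) * (5 * (P%:R * dl / rho t0)))).
  by apply: ler_pM; rewrite ?ler0n.
by rewrite le_eqVlt; apply/orP; left; apply/eqP; field; rewrite gt_eqF.
Qed.

End SphereGrid.

(** * Moments of the grid *)

(** In the binomial expansion the term [l] carries [z ^ (i * (n - 2 * l))]. Summation over [i] kills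
    it unless [P] divides [n - 2 * l], and [n < P] leaves only the middle term. *)
Lemma sum_roots_pow (F : fieldType) (z z' u v : F) (P n : nat) :
  (n < P)%N -> z * z' = 1 -> z ^+ P = 1 ->
  (forall a, (0 < a < P)%N -> z ^+ a != 1) ->
  \sum_(i < P) (u * z ^+ i + v * z' ^+ i) ^+ n =
  if odd n then 0 else P%:R * 'C(n, n./2)%:R * (u * v) ^+ n./2.
Proof.
move=> nP zz zP z1.
have z'P : z' ^+ P = 1 by have := congr1 (fun x => x ^+ P) zz; rewrite exprMn zP expr1n mul1r.
have geo (q : F) : q ^+ P = 1 -> q != 1 -> \sum_(i < P) q ^+ i = 0.
  move=> qP q1; have := subrX1 q P; rewrite qP subrr => /esym/eqP.
  by rewrite mulf_eq0 subr_eq0 (negbTE q1) => /eqP.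
have term l : (l <= n)%N -> \sum_(i < P) (u * z ^+ i) ^+ (n - l) * (v * z' ^+ i) ^+ l =
    if (l.*2 == n)%N then P%:R * (u * v) ^+ l else 0.
  move=> ln; pose q := z ^+ (n - l) * z' ^+ l.
  transitivity (u ^+ (n - l) * v ^+ l * \sum_(i < P) q ^+ i).
    rewrite mulr_sumr; apply: eq_bigr => i _.
    by rewrite /q !exprMn -!exprM [(i * (n - l))%N]mulnC [(i * l)%N]mulnC; ring.
  case: eqP => [e|ne].
    have e' : (n - l = l)%N by rewrite -e -addnn addnK.
    have -> : q = 1 by rewrite /q e' -exprMn zz expr1n.
    rewrite e' -exprMn mulrC; congr (_ * _).
    by under eq_bigr do rewrite expr1n; rewrite sumr_const card_ord.
  rewrite geo ?mulr0 //.
    by rewrite /q exprMn -!exprM ![(_ * P)%N]mulnC !exprM zP z'P !expr1n mul1r.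
  rewrite /q; have [h|h] := leqP l (n - l).
    rewrite -(subnK h) exprD -mulrA -exprMn zz expr1n mulr1 z1 //.
    by move: ne; rewrite -addnn; lia.
  set m := (n - l)%N in h *.
  rewrite -[in z' ^+ l](subnK (ltnW h)) exprD mulrCA -exprMn zz expr1n mulr1 /m.
  have : z ^+ (l - (n - l)) != 1 by apply: z1; lia.
  apply: contra => /eqP e; have := congr1 (fun x => x ^+ (l - (n - l))) zz.
  by rewrite exprMn e mulr1 expr1n => ->.
under eq_bigr do rewrite exprDn.
rewrite exchange_big /=.
rewrite (eq_bigr (fun l : 'I_n.+1 =>
  (if l.*2 == n then P%:R * (u * v) ^+ l else 0) *+ 'C(n, l))); last first.
  by move=> l _; rewrite sumrMnl term // -ltnS.
case: ifP => on.
  rewrite big1 // => l _; case: eqP => [e|_]; last by rewrite mul0rn.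
  by have := odd_double l; rewrite e on.
have hn : (n./2 < n.+1)%N by rewrite ltnS; lia.
have e2 : (n./2).*2 = n by rewrite -[RHS]odd_double_half on.
rewrite (bigD1 (Ordinal hn)) //= e2 eqxx big1 ?addr0; last first.
  move=> l ln; case: eqP => [e|_]; last by rewrite mul0rn.
  by move/eqP: ln; case; apply: val_inj; have := doubleK l; rewrite e.
by rewrite -mulr_natr; ring.
Qed.

Section Moments.
Variable R : realType.

(** Equidistant angles integrate trigonometric polynomials of degree below [P] exactly, so
    quadrature errors come from the heights alone. *)
Lemma circle_moment (P n : nat) (a b : R) : (n < P)%N ->
  \sum_(i < P) (a * cos (pi *+ 2 * (i%:R / P%:R)) + b * sin (pi *+ 2 * (i%:R / P%:R))) ^+ n =
  if odd n then 0 else P%:R * 'C(n, n./2)%:R * ((a ^+ 2 + b ^+ 2) / 4) ^+ n./2.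
Proof.
move=> nP; have P0 : (0 < P)%N by exact: leq_trans nP.
pose t i : R := pi *+ 2 * (i%:R / P%:R).
pose z : R[i] := Complex (cos (t 1)) (sin (t 1)).
pose z' : R[i] := Complex (cos (t 1)) (- sin (t 1)).
have tS i : t i.+1 = t i + t 1 by rewrite /t -natr1; ring.
have zE i : z ^+ i = Complex (cos (t i)) (sin (t i)).
  elim: i => [|i IH]; first by rewrite /t mul0r mulr0 cos0 sin0.
  by rewrite exprSr IH tS cosD sinD; simpc; congr (Complex _ _); ring.
have z'E i : z' ^+ i = Complex (cos (t i)) (- sin (t i)).
  elim: i => [|i IH]; first by rewrite /t mul0r mulr0 cos0 sin0 oppr0.
  by rewrite exprSr IH tS cosD sinD; simpc; congr (Complex _ _); ring.
have P0' : P%:R != 0 :> R by rewrite pnatr_eq0 -lt0n.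
have zz : z * z' = 1.
  rewrite /z /z'; simpc; have := cos2Dsin2 (t 1).
  by rewrite -!expr2 => ->; congr (Complex _ _); ring.
have zP : z ^+ P = 1.
  by rewrite zE /t divff // mulr1 cos2pi sin2pi.
have z1 k : (0 < k < P)%N -> z ^+ k != 1.
  move=> /andP[k0 kP]; rewrite zE; apply/eqP => -[hc _].
  pose x : R := pi * (k%:R / P%:R).
  have : cos (x *+ 2) = 1 by rewrite -hc /t /x; congr cos; ring.
  rewrite cos_mulr2n cos2sin2 => hs.
  have : 0 < sin x.
    have f0 : 0 < k%:R / P%:R :> R by rewrite divr_gt0 ?ltr0n.
    have f1 : k%:R / P%:R < 1 :> R by rewrite ltr_pdivrMr ?ltr0n // mul1r ltr_nat.
    by apply: sin_gt0_pi; have := pi_gt0 R; rewrite /x => ?; apply/andP; split; nra.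
  move=> s0; have := exprn_gt0 2 s0; have -> : sin x ^+ 2 = 0 by lra.
  by rewrite ltxx.
pose u : R[i] := Complex (a / 2) (- b / 2); pose v : R[i] := Complex (a / 2) (b / 2).
have := sum_roots_pow u v nP zz zP z1.
have uv : u * v = Complex ((a ^+ 2 + b ^+ 2) / 4) 0.
  by rewrite /u /v; simpc; congr (Complex _ _); field.
have xE i : u * z ^+ i + v * z' ^+ i = (a * cos (t i) + b * sin (t i))%:C%C.
  by rewrite zE z'E /u /v; simpc; congr (Complex _ _); field.
under eq_bigr do rewrite xE -rmorphXn.
rewrite -rmorph_sum uv -[Complex _ 0]/(_%:C%C) -/(t _).
case: ifP => _; first by move=> [].
by rewrite -rmorphXn -[P%:R](rmorph_nat (real_complex R))
  -['C(_, _)%:R](rmorph_nat (real_complex R)) -!rmorphM => -[].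
Qed.

(** [j.+1 ^ p.+1 - j ^ p.+1] lies between [p.+1 * j ^ p] and [p.+1 * j.+1 ^ p], and it
    telescopes. *)
Lemma power_sum_bounds (p N : nat) :
  (N%:R ^+ p.+1 - p.+1%:R * N%:R ^+ p : R) <= p.+1%:R * \sum_(j < N) j%:R ^+ p
    <= (N%:R ^+ p.+1 : R).
Proof.
have step (j : nat) : (p.+1%:R * j%:R ^+ p : R) <= j.+1%:R ^+ p.+1 - j%:R ^+ p.+1
      <= (p.+1%:R * j.+1%:R ^+ p : R).
  rewrite subrXX -[j.+1%:R]natr1 addrAC subrr add0r mul1r.
  set x := _ + 1; have x0 : 0 <= j%:R :> R by rewrite ler0n.
  have yx : j%:R <= x by rewrite lerDl.
  have c (y : R) : p.+1%:R * y = \sum_(i < p.+1) y by rewrite sumr_const card_ord mulr_natl.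
  have E (y : R) l : (l <= p)%N -> y ^+ p = y ^+ (p - l) * y ^+ l.
    by move=> lp; rewrite -exprD subnK.
  rewrite !c; apply/andP; split; apply: ler_sum => i _;
    rewrite /= (E _ i) ?(ltnSE (ltn_ord i)) //.
    by rewrite ler_wpM2r ?exprn_ge0 // lerXn2r ?nnegrE // (le_trans x0).
  by rewrite ler_wpM2l ?exprn_ge0 ?(le_trans x0) // lerXn2r ?nnegrE // (le_trans x0).
elim: N => [|N /andP[IH1 IH2]].
  rewrite big_ord0 mulr0 exprS !mul0r lexx andbT subr_le0 mulr_ge0 ?exprn_ge0 //.
rewrite big_ord_recr /= mulrDr; have /andP[s1 s2] := step N.
by apply/andP; split; lra.
Qed.

Lemma riemann_power (p N : nat) : (0 < N)%N ->
  `|\sum_(j < N) (j%:R / N%:R) ^+ p / N%:R - p.+1%:R^-1| <= N%:R^-1 :> R.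
Proof.
move=> N0; have N0' : 0 < N%:R :> R by rewrite ltr0n.
have p0 : 0 < p.+1%:R :> R by rewrite ltr0n.
have /andP[h1 h2] := power_sum_bounds p N.
have -> : \sum_(j < N) (j%:R / N%:R) ^+ p / N%:R =
    (p.+1%:R * \sum_(j < N) j%:R ^+ p) / N%:R ^+ p.+1 / p.+1%:R :> R.
  rewrite mulrAC [X in X / _]mulrAC divff ?gt_eqF // mul1r mulr_suml; apply: eq_bigr => j _.
  by rewrite expr_div_n exprSr invfM mulrA.
set s := p.+1%:R * \sum_(j < N) j%:R ^+ p in h1 h2 *; rewrite exprSr in h1 h2 *.
set Q := N%:R ^+ p in h1 h2 *; set n := N%:R in N0' h1 h2 *; set c := p.+1%:R in p0 h1 h2 *.
have Q0 : 0 < Q by rewrite exprn_gt0.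
have -> : s / (Q * n) / c - c^-1 = - ((Q * n - s) / (Q * n * c)).
  by field; rewrite !gt_eqF.
have D0 : 0 < Q * n * c by rewrite !mulr_gt0.
rewrite normrN normrM ger0_norm ?subr_ge0 // ger0_norm ?invr_ge0 ?(ltW D0) //.
rewrite ler_pdivrMr // (_ : n^-1 * _ = c * Q); last by field; rewrite gt_eqF.
by lra.
Qed.

(* The integral of [z ^ (2 a) * (1 - z ^ 2) ^ i] over [[0, 1]]. *)
Definition beta_moment (a i : nat) : R :=
  4 ^+ i * (a + i)`!%:R * i`!%:R * (a.*2)`!%:R / (a`!%:R * ((a + i).*2.+1)`!%:R).

Lemma beta_moment0 a : beta_moment a 0 = (a.*2.+1)%:R^-1.
Proof.
have f0 n : n`!%:R != 0 :> R by rewrite pnatr_eq0 -lt0n fact_gt0.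
have n0 : a.*2.+1%:R != 0 :> R by rewrite pnatr_eq0.
rewrite /beta_moment addn0 expr0 fact0 factS natrM.
field.
by rewrite nat1r n0 !f0.
Qed.

(** Expansion of one factor [1 - z ^ 2]. The Riemann sums obey the same recursion, so
    [height_moment] follows by induction, the error doubling at each step. *)
Lemma beta_momentS a i :
  beta_moment a i.+1 = beta_moment a i - beta_moment a.+1 i.
Proof.
rewrite /beta_moment addSn addnS !doubleS !factS !natrM exprS.
have f0 n : n`!%:R != 0 :> R by rewrite pnatr_eq0 -lt0n fact_gt0.
have -> : (a + i).*2.+3%:R = 2 * (a%:R + i%:R) + 3 :> R.
  by rewrite -!natr1 -muln2 natrM natrD; ring.
have -> : (a + i).*2.+2%:R = 2 * (a%:R + i%:R) + 2 :> R.
  by rewrite -!natr1 -muln2 natrM natrD; ring.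
have -> : (a + i).+1%:R = a%:R + i%:R + 1 :> R by rewrite -!natr1 natrD.
have -> : a.*2.+2%:R = 2 * a%:R + 2 :> R by rewrite -!natr1 -muln2 natrM; ring.
have -> : a.*2.+1%:R = 2 * a%:R + 1 :> R by rewrite -!natr1 -muln2 natrM; ring.
rewrite -[i.+1%:R]natr1 -[a.+1%:R]natr1.
have a0 : 0 <= a%:R :> R by rewrite ler0n.
have i0 : 0 <= i%:R :> R by rewrite ler0n.
have n1 : a%:R + 1 != 0 :> R by rewrite gt_eqF //; lra.
have n2 : 2 * (a%:R + i%:R) + 3 != 0 :> R by rewrite gt_eqF //; lra.
have n3 : 2 * (a%:R + i%:R) + 2 != 0 :> R by rewrite gt_eqF //; lra.
field.
by rewrite nat1r !f0 n1 n2 n3 pnatr_eq0.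
Qed.

Variables (N P : nat).
Hypotheses (N0 : (0 < N)%N) (P0 : (0 < P)%N).

Lemma height_moment a i :
  `|\sum_(j < N) (height R j ^+ 2) ^+ a * (1 - height R j ^+ 2) ^+ i / N%:R
    - beta_moment a i| <= 2 ^+ i / N%:R.
Proof.
elim: i a => [|i IH] a.
  rewrite beta_moment0 mul1r; under eq_bigr do rewrite expr0 mulr1 -exprM mul2n.
  exact: riemann_power.
rewrite beta_momentS (_ : \sum_(_ < _) _ =
  \sum_(j < N) (height R j ^+ 2) ^+ a * (1 - height R j ^+ 2) ^+ i / N%:R -
  \sum_(j < N) (height R j ^+ 2) ^+ a.+1 * (1 - height R j ^+ 2) ^+ i / N%:R); last first.
  by rewrite -sumrB; apply: eq_bigr => j _; rewrite !exprS; ring.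
have := IH a; have := IH a.+1.
set S1 := \sum_(_ < _) _; set S2 := \sum_(_ < _) _.
rewrite exprS !ler_norml => /andP[? ?] /andP[? ?].
by apply/andP; split; lra.
Qed.

Lemma sum_even_terms (F : nat -> R) k : (forall l, odd l -> F l = 0) ->
  \sum_(l < k.*2.+1) F l = \sum_(l < k.+1) F l.*2.
Proof.
move=> F0; elim: k => [|k IH]; first by rewrite !big_ord1.
by rewrite doubleS 2!big_ord_recr /= IH F0 /= ?odd_double // addr0 [RHS]big_ord_recr.
Qed.

(** Coefficient of the [l]-th even term once the power [2 * k] of the inner product has been
    averaged over the angle. *)
Let coef k l : R := 'C(k.*2, l.*2)%:R * 'C(l.*2, l)%:R / 4 ^+ l.

(** Rotation invariance of the moments: with these binomial coefficients the sum over [l] becomes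
    [(c ^ 2 + s) ^ k / (2 * k + 1)], and [c ^ 2 + s = 1] for a unit direction. *)
Lemma coef_beta_moment k l : (l <= k)%N ->
  coef k l * beta_moment (k - l) l = 'C(k, l)%:R / (k.*2.+1)%:R.
Proof.
move=> lk; rewrite /coef /beta_moment subnK // factS natrM.
have f0 n : n`!%:R != 0 :> R by rewrite pnatr_eq0 -lt0n fact_gt0.
have binE n m : (m <= n)%N -> 'C(n, m)%:R = n`!%:R / (m`!%:R * (n - m)`!%:R) :> R.
  move=> mn; have h := mulf_neq0 (f0 m) (f0 (n - m)%N).
  by apply: (mulIf h); rewrite divfK // -!natrM bin_fact.
rewrite !binE // ?leq_double //; last by rewrite -addnn leq_addr.
rewrite -doubleB [(l.*2 - l)%N](_ : _ = l); last by rewrite -addnn addnK.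
field.
by rewrite nat1r !f0 pnatr_eq0 expf_neq0.
Qed.

Definition moment_const k : R := \sum_(l < k.+1) coef k l * 2 ^+ l.

Lemma sphere_grid_dot (t : 'I_N * 'I_P) m :
  dot (sphere_grid R t) m = height R t.1 * m ord_max +
    Num.sqrt (1 - height R t.1 ^+ 2) *
      (m ord0 * cos (angle R t.2) + m (inord 1) * sin (angle R t.2)).
Proof.
rewrite /dot !big_ord_recl big_ord0 /= addr0.
have -> : lift ord0 ord0 = inord 1 :> 'I_3 by apply: val_inj; rewrite /= inordK.
have -> : lift ord0 (lift ord0 ord0) = ord_max :> 'I_3 by apply: val_inj.
by rewrite /sphere_grid /cyl_vec /= inordK //=; ring.
Qed.

Lemma sphere_grid_moment k m : (k.*2 < P)%N -> is_unit m ->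
  `|\sum_(t : 'I_N * 'I_P) dot (sphere_grid R t) m ^+ k.*2 / (N%:R * P%:R) - (k.*2.+1)%:R^-1|
    <= moment_const k / N%:R.
Proof.
move=> kP; rewrite /is_unit !big_ord_recl big_ord0 addr0 /=.
have -> : lift ord0 ord0 = inord 1 :> 'I_3 by apply: val_inj; rewrite /= inordK.
have -> : lift ord0 (lift ord0 ord0) = ord_max :> 'I_3 by apply: val_inj.
set a := m ord0; set b := m _; set c := m ord_max; pose s := a ^+ 2 + b ^+ 2.
rewrite addrA -/s => sc.
have N0' : N%:R != 0 :> R by rewrite pnatr_eq0 -lt0n.
have P0' : P%:R != 0 :> R by rewrite pnatr_eq0 -lt0n.
have ring_sum (z r : R) : \sum_(i < P) (z * c + r * (a * cos (angle R i) + b * sin (angle R i))) ^+ k.*2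
    = \sum_(l < k.+1) P%:R * coef k l * (c ^+ 2) ^+ (k - l) * s ^+ l * ((z ^+ 2) ^+ (k - l) * (r ^+ 2) ^+ l).
  under eq_bigr do rewrite exprDn.
  rewrite exchange_big /=.
  pose F l := (z * c) ^+ (k.*2 - l) * r ^+ l * 'C(k.*2, l)%:R *
     (if odd l then 0 else P%:R * 'C(l, l./2)%:R * (s / 4) ^+ l./2).
  rewrite (eq_bigr (fun l : 'I_k.*2.+1 => F l)).
    rewrite sum_even_terms; last by move=> l ol; rewrite /F ol mulr0.
    apply: eq_bigr => l _; rewrite /F odd_double doubleK -doubleB -!mul2n !exprM !exprMn /coef !mul2n exprVn.
    by ring.
  move=> l _; rewrite /F -circle_moment; last exact: leq_ltn_trans (ltnSE (ltn_ord l)) kP.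
  rewrite mulr_sumr; apply: eq_bigr => i _; rewrite -[_ *+ 'C(_, _)]mulr_natr !exprMn -/(angle R i).
  by ring.
have -> : \sum_(t : 'I_N * 'I_P) dot (sphere_grid R t) m ^+ k.*2 / (N%:R * P%:R) =
    \sum_(l < k.+1) coef k l * (c ^+ 2) ^+ (k - l) * s ^+ l *
      \sum_(j < N) (height R j ^+ 2) ^+ (k - l) * (1 - height R j ^+ 2) ^+ l / N%:R.
  transitivity (\sum_(j < N) \sum_(i < P) dot (sphere_grid R (j, i)) m ^+ k.*2 / (N%:R * P%:R)).
    by rewrite pair_bigA; apply: eq_bigr => -[].
  transitivity (\sum_(j < N) \sum_(l < k.+1) coef k l * (c ^+ 2) ^+ (k - l) * s ^+ l *
      ((height R j ^+ 2) ^+ (k - l) * (1 - height R j ^+ 2) ^+ l / N%:R)).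
    apply: eq_bigr => j _; rewrite -mulr_suml.
    under eq_bigr do rewrite sphere_grid_dot /= -/a -/b -/c.
    rewrite ring_sum mulr_suml; apply: eq_bigr => l _.
    rewrite sqr_sqrtr; first by field; rewrite N0' P0'.
    by have /andP[? ?] := height_itv R N0 j; rewrite subr_ge0 expr_le1.
  rewrite exchange_big /=; apply: eq_bigr => l _.
  by rewrite mulr_sumr.
have -> : (k.*2.+1)%:R^-1 = \sum_(l < k.+1) coef k l * (c ^+ 2) ^+ (k - l) * s ^+ l *
     beta_moment (k - l) l.
  transitivity ((c ^+ 2 + s) ^+ k / (k.*2.+1)%:R); first by rewrite addrC sc expr1n mul1r.
  rewrite exprDn mulr_suml; apply: eq_bigr => l _.
  have lk : (l <= k)%N by rewrite -ltnS.
  transitivity ((c ^+ 2) ^+ (k - l) * s ^+ l * ('C(k, l)%:R / k.*2.+1%:R)).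
    by rewrite -[_ *+ 'C(k, l)]mulr_natr mulrA.
  by rewrite -coef_beta_moment //; ring.
have coef0 l : 0 <= coef k l by rewrite divr_ge0 ?exprn_ge0 ?mulr_ge0 ?ler0n.
have s0 : 0 <= s by rewrite addr_ge0 ?sqr_ge0.
have c0 l : 0 <= (c ^+ 2) ^+ l by apply: exprn_ge0; exact: sqr_ge0.
have c1 l : (c ^+ 2) ^+ l <= 1 by apply: exprn_ile1; [exact: sqr_ge0|rewrite -sc lerDr].
have s_ge0 l : 0 <= s ^+ l by exact: exprn_ge0.
have s_le1 l : s ^+ l <= 1 by apply: exprn_ile1 => //; rewrite -sc lerDl sqr_ge0.
rewrite -sumrB /moment_const mulr_suml; apply: le_trans (ler_norm_sum _ _ _) _.
apply: ler_sum => l _; rewrite -mulrBr normrM -[leRHS]mulrA.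
have h1 : coef k l * (c ^+ 2) ^+ (k - l) * s ^+ l <= coef k l.
  by rewrite -mulrA ler_piMr // mulr_ile1.
rewrite ger0_norm; last by apply: mulr_ge0 => //; apply: mulr_ge0.
apply: ler_pM => //; first by apply: mulr_ge0 => //; apply: mulr_ge0.
exact: height_moment.
Qed.

End Moments.

(** * Width of the grid from its even moments *)

Section SphereWidth.
Variable R : realType.
Local Notation vec := ('I_3 -> R).

(* [(sqrt_poly n).[x ^+ 2]] approximates [|x|] uniformly from below on [[-1, 1]], so
   that the mean of [|<v, m>|] is controlled by even moments. *)
Fixpoint sqrt_poly n : {poly R} :=
  if n is n'.+1 then sqrt_poly n' + 2^-1 *: ('X - sqrt_poly n' ^+ 2) else 0.

(** One step turns the error [e] into [e * (1 - (2 * x - e) / 2)], at most [e * (1 - e / 2)] because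
    [e <= x]; this recursion decays like [2 / n]. *)
Lemma sqrt_poly_error n (x : R) : 0 <= x <= 1 ->
  [/\ 0 <= x - (sqrt_poly n).[x ^+ 2], x - (sqrt_poly n).[x ^+ 2] <= x &
      (x - (sqrt_poly n).[x ^+ 2]) * n.+1%:R <= 2].
Proof.
move=> /andP[x0 x1]; elim: n => [|n [e0 ex en]].
  by rewrite horner0 subr0 mulr1; split=> //; lra.
rewrite /= !hornerE /= -[n.+2%:R]natr1 -/(sqrt_poly n).
move: e0 ex en; set p := (sqrt_poly n).[_]; set c := n.+1%:R => e0 ex en.
have c1 : 1 <= c by rewrite ler1n.
pose e := x - p; rewrite -/e in e0 ex en.
have -> : x - (p + 2^-1 * (x ^+ 2 - p ^+ 2)) = e * (1 - (2 * x - e) / 2) by rewrite /e; field.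
have h1 : 0 <= e * (1 - (2 * x - e) / 2) by rewrite mulr_ge0 //; lra.
have h2 : e * (1 - (2 * x - e) / 2) <= e * (1 - e / 2) by rewrite ler_wpM2l //; lra.
split=> //; first by apply: (le_trans h2); nra.
apply: (@le_trans _ _ (e * (1 - e / 2) * (c + 1))); first by rewrite ler_wpM2r //; lra.
have [small|big] := lerP (e * (c + 1)) 2.
  by apply: le_trans small; nra.
have : 0 <= e * (e * (c + 1) - 2) by rewrite mulr_ge0 //; lra.
by nra.
Qed.

Lemma dot_le1 (u m : vec) : is_unit u -> is_unit m -> `|dot u m| <= 1.
Proof.
rewrite /is_unit /dot !(sum3_cyclic _ 0) => u1 m1; rewrite ler_norml.
set u0 := u 0 in u1 *; set u2 := u (0 + 1) in u1 *; set u3 := u (0 + 2) in u1 *.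
set m0 := m 0 in m1 *; set m2 := m (0 + 1) in m1 *; set m3 := m (0 + 2) in m1 *.
have := sqr_ge0 (u0 - m0); have := sqr_ge0 (u2 - m2); have := sqr_ge0 (u3 - m3).
have := sqr_ge0 (u0 + m0); have := sqr_ge0 (u2 + m2); have := sqr_ge0 (u3 + m3).
by move=> *; apply/andP; split; lra.
Qed.

(** The even moments in every direction and those of the height have the same limits
    [1 / (2 * k + 1)]. Comparing both means of [q] with [S] transfers the question to the heights,
    whose mean tends to 1/2. *)
Lemma sphere_grid_width (d : R) : 0 < d ->
  exists n0 : nat, forall N P, (n0 <= N)%N -> (n0 <= P)%N ->
    forall m, is_unit m ->
      2^-1 - d <= \sum_(t : 'I_N * 'I_P) `|dot (sphere_grid R t) m| / (N%:R * P%:R).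
Proof.
move=> d0; pose n := Num.truncn (4 / d); pose q := sqrt_poly n.
have nd : 2 / n.+1%:R <= d / 2.
  have := truncnS_gt (4 / d); rewrite -/n ltr_pdivrMr // => h.
  by rewrite ler_pdivrMr ?ltr0n //; lra.
have q_le (x : R) : 0 <= x <= 1 -> x - d / 2 <= q.[x ^+ 2] <= x.
  move=> xi; have [h1 _ h3] := sqrt_poly_error n xi; rewrite -/q in h1 h3.
  have : x - q.[x ^+ 2] <= 2 / n.+1%:R by rewrite ler_pdivlMr ?ltr0n.
  by move=> /le_trans/(_ nd) h4; apply/andP; split; lra.
pose B : R := \sum_(k < size q) `|q`_k| * (moment_const R k + 1).
pose n0 := (maxn (size q).*2.+1 (Num.truncn (2 * (B + 1) / d)).+1).
exists n0 => N P; rewrite !geq_max => /andP[_ Nn] /andP[Pq _] m m1.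
have N0 : (0 < N)%N by exact: leq_trans Nn.
have P0 : (0 < P)%N by exact: leq_trans Pq.
have N0' : 0 < N%:R :> R by rewrite ltr0n.
have P0' : 0 < P%:R :> R by rewrite ltr0n.
have BN : (B + 1) / N%:R <= d / 2.
  have : 2 * (B + 1) / d <= N%:R.
    by rewrite ltW // (lt_le_trans (truncnS_gt _)) // ler_nat.
  by rewrite !ler_pdivrMr //; lra.
pose S := \sum_(k < size q) q`_k / (k.*2.+1)%:R.
have upper : S - (\sum_(k < size q) `|q`_k| * moment_const R k) / N%:R <=
    \sum_(t : 'I_N * 'I_P) `|dot (sphere_grid R t) m| / (N%:R * P%:R).
  apply: (@le_trans _ _ (\sum_(t : 'I_N * 'I_P) q.[dot (sphere_grid R t) m ^+ 2] / (N%:R * P%:R))).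
    under [leRHS]eq_bigr do rewrite horner_coef mulr_suml.
    rewrite [leRHS]exchange_big /= /S mulr_suml -sumrB; apply: ler_sum => k _.
    have kP : (k.*2 < P)%N.
      by apply: leq_ltn_trans Pq; rewrite leq_double ltnW.
    have := sphere_grid_moment N0 P0 kP m1.
    rewrite (_ : \sum_(t : 'I_N * 'I_P) q`_k * (dot (sphere_grid R t) m ^+ 2) ^+ k / (N%:R * P%:R)
       = q`_k * \sum_(t : 'I_N * 'I_P) dot (sphere_grid R t) m ^+ k.*2 / (N%:R * P%:R)); last first.
      by rewrite mulr_sumr; apply: eq_bigr => t _; rewrite -exprM mul2n mulrA.
    move=> h.
    rewrite lerBlDr -lerBlDl -mulrBr; apply: le_trans (ler_norm _) _.
    by rewrite normrM distrC -mulrA ler_wpM2l.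
  apply: ler_sum => t _; rewrite ler_wpM2r ?invr_ge0 ?mulr_ge0 ?ler0n //.
  rewrite -real_normK ?num_real //.
  have i : 0 <= `|dot (sphere_grid R t) m| <= 1.
    by rewrite normr_ge0 dot_le1 //; exact: sphere_grid_unit.
  by have /andP[] := q_le _ i.
have lower : \sum_(j < N) (j%:R / N%:R) / N%:R - d / 2 <=
    S + (\sum_(k < size q) `|q`_k|) / N%:R.
  apply: (@le_trans _ _ (\sum_(j < N) q.[height R j ^+ 2] / N%:R)).
    rewrite (_ : d / 2 = \sum_(j < N) d / 2 / N%:R); last first.
      by rewrite sumr_const card_ord -[RHS]mulr_natr divfK ?gt_eqF.
    rewrite -sumrB; apply: ler_sum => j _; rewrite -mulrBl ler_wpM2r ?invr_ge0 ?ler0n //.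
    by have /andP[] := q_le _ (height_itv R N0 j).
  under [leLHS]eq_bigr do rewrite horner_coef mulr_suml.
  rewrite [leLHS]exchange_big /= /S mulr_suml -big_split /=; apply: ler_sum => k _.
  have := height_moment R N0 k 0; rewrite beta_moment0 expr0 div1r.
  rewrite (_ : \sum_(j < N) q`_k * (height R j ^+ 2) ^+ k / N%:R
     = q`_k * \sum_(j < N) (height R j ^+ 2) ^+ k * (1 - height R j ^+ 2) ^+ 0 / N%:R); last first.
    by rewrite mulr_sumr; apply: eq_bigr => j _; rewrite expr0 mulr1 mulrA.
  move=> h; rewrite -lerBlDl -mulrBr; apply: le_trans (ler_norm _) _.
  by rewrite normrM ler_wpM2l.
have := riemann_power R 1 N0; under eq_bigr do rewrite expr1.
rewrite ler_norml => /andP[r1 _].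
have BE : B = \sum_(k < size q) `|q`_k| * moment_const R k + \sum_(k < size q) `|q`_k|.
  by rewrite /B -big_split; apply: eq_bigr => k _; rewrite mulrDr mulr1.
move: BN upper lower r1; rewrite BE !mulrDl div1r.
set X := \sum_(_ < _) _; set Y := \sum_(_ < _) _; lra.
Qed.

End SphereWidth.

(** * Few weighted points of nearly maximal width *)

Section Points.
Variable R : realType.
Local Notation vec := ('I_3 -> R).

Lemma dot_face (u m : vec) : m (face m) != 0 ->
  dot u m = m (face m) * dot u (face_vec (face m) (ratio m 1) (ratio m 2)).
Proof.
move=> m0; rewrite /dot !(sum3_cyclic _ (face m)) /face_vec /ratio !eqxx.
have -> : (face m + 1 == face m) = false by case: (face m) => [[|[|[|//]]] ?].
have -> : (face m + 2 == face m) = false by case: (face m) => [[|[|[|//]]] ?].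
have -> : (face m + 2 == face m + 1) = false by case: (face m) => [[|[|[|//]]] ?].
by field.
Qed.

Lemma width_face (T : finType) (v : T -> vec) (w : T -> R) m : m (face m) != 0 ->
  width v w m = `|m (face m)| * width v w (face_vec (face m) (ratio m 1) (ratio m 2)).
Proof.
move=> m0; rewrite /width mulr_sumr; apply: eq_bigr => t _.
by rewrite (dot_face _ m0) normrM; ring.
Qed.

(** The price of the first descent: [2 ^ kappa] rounds at scale [kappa] cost no more than one round
    at scale [k]. *)
Lemma rate_beats_count k kappa : (2 * k <= kappa)%N ->
  2 ^+ kappa * rate R kappa <= rate R k.
Proof.
move=> kk; set q := (Num.sqrt (2 : R))^-1.
have q2 : q ^+ 2 = 2^-1 by rewrite exprVn sqr_sqrtr.
have q0 : 0 < q by rewrite invr_gt0 sqrtr_gt0.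
have q1 : q <= 1 by rewrite -(@ler_pXn2r _ 2) ?nnegrE ?(ltW q0) // q2; lra.
have -> : 2 ^+ kappa * rate R kappa = q ^+ (3 * kappa).
  rewrite /rate -/q (_ : 5 * kappa = 2 * kappa + 3 * kappa)%N; last by lia.
  by rewrite exprD mulrA exprM q2 -exprMn divff ?expr1n ?mul1r.
by rewrite /rate -/q ler_wiXn2l ?(ltW q0) //; lia.
Qed.

Lemma absorb_error (E e c x a A A' h : R) : 0 <= E -> 0 <= e -> 0 <= c ->
  x <= e -> 0 <= a -> a <= 1 -> - (E * (x + c * e)) <= A' - A -> h - e <= a * A ->
  h - ((c + 1) * E + 1) * e <= a * A'.
Proof.
move=> E0 e0 c0 xe a0 a1 h1 h2.
have Ee : 0 <= (c + 1) * (E * e) by rewrite !mulr_ge0 // addr_ge0.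
have h3 : 0 <= E * (e - x) by rewrite mulr_ge0 // subr_ge0.
have : 0 <= a * (A' - A + (c + 1) * (E * e)) by rewrite mulr_ge0 //; lra.
have : 0 <= (1 - a) * ((c + 1) * (E * e)) by rewrite mulr_ge0 // subr_ge0.
by lra.
Qed.

Lemma few_wide_points : exists C0 : R, 0 < C0 /\ forall k : nat,
  exists (T : finType) (v : T -> vec) (w : T -> R),
    [/\ forall t, is_unit (v t), forall t, 0 <= w t, \sum_t w t = 1,
        (#|support w| <= 432 * 4 ^ k)%N &
        forall m, is_unit m -> 2^-1 - C0 * rate R k <= width v w m].
Proof.
pose D : R := 105; pose E := 2880 * D + 3.
have D0 : 0 < D by [].
have E0 : 0 < E by rewrite /E; lra.
have [c cE] : exists c : R, c = 2592 by exists 2592.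
have c0 : 0 <= c by rewrite cE ler0n.
exists ((c + 1) * E + 1); split.
  by apply: addr_gt0; [apply: mulr_gt0; [lra|]|].
move=> k; have [n0 wide] := sphere_grid_width (rate_gt0 R k).
(* [n0] brings the width of the grid within [rate R k] of 1/2, and [2 * k] serves
   [rate_beats_count]. These [N] and [P] are just large enough for [sphere_grid_cell] at all scales
   up to [kappa]. *)
pose kappa := (2 * k + n0)%N; pose N := (4 ^ kappa)%N; pose P := (2 ^ kappa)%N.
have kap_P : (n0 <= P)%N.
  by rewrite (leq_trans (leq_addl (2 * k) n0)) // ltnW // ltn_expl.
have kap_N : (n0 <= N)%N by apply: leq_trans kap_P _; rewrite /N (_ : 4 = 2 * 2)%N // expnMn leq_pmulr // expn_gt0.
have N0 : (0 < N)%N by rewrite expn_gt0.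
have P0 : (0 < P)%N by rewrite expn_gt0.
have N0' : 0 < N%:R :> R by rewrite ltr0n.
have P0' : 0 < P%:R :> R by rewrite ltr0n.
pose w (t : 'I_N * 'I_P) : R := (N%:R * P%:R)^-1.
have unit t := @sphere_grid_unit R N P N0 t.
have w0 t : 0 <= w t by rewrite invr_ge0 mulr_ge0 ?ler0n.
have w1 : \sum_t w t = 1.
  rewrite /w sumr_const card_prod !card_ord -[_ *+ _]mulr_natl natrM divff //.
  by rewrite mulf_neq0 // gt_eqF.
have wc l b : (l <= kappa)%N -> \sum_(t | cell l (sphere_grid R t) == b) w t <= D / 4 ^+ l.
  move=> lk; have sq : (2 ^- l) ^+ 2 = (4 ^+ l)^-1 :> R.
    by rewrite exprVn -exprM mulnC exprM; congr (_ ^+ _)^-1; ring.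
  have := @sphere_grid_cell R N P N0 P0 l b; rewrite sq.
  rewrite ler_pdivlMr ?exprn_gt0 // mul1r ler_pdivlMr ?exprn_gt0 // mul1r.
  rewrite -!natrX !ler_nat !leq_exp2l // => /(_ lk lk).
  rewrite -ler_pdivrMr ?mulr_gt0 // natrX => h; apply: le_trans h.
  rewrite /w sumr_const -[_ *+ _]mulr_natl; apply: ler_wpM2r => //.
  by rewrite ler_nat; apply: subset_leq_card; apply/fintype.subsetP => t; rewrite inE.
have cardT : (#|{: 'I_N * 'I_P}| <= P * 4 ^ kappa)%N.
  by rewrite card_prod !card_ord mulnC.
have [w' [w'0 w'c w's w'w]] := thin_to_level unit D0 w0 w1 wc cardT (leq_subr k kappa).
have kk : (kappa - (kappa - k) = k)%N by rewrite subKn // /kappa; lia.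
rewrite kk -/E -cE in w'c w's w'w.
exists ('I_N * 'I_P)%type, (@sphere_grid R N P), w'; split=> //.
  by rewrite (same_cells_sum w'c).
move=> m m1; have m0 := face_neq0 m1.
have := w'w (face m) _ _ (ratio_itv 1 m1) (ratio_itv 2 m1).
have := wide _ _ kap_N kap_P _ m1.
rewrite -/(\sum_(t : 'I_N * 'I_P) _) (_ : \sum_(t : 'I_N * 'I_P) _ = width (@sphere_grid R N P) w m); last first.
  by rewrite /width /w; apply: eq_bigr => t _; rewrite mulrC.
rewrite (width_face _ w m0) (width_face _ w' m0) ler_norml.
have a1 : `|m (face m)| <= 1 by rewrite unit_le1.
have a0 := normr_ge0 (m (face m)).
have rk := rate_gt0 R k.
have : P%:R * rate R kappa <= rate R k.
  by rewrite natrX rate_beats_count // /kappa leq_addr.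
move=> hx hA /andP[hAA _].
exact: absorb_error (ltW E0) (ltW rk) c0 hx a0 a1 hAA hA.
Qed.

End Points.

(** * From widths to responses *)

Section Responses.
Import numFieldNormedType.Exports.
Variable R : realType.
Local Notation vec := ('I_3 -> R).

(** A zonotope is the linear image of a compact cube, hence has a point nearest to [a]. The
    minimiser is sought in the cube because its coordinates become the responses. *)
Lemma min_on_cube (n : nat) (a : vec) (b : 'I_n -> vec) :
  exists2 u : 'I_n -> R, (forall i, -1 <= u i <= 1) &
    forall u', (forall i, -1 <= u' i <= 1) ->
      \sum_g (a g - \sum_i u i * b i g) ^+ 2 <= \sum_g (a g - \sum_i u' i * b i g) ^+ 2.
Proof.
pose f (u : 'rV[R]_n) := \sum_g (a g - \sum_i u ord0 i * b i g) ^+ 2.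
pose A : set 'rV[R]_n := [set u | forall i, `[-1, 1]%classic (u ord0 i)]%classic.
have cf : continuous f.
  apply: continuous_big => [|g _]; first exact: add_continuous.
  have cg : continuous (fun u : 'rV[R]_n => a g - \sum_i u ord0 i * b i g).
    move=> u; apply: continuousB; first exact: cst_continuous.
    move: u; apply: continuous_big => [|i _]; first exact: add_continuous.
    move=> u; apply: continuousM; last exact: cst_continuous.
    exact: coord_continuous.
  suff -> : (fun u : 'rV[R]_n => (a g - \sum_i u ord0 i * b i g) ^+ 2) =
    (fun u => a g - \sum_i u ord0 i * b i g) \* (fun u => a g - \sum_i u ord0 i * b i g).
    by move=> u; exact: continuousM (cg u) (cg u).
  by apply/funext => u; rewrite expr2.
have [|||u uA umin] := @EVT_min_rV R n f A.
- exists 0 => i /=; rewrite mxE in_itv /=; lra.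
- exact: (@rV_compact R n (fun=> `[-1, 1]%classic) (fun=> @segment_compact R (-1) 1)).
- exact: continuous_subspaceT.
have AE (x : 'rV[R]_n) : (x \in A) <-> forall i, -1 <= x ord0 i <= 1.
  rewrite inE /A /=; split=> h i; have := h i; by rewrite in_itv.
exists (fun i => u ord0 i); first by move/AE: uA.
move=> u' hu'; have /umin : (\row_i u' i) \in A by apply/AE => i; rewrite mxE.
rewrite /f => /le_trans; apply; rewrite le_eqVlt; apply/orP; left; apply/eqP.
by apply: eq_bigr => g _; congr ((_ - _) ^+ 2); apply: eq_bigr => i _; rewrite mxE.
Qed.

Lemma min_slope (p q : R) : 0 <= q ->
  (forall t, 0 < t <= 1 -> 2 * (t * p) <= t ^+ 2 * q) -> p <= 0.
Proof.
move=> q0 h; rewrite leNgt; apply/negP => p0.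
have pq : 0 < p + q by lra.
pose t := p / (p + q).
have t0 : 0 < t by rewrite divr_gt0.
have tE : t * (p + q) = p by rewrite /t divfK // gt_eqF.
have := h t; have -> : 0 < t <= 1 by rewrite t0 /= /t ler_pdivrMr //; lra.
move=> /(_ isT); rewrite expr2 -mulrA mulrCA ler_pM2l // => h1.
have : 0 < t * p by rewrite mulr_gt0.
by lra.
Qed.

Variables (T : finType) (v : T -> vec) (w : T -> R).

(* If the point of the zonotope nearest to [r x] were not [r x] itself, the width
   in the direction of the difference would be less than [r]. *)
Lemma responses_exist (r : R) (x : vec) : 0 <= r ->
  (forall m, is_unit m -> r <= width v w m) -> is_unit x ->
  exists s : T -> R, (forall t, -1 <= s t <= 1) /\
    forall g, \sum_t w t * s t * v t g = r * x g.
Proof.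
move=> r0 wide x1.
pose b (i : 'I_#|T|) : vec := fun g => w (enum_val i) * v (enum_val i) g.
have [u0 u0c u0min] := min_on_cube (fun g => r * x g) b.
pose s t := u0 (enum_rank t).
have reidx (u : T -> R) g : \sum_t w t * u t * v t g = \sum_i u (enum_val i) * b i g.
  rewrite (reindex (enum_val : 'I_#|T| -> T)) /=; last first.
    by apply: onW_bij; exact: enum_val_bij.
  by apply: eq_bigr => i _; rewrite /b; ring.
have smin (u : T -> R) : (forall t, -1 <= u t <= 1) ->
    \sum_g (r * x g - \sum_t w t * s t * v t g) ^+ 2 <=
    \sum_g (r * x g - \sum_t w t * u t * v t g) ^+ 2.
  move=> uc; have := u0min (fun i => u (enum_val i)) (fun i => uc _).
  congr (_ <= _); apply: eq_bigr => g _; rewrite reidx //.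
  by congr ((_ - _) ^+ 2); apply: eq_bigr => i _; rewrite /s enum_valK.
exists s; split; first by move=> t; exact: u0c.
pose y g := r * x g - \sum_t w t * s t * v t g.
have sc t : -1 <= s t <= 1 by exact: u0c.
suff y0 : \sum_g y g ^+ 2 = 0.
  move=> g; apply/eqP; rewrite eq_sym -subr_eq0 -sqrf_eq0.
  have /psumr_eq0P := y0; rewrite /y => /(_ (fun _ _ => sqr_ge0 _)) /(_ g isT) ->.
  exact: eqxx.
(* The move from the nearest point towards the point of the zonotope that is extreme in direction
   [y]; minimality makes its inner product with [y] nonpositive. *)
pose z g := \sum_t w t * (Num.sg (dot (v t) y) - s t) * v t g.
have sgc t : -1 <= Num.sg (dot (v t) y) <= 1.
  by case: Num.Theory.sgrP => _; apply/andP; split; lra.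
have slope : \sum_g y g * z g <= 0.
  apply: (@min_slope _ (\sum_g z g ^+ 2)); first by rewrite sumr_ge0 // => g _; exact: sqr_ge0.
  move=> a /andP[a0 a1].
  have := smin (fun t => s t + a * (Num.sg (dot (v t) y) - s t)) _.
  have -> : \sum_g (r * x g - \sum_t w t * (s t + a * (Num.sg (dot (v t) y) - s t)) * v t g) ^+ 2
     = \sum_g y g ^+ 2 - 2 * (a * \sum_g y g * z g) + a ^+ 2 * \sum_g z g ^+ 2.
    rewrite !mulr_sumr -sumrN -!big_split /=; apply: eq_bigr => g _.
    have -> : \sum_t w t * (s t + a * (Num.sg (dot (v t) y) - s t)) * v t g =
       \sum_t w t * s t * v t g + a * z g.
      by rewrite /z mulr_sumr -big_split /=; apply: eq_bigr => t _; ring.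
    by rewrite /y; ring.
  rewrite -/(y _); move=> /(_ _)-h; suff : forall t, -1 <= s t + a * (Num.sg (dot (v t) y) - s t) <= 1.
    by move=> /h; set S := \sum_g _ ^+ 2; lra.
  move=> t; have /andP[? ?] := sc t; have /andP[? ?] := sgc t.
  by apply/andP; split; nra.
(* As [r * dot x y] is at most the width in direction [y], the slope is at least the squared norm of
   [y], which forces [y = 0]. *)
have zE : \sum_g y g * z g = width v w y - r * dot x y + \sum_g y g ^+ 2.
  have -> : \sum_g y g * z g = \sum_t w t * (Num.sg (dot (v t) y) - s t) * dot (v t) y.
    rewrite /z; under eq_bigr do rewrite mulr_sumr.
    rewrite exchange_big; apply: eq_bigr => t _; rewrite /dot mulr_sumr.
    by apply: eq_bigr => g _; ring.
  have -> : width v w y = \sum_t w t * Num.sg (dot (v t) y) * dot (v t) y.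
    by apply: eq_bigr => t _; rewrite normrEsg mulrA.
  have -> : r * dot x y = \sum_t w t * s t * dot (v t) y + \sum_g y g ^+ 2.
    rewrite /dot mulr_sumr; under [X in _ = X + _]eq_bigr do rewrite mulr_sumr.
    rewrite exchange_big -big_split /=; apply: eq_bigr => g _.
    under eq_bigr do rewrite mulrA; rewrite -mulr_suml.
    by rewrite expr2 -mulrDl {2}/y addrC subrK mulrA.
  under eq_bigr do rewrite mulrBr mulrBl.
  by rewrite sumrB; ring.
have Y0 : 0 <= \sum_g y g ^+ 2 by rewrite sumr_ge0 // => g _; exact: sqr_ge0.
have [//|Yn] := eqVneq (\sum_g y g ^+ 2) 0.
exfalso.
pose n := Num.sqrt (\sum_g y g ^+ 2).
have n0 : 0 < n by rewrite sqrtr_gt0 lt_neqAle eq_sym Yn.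
have nn : n ^+ 2 = \sum_g y g ^+ 2 by rewrite sqr_sqrtr.
pose m g := y g / n.
have m1 : is_unit m.
  rewrite /is_unit /m; under eq_bigr do rewrite expr_div_n.
  by rewrite -mulr_suml -nn divff // expf_neq0 // gt_eqF.
have dm u : dot u y = n * dot u m.
  rewrite /dot mulr_sumr; apply: eq_bigr => g _; rewrite /m; field.
  by rewrite gt_eqF.
have wy : width v w y = n * width v w m.
  rewrite /width mulr_sumr; apply: eq_bigr => t _.
  by rewrite dm normrM (gtr0_norm n0); ring.
have dxm : dot x m <= 1 by exact: le_trans (ler_norm _) (dot_le1 x1 m1).
have := wide _ m1; rewrite zE wy dm -nn in slope.
move=> h; have : 0 < n ^+ 2 by rewrite exprn_gt0.
have : r * dot x m <= width v w m by apply: le_trans h; rewrite -[leRHS]mulr1 ler_wpM2l.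
move=> h1 h2; have : n * (r * dot x m) <= n * width v w m by rewrite ler_pM2l.
by lra.
Qed.

End Responses.

(** * Qubit operators *)

Section Bloch.
Local Open Scope complex_scope.
Variable R : realType.
Local Notation vec := ('I_3 -> R).
Local Notation C := (R[i]).

(* [a + u . sigma] *)
Definition bloch (a : R) (u : vec) : 'M[C]_2 :=
  \matrix_(i < 2, j < 2)
    if i == j then (if i == 0 then (a + u ord_max)%:C else (a - u ord_max)%:C)
    else (if i == 0 then Complex (u ord0) (- u (inord 1)) else Complex (u ord0) (u (inord 1))).

Lemma forall_ord2 (Q : 'I_2 -> Prop) : Q 0 -> Q 1 -> forall i, Q i.
Proof.
move=> q0 q1 [[|[|//]] hi].
  by rewrite (_ : Ordinal hi = 0) //; apply: val_inj.
by rewrite (_ : Ordinal hi = 1) //; apply: val_inj.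
Qed.

Lemma ComplexE (x y : R) : Complex x y = x%:C + 'i * y%:C.
Proof. by simpc. Qed.

Lemma bloch_linear (I : finType) (c a : I -> R) (u : I -> vec) :
  \sum_i (c i)%:C *: bloch (a i) (u i) =
  bloch (\sum_i c i * a i) (fun g => \sum_i c i * u i g).
Proof.
apply/matrixP => i j; rewrite summxE.
under eq_bigr do rewrite !mxE.
rewrite mxE; move: i j.
have real (f : I -> R) : \sum_i (c i)%:C * (f i)%:C = (\sum_i c i * f i)%:C.
  by rewrite rmorph_sum; apply: eq_bigr => k _; rewrite rmorphM.
have cplx (f h : I -> R) : \sum_i (c i)%:C * Complex (f i) (h i) =
    Complex (\sum_i c i * f i) (\sum_i c i * h i).
  rewrite ComplexE -!real mulr_sumr -big_split /=; apply: eq_bigr => k _.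
  by rewrite ComplexE; ring.
apply: forall_ord2; apply: forall_ord2 => /=.
- by rewrite real; congr (_%:C); rewrite -big_split; apply: eq_bigr => k _; rewrite mulrDr.
- by rewrite cplx; congr Complex; rewrite -sumrN; apply: eq_bigr => k _; rewrite mulrN.
- by rewrite cplx.
- by rewrite real; congr (_%:C); rewrite -sumrB; apply: eq_bigr => k _; rewrite mulrBr.
Qed.

Lemma eq_bloch a u a' u' : a = a' -> (forall g, u g = u' g) -> bloch a u = bloch a' u'.
Proof. by move=> -> e; congr bloch; apply/funext. Qed.

Lemma bloch1 : bloch 1 (fun=> 0) = 1%:M.
Proof.
apply/matrixP; apply: forall_ord2; apply: forall_ord2; rewrite !mxE /= ?addr0 ?subr0 //.
by rewrite oppr0.
Qed.

Definition vec_of (n : R * R * R) : vec := fun g =>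
  if val g is k.+1 then (if k is _.+1 then n.2 else n.1.2) else n.1.1.

Lemma vec_of_unit n : unit3 n -> is_unit (vec_of n).
Proof. by case: n => [[a b] c]; rewrite /unit3 /is_unit !big_ord_recl big_ord0 /= addr0 addrA. Qed.

Lemma vec_ofE n : [/\ vec_of n ord0 = n.1.1, vec_of n (inord 1) = n.1.2 &
  vec_of n ord_max = n.2].
Proof. by rewrite /vec_of /= inordK. Qed.

Lemma Pr_bloch r (x : unitvec R) (b : bool) :
  Pr r x b = bloch 2^-1 (fun g => (if b then r else - r) / 2 * vec_of (sval x) g).
Proof.
case: x => [[[n1 n2] n3] hx]; rewrite /Pr /=.
apply/matrixP; apply: forall_ord2; apply: forall_ord2; rewrite !mxE /= ?inordK //=.
all: have [E0 E1 E2] := vec_ofE (n1, n2, n3); rewrite ?E0 ?E1 ?E2.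
all: by case: b; apply/eqP; rewrite eq_complex /=; apply/andP; split; apply/eqP; field.
Qed.

Lemma adjmx_mul m n p (A : 'M[C]_(m, n)) (B : 'M[C]_(n, p)) :
  adjmx (A *m B) = adjmx B *m adjmx A.
Proof. by rewrite /adjmx map_mxM trmx_mul. Qed.

Lemma adjmxK m n (A : 'M[C]_(m, n)) : adjmx (adjmx A) = A.
Proof. by apply/matrixP => i j; rewrite !mxE conjcK. Qed.

Lemma psd_gram n (G : 'M[C]_n) : psd (adjmx G *m G).
Proof.
split; first by rewrite adjmx_mul adjmxK.
move=> c; have -> : adjmx c *m (adjmx G *m G) *m c = adjmx (G *m c) *m (G *m c).
  by rewrite adjmx_mul !mulmxA.
rewrite mxE sumr_ge0 // => i _; rewrite !mxE mulrC.
by set z := \sum_(_ < _) _; rewrite -normCK exprn_ge0.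
Qed.

Lemma psd_scale n (c : R) (A : 'M[C]_n) : 0 <= c -> psd A -> psd (c%:C *: A).
Proof.
move=> c0 [hA pA]; split.
  rewrite -[in RHS]hA; apply/matrixP => i j; rewrite !mxE rmorphM /=.
  by congr (_ * _); apply/eqP; rewrite eq_complex /= oppr0 !eqxx.
by move=> x; rewrite -scalemxAr -scalemxAl mxE mulr_ge0 ?ler0c.
Qed.

Lemma adjmx_bloch a u : adjmx (bloch a u) = bloch a u.
Proof.
apply/matrixP; apply: forall_ord2; apply: forall_ord2; rewrite !mxE /=.
all: by apply/eqP; rewrite eq_complex /= ?oppr0 ?opprK !eqxx.
Qed.

Lemma bloch_sqr u : is_unit u -> bloch 1 u *m bloch 1 u = 2%:C *: bloch 1 u.
Proof.
rewrite /is_unit !big_ord_recl big_ord0 /= addr0.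
have -> : lift ord0 ord0 = inord 1 :> 'I_3 by apply: val_inj; rewrite /= inordK.
have -> : lift ord0 (lift ord0 ord0) = ord_max :> 'I_3 by apply: val_inj.
set x := u ord0; set y := u _; set z := u _ => u1.
apply/matrixP; apply: forall_ord2; apply: forall_ord2;
  rewrite !mxE !big_ord_recl big_ord0 !mxE /= -/x -/y -/z; simpc; congr Complex; lra.
Qed.

(** [1 + u . sigma] is twice a projection, hence half its own Gram matrix. *)
Lemma psd_bloch u : is_unit u -> psd (bloch 1 u).
Proof.
move=> u1; have -> : bloch 1 u = (2^-1)%:C *: (adjmx (bloch 1 u) *m bloch 1 u).
  rewrite adjmx_bloch bloch_sqr // scalerA -rmorphM mulVf ?scale1r //.
by apply: psd_scale; [lra|exact: psd_gram].
Qed.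

End Bloch.

(** * The parent measurement *)

Section Model.
Local Open Scope complex_scope.
Variable R : realType.
Local Notation vec := ('I_3 -> R).
Local Notation C := (R[i]).

Variables (T : finType) (v : T -> vec) (w : T -> R) (r : R).
Hypothesis v_unit : forall t, is_unit (v t).
Hypothesis w_ge0 : forall t, 0 <= w t.
Hypothesis w_sum : \sum_t w t = 1.
Hypothesis r_ge0 : 0 <= r.
Hypothesis wide : forall m, is_unit m -> r <= width v w m.

(** Two antipodal outcomes per supported point, which doubles the size. *)
Definition label : finType := ({t : T | t \in support w} * bool)%type.

Lemma card_label : #|label| = (#|support w| * 2)%N.
Proof. by rewrite card_prod card_sig card_bool. Qed.

Lemma sum_label (F : T -> bool -> R) : (forall t b, w t = 0 -> F t b = 0) ->
  \sum_(k < #|label|) F (val (enum_val k).1) (enum_val k).2 = \sum_t (F t true + F t false).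
Proof.
move=> F0.
transitivity (\sum_(i : label) F (val i.1) i.2).
  rewrite [RHS](reindex (enum_val : 'I_#|label| -> label)) //=.
  by apply: onW_bij; exact: enum_val_bij.
rewrite -(pair_bigA _ (fun (x : {t : T | t \in support w}) b => F (val x) b)) /=.
rewrite [RHS](bigID (mem (support w))) /= [X in _ = _ + X]big1 ?addr0; last first.
  by move=> t; rewrite inE negbK => /eqP t0; rewrite !F0 ?addr0.
rewrite [RHS]big_sub /=; apply: eq_bigr => x _; exact: big_bool.
Qed.

Definition sgn (b : bool) : R := if b then 1 else - 1.

Definition direction (k : 'I_#|label|) : vec :=
  fun g => sgn (enum_val k).2 * v (val (enum_val k).1) g.

Definition weight (k : 'I_#|label|) : R := w (val (enum_val k).1) / 2.

Lemma direction_unit k : is_unit (direction k).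
Proof.
rewrite /is_unit /direction; have := v_unit (val (enum_val k).1); rewrite /is_unit => <-.
by apply: eq_bigr => g _; rewrite exprMn /sgn; case: ifP => _; rewrite ?sqrrN expr1n mul1r.
Qed.

Lemma weight_ge0 k : 0 <= weight k.
Proof. by rewrite divr_ge0. Qed.

Lemma weight_sum : \sum_k weight k = 1.
Proof.
rewrite (sum_label (F := fun t _ => w t / 2)); last by move=> t _ ->; rewrite mul0r.
by rewrite -[RHS]w_sum; apply: eq_bigr => t _; field.
Qed.

(** Over the two signs the constant 1 of the response cancels and the term linear in [s] remains.
    The case [e = 0] shows that the effects have no net Bloch vector. *)
Lemma balanced (s : T -> R) (e : R) g :
  \sum_k weight k * ((1 + e * sgn (enum_val k).2 * s (val (enum_val k).1)) / 2) * direction k g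
  = e / 2 * \sum_t w t * s t * v t g.
Proof.
rewrite (sum_label (F := fun t b => w t / 2 * ((1 + e * sgn b * s t) / 2) * (sgn b * v t g))).
  by rewrite mulr_sumr; apply: eq_bigr => t _; rewrite /sgn /=; field.
by move=> t b ->; rewrite !mul0r.
Qed.

Lemma balanced_trace (s : T -> R) (e : R) :
  \sum_k weight k * ((1 + e * sgn (enum_val k).2 * s (val (enum_val k).1)) / 2) = 2^-1.
Proof.
rewrite (sum_label (F := fun t b => w t / 2 * ((1 + e * sgn b * s t) / 2))).
  transitivity (\sum_t w t / 2); last by rewrite -mulr_suml w_sum mul1r.
  by apply: eq_bigr => t _; rewrite /sgn /=; field.
by move=> t b ->; rewrite !mul0r.
Qed.

Definition effect (k : 'I_#|label|) : 'M[C]_2 := (weight k)%:C *: bloch 1 (direction k).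

Lemma effect_povm : povm effect.
Proof.
split=> [k|]; first by apply: psd_scale; [exact: weight_ge0|exact/psd_bloch/direction_unit].
rewrite /effect bloch_linear -bloch1; apply: eq_bloch.
  by under eq_bigr do rewrite mulr1; exact: weight_sum.
move=> g; have := balanced (fun=> 0) 0 g; rewrite !mul0r => h.
apply: (mulfI (_ : 2^-1 != 0 :> R)) => //; rewrite mulr0 -[RHS]h mulr_sumr.
by apply: eq_bigr => k _; field.
Qed.

Lemma response_family : exists p : unitvec R -> bool -> 'I_#|label| -> R,
  [/\ forall x a i, 0 <= p x a i, forall x i, p x true i + p x false i = 1 &
      forall x a, Pr r x a = \sum_i (p x a i)%:C *: effect i].
Proof.
have ex (x : unitvec R) : exists s : T -> R, (forall t, -1 <= s t <= 1) /\
    forall g, \sum_t w t * s t * v t g = r * vec_of (sval x) g.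
  by apply: responses_exist => //; apply: vec_of_unit; exact: svalP x.
have [s sP] := choice ex.
exists (fun x a k => (1 + sgn a * sgn (enum_val k).2 * s x (val (enum_val k).1)) / 2); split.
- move=> x a k; have /andP[? ?] := (sP x).1 (val (enum_val k).1).
  by rewrite /sgn; case: ifP => _; case: ifP => _; lra.
- by move=> x k; rewrite /sgn; case: ifP => _; field.
move=> x a; rewrite Pr_bloch.
under eq_bigr do rewrite /effect scalerA -rmorphM mulrC.
rewrite bloch_linear; apply: eq_bloch.
  by under eq_bigr do rewrite mulr1; rewrite balanced_trace.
by move=> g; rewrite balanced (sP x).2 /sgn; case: a; field.
Qed.

Lemma simulable_label : simulable r #|label|.
Proof.
have [p [p0 p1 pE]] := response_family.
exists effect; split; first exact: effect_povm.
exists p; split=> //; split=> // x i.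
by rewrite big_bool; exact: p1.
Qed.

End Model.

(** * Steering with the noisy singlet *)

Section Steering.
Local Open Scope complex_scope.
Variable R : realType.
Local Notation vec := ('I_3 -> R).
Local Notation C := (R[i]).

Let singlet (c b : 'I_2) : R :=
  ((c == 0) && (b == 1))%:R - ((c == 1) && (b == 0))%:R.

Lemma Psi_minusE c b (j : 'I_1) :
  Psi_minus R (mxtens_index (c, b)) j = ((Num.sqrt 2)^-1 * singlet c b)%:C.
Proof.
rewrite /Psi_minus ord1 !mxE !(inj_eq (can_inj (@mxtens_indexK _ _))) !xpair_eqE !andbT.
by rewrite rmorphM rmorphB !rmorph_nat.
Qed.

Lemma omegaE r c b a b' :
  omega r (mxtens_index (c, b)) (mxtens_index (a, b')) =
  (r / 2 * singlet c b * singlet a b' + (1 - r) / 4 * ((c == a) && (b == b'))%:R)%:C.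
Proof.
rewrite /omega; move: Psi_minusE; move: (Psi_minus R) => psi psiE.
rewrite !mxE big_ord1 /adjmx !mxE !psiE.
rewrite (inj_eq (can_inj (@mxtens_indexK _ _))) xpair_eqE.
have -> : ((Num.sqrt 2)^-1 * singlet a b')%:C^* = ((Num.sqrt 2)^-1 * singlet a b')%:C.
  by apply/eqP; rewrite eq_complex /= oppr0 !eqxx.
rewrite -(rmorph_nat (real_complex R)) -!rmorphM -rmorphD /=.
have h : (Num.sqrt (2 : R))^-1 * (Num.sqrt 2)^-1 = 2^-1 by rewrite -expr2 exprVn sqr_sqrtr.
apply: (congr1 (real_complex R)); congr (_ + _).
by rewrite mulrACA h; ring.
Qed.

Lemma steerE (M : 'M[C]_2) r b b' :
  ptrA ((M *t (1%:M : 'M[C]_2)) *m omega r) b b' =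
  \sum_(a < 2) \sum_(c < 2) M a c * omega r (mxtens_index (c, b)) (mxtens_index (a, b')).
Proof.
rewrite mxE; apply: eq_bigr => a _; rewrite mxE.
rewrite (reindex (fun p : 'I_2 * 'I_2 => mxtens_index p)) /=; last first.
  by exists (@mxtens_unindex 2 2) => p _; rewrite ?mxtens_indexK ?mxtens_unindexK.
transitivity (\sum_c \sum_d (M *t 1%:M) (mxtens_index (a, b)) (mxtens_index (c, d)) *
  omega r (mxtens_index (c, d)) (mxtens_index (a, b'))).
  by rewrite pair_bigA; apply: eq_bigr => -[c d].
apply: eq_bigr => c _; rewrite (bigD1 b) //= big1 ?addr0.
  by rewrite tensmxE mxE eqxx mulr1.
by move=> d db; rewrite tensmxE mxE eq_sym (negbTE db) mulr0 mul0r.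
Qed.

(** The singlet anticorrelates: steering reverses the Bloch vector and shrinks it by [r], giving
    half the noisy operator with its two outcomes exchanged. *)
Lemma steer_bloch a u r :
  ptrA ((bloch a u *t (1%:M : 'M[C]_2)) *m omega r) =
  (2^-1)%:C *: bloch a (fun g => - r * u g).
Proof.
apply/matrixP => b b'; rewrite steerE.
under eq_bigr do under eq_bigr do rewrite omegaE.
rewrite !big_ord_recl !big_ord0 !mxE /= /singlet.
move: b b'; apply: forall_ord2; apply: forall_ord2 => /=;
  by simpc; apply/eqP; rewrite eq_complex /=; apply/andP; split; apply/eqP; field.
Qed.

Lemma bloch_inj (a a' : R) (u u' : vec) : bloch a u = bloch a' u' -> a = a' /\ forall g, u g = u' g.
Proof.
move=> /matrixP h; have := h 0 0; have := h 1 1; have := h 0 1.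
rewrite !mxE /= => -[h0 h1] [h2] [h3].
have h4 : u ord_max = u' ord_max by lra.
split; first by lra.
case=> [[|[|[|//]]] hg].
- by rewrite (_ : Ordinal hg = ord0) //; apply: val_inj.
- by rewrite (_ : Ordinal hg = inord 1); [lra|apply: val_inj; rewrite /= inordK].
- by rewrite (_ : Ordinal hg = ord_max) //; apply: val_inj.
Qed.

Lemma hermitian_bloch (M : 'M[C]_2) : adjmx M = M -> exists a u, M = bloch a u.
Proof.
move=> /matrixP h; have := h 1 0; have := h 1 1; have := h 0 0; rewrite !mxE.
case e00 : (M 0 0) => [p p']; case e01 : (M 0 1) => [x y].
case e10 : (M 1 0) => [x' y']; case e11 : (M 1 1) => [q q'].
move=> [h0] [h1] [h2 h3].
exists ((p + q) / 2), (vec_of (x, - y, (p - q) / 2)).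
have [E0 E1 E2] := vec_ofE (x, - y, (p - q) / 2).
apply/matrixP; apply: forall_ord2; apply: forall_ord2; rewrite !mxE /= ?E0 ?E1 ?E2 /=.
- by rewrite e00; apply/eqP; rewrite eq_complex /=; apply/andP; split; apply/eqP; lra.
- by rewrite e01 opprK.
- by rewrite e10 -h2 -h3.
- by rewrite e11; apply/eqP; rewrite eq_complex /=; apply/andP; split; apply/eqP; lra.
Qed.

Lemma bloch_mul_self (a : R) (u : vec) : bloch a u *m bloch a u =
  bloch (a ^+ 2 + \sum_g u g ^+ 2) (fun g => 2 * a * u g).
Proof.
rewrite !big_ord_recl big_ord0 /= addr0.
have -> : lift ord0 ord0 = inord 1 :> 'I_3 by apply: val_inj; rewrite /= inordK.
have -> : lift ord0 (lift ord0 ord0) = ord_max :> 'I_3 by apply: val_inj.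
set x := u ord0; set y := u (inord 1); set z := u ord_max.
apply/matrixP; apply: forall_ord2; apply: forall_ord2;
  rewrite !mxE !big_ord_recl big_ord0 !mxE /= -/x -/y -/z; simpc;
  apply/eqP; rewrite eq_complex /=; apply/andP; split; apply/eqP; ring.
Qed.

Lemma projection_bloch (M : 'M[C]_2) : adjmx M = M -> M *m M = M ->
  exists a u, M = bloch a u /\
    [\/ a = 0 /\ (forall g, u g = 0), a = 1 /\ (forall g, u g = 0) |
        a = 2^-1 /\ is_unit (fun g => 2 * u g)].
Proof.
move=> /hermitian_bloch[a [u ->]]; rewrite bloch_mul_self => /bloch_inj[ea eu].
exists a, u; split=> //.
have [/existsP[g ug]|/existsPn u0] := boolP [exists g, u g != 0].
  have a2 : a = 2^-1.
    by apply: (mulIf ug); have := eu g; move: (u g) => z; lra.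
  apply: Or33; split=> //; rewrite /is_unit.
  transitivity (4 * \sum_g u g ^+ 2); last by rewrite a2 in ea; lra.
  by rewrite mulr_sumr; apply: eq_bigr => k _; ring.
have {}u0 g : u g = 0 by have := u0 g; rewrite negbK => /eqP.
rewrite big1 ?addr0 in ea; last by move=> g _; rewrite u0 expr0n.
have : a * (a - 1) = 0 by rewrite mulrBr mulr1 -expr2 ea subrr.
move/eqP; rewrite mulf_eq0 subr_eq0 => /orP[] /eqP ->.
  exact: Or31.
exact: Or32.
Qed.

Lemma bloch_zero (a : R) (u : vec) : a = 0 -> (forall g, u g = 0) -> bloch a u = 0.
Proof.
move=> -> u0; apply/matrixP; apply: forall_ord2; apply: forall_ord2.
all: by rewrite !mxE /= !u0 ?oppr0 ?addr0 ?subr0.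
Qed.

Variables (n : nat) (p : unitvec R -> bool -> 'I_n -> R) (eff : 'I_n -> 'M[C]_2) (r : R).
Hypothesis p_ge0 : forall x b i, 0 <= p x b i.
Hypothesis p_sum : forall x i, p x true i + p x false i = 1.
Hypothesis p_sim : forall x b, Pr r x b = \sum_i (p x b i)%:C *: eff i.
Hypothesis eff_sum : \sum_i eff i = 1%:M.

(** The half-traces [al] take values 0, 1/2, 1 and add up to 1. Either one outcome is the identity,
    answered deterministically, or two outcomes carry antipodal rank-one projections and the others
    vanish; then the responses to [Pr r x] are used with exchanged outcomes. *)
Lemma steer_response (A : finType) (M : A -> 'M[C]_2) :
  (forall a, adjmx (M a) = M a /\ M a *m M a = M a) -> \sum_a M a = 1%:M ->
  exists q : A -> 'I_n -> R,
    [/\ forall a i, 0 <= q a i, forall i, \sum_a q a i = 1 &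
        forall a, ptrA ((M a *t (1%:M : 'M[C]_2)) *m omega r) =
          \sum_i (2^-1 * q a i)%:C *: eff i].
Proof.
move=> Mproj Msum.
have ex a : exists au : R * vec, M a = bloch au.1 au.2 /\
    [\/ au.1 = 0 /\ (forall g, au.2 g = 0), au.1 = 1 /\ (forall g, au.2 g = 0) |
        au.1 = 2^-1 /\ is_unit (fun g => 2 * au.2 g)].
  have [h1 h2] := Mproj a; have [b [u [e k]]] := projection_bloch h1 h2.
  by exists (b, u).
have [f fP] := choice ex.
pose al a := (f a).1; pose U a := (f a).2.
have ME a : M a = bloch (al a) (U a) by case: (fP a).
have [al_sum U_sum] : \sum_a al a = 1 /\ forall g, \sum_a U a g = 0.
  have := bloch_linear (fun=> 1) al U; rewrite (eq_bigr M); last first.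
    by move=> a _; rewrite scale1r -ME.
  rewrite Msum -bloch1 => /bloch_inj[h1 h2]; split.
    by rewrite [RHS]h1; apply: eq_bigr => a _; rewrite mul1r.
  by move=> g; rewrite [RHS](h2 g); apply: eq_bigr => a _; rewrite mul1r.
have al_ge0 a : 0 <= al a.
  by rewrite /al; case: (fP a) => _ [[-> _]|[-> _]|[-> _]] //; lra.
have steer0 a : al a = 0 -> ptrA ((M a *t (1%:M : 'M[C]_2)) *m omega r) =
    \sum_i (2^-1 * 0)%:C *: eff i.
  move=> a0; rewrite big1; last by move=> i _; rewrite mulr0 scale0r.
  rewrite ME steer_bloch bloch_zero ?scaler0 // => g.
  move: a0; rewrite /al /U; case: (fP a) => _ [[_ ->]|[-> _]|[-> _]]; rewrite ?mulr0 //; lra.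
have [a1 a1n] : exists a, al a != 0.
  apply/existsP; apply/contraT; rewrite negb_exists => /forallP h.
  move: al_sum; rewrite big1 => [/eqP|a _]; first by rewrite eq_sym oner_eq0.
  by have := h a; rewrite negbK => /eqP.
have zero_rest (Q : pred A) : \sum_(a | Q a) al a = 0 -> forall a, Q a -> al a = 0.
  by move=> h a Qa; apply: (psumr_eq0P _ h).
move: (al_sum); rewrite (bigD1 a1) //= => rest.
case: (fP a1) => _ [[e _]|[e U1]|[e U1]].
- by move: a1n; rewrite /al e eqxx.
- exists (fun a _ => (a == a1)%:R); split; first by move=> a i; rewrite ler0n.
    by move=> i; rewrite (bigD1 a1) //= eqxx big1 ?addr0 // => a /negbTE ->.
  move=> a; case: (eqVneq a a1) => [->|na]; last first.
    by apply: steer0; apply: (zero_rest (fun a => a != a1)) => //; rewrite /al e in rest; lra.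
  rewrite ME steer_bloch (_ : bloch _ _ = 1%:M); last first.
    by rewrite -bloch1; apply: eq_bloch => // g; rewrite /U U1 mulr0.
  by rewrite -eff_sum scaler_sumr; apply: eq_bigr => i _; rewrite mulr1.
have rest2 : \sum_(a | a != a1) al a = 2^-1 by rewrite /al e in rest *; lra.
have [a2 /andP[a21 a2n]] : exists a, (a != a1) && (al a != 0).
  apply/existsP; apply/contraT; rewrite negb_exists => /forallP h.
  move: rest2; rewrite big1 => [|a na]; first by lra.
  by have := h a; rewrite na /= negbK => /eqP.
move: (rest2); rewrite (bigD1 a2) //= => rest3.
have rest3_ge0 : 0 <= \sum_(i | (i != a1) && (i != a2)) al i by exact: sumr_ge0.
have a2half : al a2 = 2^-1.
  move: a2n rest3; rewrite /al; case: (fP a2) => _ [[-> _]|[-> _]|[-> _]] //.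
    by rewrite eqxx.
  by move=> _ h; rewrite /al in rest3_ge0; lra.
have others a : a != a1 -> a != a2 -> al a = 0.
  move=> n1 n2; apply: (zero_rest (fun a => (a != a1) && (a != a2))); last by rewrite n1.
  by rewrite a2half in rest3; lra.
have U0 a : al a = 0 -> forall g, U a g = 0.
  by rewrite /al /U; case: (fP a) => _ [[_ h]|[-> _]|[-> _]] //; lra.
have U2 g : U a2 g = - U a1 g.
  have := U_sum g; rewrite (bigD1 a1) //= (bigD1 a2) //= big1 ?addr0.
    by lra.
  by move=> a /andP[n1 n2]; apply: U0; exact: others.
have unit1 : unit3 (2 * U a1 ord0, 2 * U a1 (inord 1), 2 * U a1 ord_max).
  move: U1; rewrite /is_unit !big_ord_recl big_ord0 /= addr0 addrA.
  have -> : lift ord0 ord0 = inord 1 :> 'I_3 by apply: val_inj; rewrite /= inordK.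
  by have -> : lift ord0 (lift ord0 ord0) = ord_max :> 'I_3 by apply: val_inj.
pose x : unitvec R := exist _ _ unit1.
have xE g : vec_of (sval x) g = 2 * U a1 g.
  have [E0 E1 E2] := vec_ofE (sval x); case: g => [[|[|[|//]]] hg].
  - by rewrite (_ : Ordinal hg = ord0) ?E0 //; apply: val_inj.
  - by rewrite (_ : Ordinal hg = inord 1) ?E1 //; apply: val_inj; rewrite /= inordK.
  - by rewrite (_ : Ordinal hg = ord_max) ?E2 //; apply: val_inj.
have steer_Pr a b : al a = 2^-1 -> (forall g, - r * U a g = (if b then r else - r) / 2 * vec_of (sval x) g) ->
    ptrA ((M a *t (1%:M : 'M[C]_2)) *m omega r) = \sum_i (2^-1 * p x b i)%:C *: eff i.
  move=> ha hU; rewrite ME steer_bloch (_ : bloch _ _ = Pr r x b); last first.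
    by rewrite Pr_bloch; apply: eq_bloch.
  rewrite p_sim scaler_sumr; apply: eq_bigr => i _.
  by rewrite scalerA rmorphM.
exists (fun a i => if a == a1 then p x false i else if a == a2 then p x true i else 0); split.
- by move=> a i; case: ifP => // _; case: ifP.
- move=> i; rewrite (bigD1 a1) //= (bigD1 a2) //= eqxx (negbTE a21) eqxx big1 ?addr0.
    by rewrite addrC p_sum.
  by move=> a /andP[/negbTE -> /negbTE ->].
move=> a; case: (eqVneq a a1) => [->|n1].
  by apply: steer_Pr => // g; rewrite xE; field.
case: (eqVneq a a2) => [->|n2].
  by apply: steer_Pr => // g; rewrite xE U2; field.
by apply: steer0; exact: others.
Qed.

End Steering.

(** * The main bound *)

Section Final.
Variable R : realType.
Local Notation vec := ('I_3 -> R).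

Lemma density_bloch (u : vec) : is_unit u -> density ((2^-1)%:C%C *: bloch 1 u).
Proof.
move=> u1; split; first by apply: psd_scale (psd_bloch u1); lra.
rewrite mxtraceZ /mxtrace !big_ord_recl big_ord0 addr0 !mxE /=.
by simpc; apply/eqP; rewrite eq_complex /=; apply/andP; split; apply/eqP; field.
Qed.

(** The local states are the normalised effects; the hidden variable has half their traces as
    distribution. *)
Lemma LHS_label (T : finType) (v : T -> vec) (w : T -> R) (r : R) :
  (forall t, is_unit (v t)) -> (forall t, 0 <= w t) -> \sum_t w t = 1 -> 0 <= r ->
  (forall m, is_unit m -> r <= width v w m) ->
  forall (X : Type) (A : finType) (M : X -> A -> 'M[R[i]]_2), projective M ->
  LHS_model #|label w| (assemblage (omega r) M).
Proof.
move=> v1 w0 w1 r0 wide X A M [Mproj Msum].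
have [p [p0 p1 pE]] := response_family w1 r0 wide.
have [_ eff1] := effect_povm v1 w0 w1.
have ex x := steer_response p0 p1 pE eff1 (Mproj x) (Msum x).
have [q qP] := choice ex.
exists (weight (w := w)), (fun k => (2^-1)%:C%C *: bloch 1 (direction v k)), q.
split; first exact: weight_ge0.
split; first exact: weight_sum.
split; first by move=> k; apply: density_bloch; exact: direction_unit.
split; first by move=> x a i; case: (qP x).
split; first by move=> x i; case: (qP x).
move=> x a; rewrite /assemblage; case: (qP x) => _ _ ->; apply: eq_bigr => k _.
rewrite /effect !scalerA -!rmorphM; congr (_ *: _); apply: (congr1 (real_complex R)).
by ring.
Qed.

Lemma Nmin_le (r : R) n : simulable r n -> (Nmin r <= n)%N.
Proof.
move=> h; rewrite /Nmin; case: pselect => [e|//].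
by case: ex_minnP => m _; apply; apply/asboolP.
Qed.

(** [rate] is the power -5/4 of [4 ^ k], expressed with integer exponents. *)
Lemma rate_pow k : rate R k ^+ 4 * (4 ^+ k) ^+ 5 = 1.
Proof.
have -> : (4 ^+ k) ^+ 5 = (2 ^+ (5 * k)) ^+ 2 :> R.
  have -> : 4 = 2 ^+ 2 :> R by ring.
  by rewrite -!exprM; congr (_ ^+ _); lia.
by rewrite (exprM _ 2 2) rate_sqr -exprMn mulVf ?expr1n ?expf_neq0.
Qed.

Lemma powR_inv_four_fifths (g : R) : 0 < g ->
  0 < g `^ (- (4 / 5)) /\ (g `^ (- (4 / 5))) ^+ 5 * g ^+ 4 = 1.
Proof.
move=> g0; split; first exact: powR_gt0.
rewrite -powR_mulrn ?powR_ge0 // -powRrM (_ : - (4 / 5) * 5 = - 4); last by field.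
by rewrite powRN powR_mulrn ?(ltW g0) // mulVf // expf_neq0 // gt_eqF.
Qed.

Lemma rate_small (e : R) : 0 < e -> exists k, rate R k <= e.
Proof.
move=> e0; pose k := (Num.truncn (1 / e)).+1; exists k.
have ke : 1 <= k%:R * e by rewrite -ler_pdivrMr // ltW // truncnS_gt.
have k2 : k%:R <= 2 ^+ k :> R by rewrite -natrX ler_nat ltnW // ltn_expl.
have rk : rate R k <= 2 ^- k.
  rewrite -(@ler_pXn2r _ 2) ?nnegrE ?invr_ge0 ?exprn_ge0 ?(ltW (rate_gt0 _ _)) //.
  rewrite rate_sqr exprVn -exprM lef_pV2 ?posrE ?exprn_gt0 //.
  by apply: ler_weXn2l; [lra|lia].
apply: (le_trans rk); rewrite -[leLHS]mul1r ler_pdivrMr ?exprn_gt0 //.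
apply: (le_trans ke); rewrite mulrC ler_pM2l //.
Qed.

(** For the least admissible [k > 0] the predecessor fails, and [g < C0 * rate R (k - 1)] bounds
    [4 ^ (k - 1)] after comparison of fifth powers; the factor 4 is the last scale. For [k = 0] the
    bound comes from [g <= 1]. *)
Lemma level_count (C0 g : R) : 0 < C0 -> 0 < g -> g <= 1 ->
  exists k, C0 * rate R k <= g /\ 4 ^+ k <= 4 * (C0 + 1) * g `^ (- (4 / 5)).
Proof.
move=> C00 g0 g1.
have [z0 z5] := powR_inv_four_fifths g0; set z := g `^ _ in z0 z5 *.
have ex : exists k, C0 * rate R k <= g.
  have [k hk] := rate_small (divr_gt0 g0 C00); exists k.
  by rewrite mulrC -ler_pdivlMr.
case: (ex_minnP ex) => k hk kmin; exists k; split=> //.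
have g4 : 0 < g ^+ 4 by rewrite exprn_gt0.
have z1 : 1 <= z.
  rewrite -(@ler_pXn2r _ 5) ?nnegrE ?(ltW z0) // expr1n -(ler_pM2r g4) z5 mul1r.
  by rewrite exprn_ile1 // ltW.
case: k hk kmin => [|j] hk kmin; first by rewrite expr0; nra.
have gj : g < C0 * rate R j.
  by rewrite ltNge; apply/negP => h; have := kmin j h; rewrite ltnn.
have e4 : g ^+ 4 <= C0 ^+ 4 * rate R j ^+ 4.
  rewrite -exprMn lerXn2r ?nnegrE ?(ltW g0) ?(ltW gj) //.
  by rewrite mulr_ge0 ?(ltW C00) ?(ltW (rate_gt0 _ _)).
have y0 : 0 < 4 ^+ j :> R by rewrite exprn_gt0.
have yj : 4 ^+ j <= (C0 + 1) * z.
  have Cz : 0 <= (C0 + 1) * z by rewrite mulr_ge0 ?(ltW z0) //; lra.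
  rewrite -(@ler_pXn2r _ 5) ?nnegrE ?(ltW y0) //.
  rewrite -(ler_pM2r g4) [((C0 + 1) * z) ^+ 5]exprMn -[leRHS]mulrA z5 mulr1.
  have y5 : 0 <= (4 ^+ j) ^+ 5 :> R by apply: exprn_ge0; exact: ltW.
  apply: (le_trans (ler_wpM2l y5 e4)).
  rewrite (_ : _ * (C0 ^+ 4 * _) = C0 ^+ 4 * (rate R j ^+ 4 * (4 ^+ j) ^+ 5)); last by ring.
  rewrite rate_pow mulr1; apply: (@le_trans _ _ ((C0 + 1) ^+ 4)).
    by rewrite lerXn2r ?nnegrE ?(ltW C00) //; lra.
  by rewrite [leRHS]exprSr ler_peMr ?exprn_ge0 //; lra.
by rewrite exprS -!mulrA ler_pM2l.
Qed.

End Final.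

Theorem theorem2 (R : realType) :
  exists Cst : R, 0 < Cst /\
    forall r : R, 0 <= r -> r < 2^-1 ->
      (exists n : nat, simulable r n) /\
      ((Nmin r)%:R <= Cst * (2^-1 - r) `^ (- (4 / 5))) /\
      (forall (X : Type) (A : finType) (M : X -> A -> 'M[R[i]]_2),
         projective M ->
         exists n : nat, LHS_model n (assemblage (omega r) M) /\
           (n%:R <= Cst * (2^-1 - r) `^ (- (4 / 5)))).
Proof.
have [C0 [C00 points]] := few_wide_points R.
have c0 : 0 < (432 * 2)%:R :> R by rewrite ltr0n.
exists ((432 * 2)%:R * (4 * (C0 + 1))); split.
  by rewrite mulr_gt0 // mulr_gt0 //; lra.
move=> r r0 r2; pose g := 2^-1 - r; have g0 : 0 < g by rewrite /g; lra.
have [k [kg k4]] := @level_count R C0 g C00 g0 ltac:(rewrite /g; lra).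
have [T [v [w [v1 w0 w1 wk wide]]]] := points k.
have wide_r m : is_unit m -> r <= width v w m.
  by move=> m1; apply: le_trans (wide m m1); rewrite /g in kg; lra.
have size : #|label w|%:R <= (432 * 2)%:R * (4 * (C0 + 1)) * g `^ (- (4 / 5)).
  rewrite card_label -mulrA; apply: le_trans (ler_wpM2l (ltW c0) k4).
  by rewrite -natrX -natrM ler_nat mulnAC leq_mul2r wk orbT.
have sim := simulable_label v1 w0 w1 r0 wide_r.
split; first by exists #|label w|.
split; first by apply: le_trans size; rewrite ler_nat; exact: Nmin_le.
move=> X A M proj; exists #|label w|; split=> //.
exact: LHS_label proj.
Qed.
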